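(* Let $A$ be a non-degenerate algebra over $\mathbb C$ with a regular coproduct $\Delta:A\to M(A\otimes A)$. Assume that there is an idempotent $E\in M(A\otimes A)$ with $$\Delta(A)(A\otimes A)=E(A\otimes A)\qquad\text{and}\qquad (A\otimes A)\Delta(A)=(A\otimes A)E,$$ satisfying $(\Delta\otimes\iota)E=(E\otimes 1)(1\otimes E)=(1\otimes E)(E\otimes 1)$, and that there are two algebras $B$ and $C$ sitting in $M(A)$ in a non-degenerate way such that $E$ is a regular separability idempotent in $M(B\otimes C)$. If there exist a left faithful set of left integrals and a right faithful set of right integrals on $A$, then $(A,\Delta)$ is a weak multiplier Hopf algebra. If there exist a faithful set of left integrals and a faithful set of right integrals on $A$, then $(A,\Delta)$ is a regular weak multiplier Hopf algebra.
   Context: Algebras are associative over $\mathbb C$, not necessarily unital. $A$ is non-degenerate if for $a\in A$: $ab=0$ for all $b$ implies $a=0$, and $ba=0$ for all $b$ implies $a=0$. $M(\cdot)$ denotes the multiplier algebra, $\otimes$ the algebraic tensor product, $\iota$ the identity map, $\zeta$ the flip. Products of subspaces denote linear spans of products. Canonical maps of $\Delta$: $T_1(a\otimes b)=\Delta(a)(1\otimes b)$, $T_2(c\otimes a)=(c\otimes 1)\Delta(a)$, $T_3(a\otimes b)=(1\otimes b)\Delta(a)$, $T_4(c\otimes a)=\Delta(a)(c\otimes 1)$. A canonical map is regular if its range lies in $A\otimes A$. A regular coproduct is an algebra homomorphism $\Delta:A\to M(A\otimes A)$ such that all four canonical maps are regular and which is coassociative: $(c\otimes 1\otimes 1)(\Delta\otimes\iota)(\Delta(a)(1\otimes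 b))=(\iota\otimes\Delta)((c\otimes 1)\Delta(a))(1\otimes 1\otimes b)$ for all $a,b,c\in A$. It is full if $A$ is the smallest subspace $V$ with $\Delta(a)(1\otimes b)\in V\otimes A$ for all $a,b$, and also the smallest subspace $W$ with $(c\otimes 1)\Delta(a)\in A\otimes W$ for all $a,c$. Fullness of $\Delta$ and $A^2=A$ are not assumed in the theorem. The idempotent $E$ is unique, satisfies $E\Delta(a)=\Delta(a)E=\Delta(a)$, and $\Delta\otimes\iota$, $\iota\otimes\Delta$ extend to homomorphisms $M(A\otimes A)\to M(A\otimes A\otimes A)$ (uniquely with $(\Delta\otimes\iota)(1)=E\otimes 1$, $(\iota\otimes\Delta)(1)=1\otimes E$); the formula for $(\Delta\otimes\iota)E$ uses this extension. $B,C$ sit in $M(A)$ in a non-degenerate way: they are subalgebras of $M(A)$ with $BA=AB=A$ and $CA=AC=A$. Then $B,C$ are non-degenerate and $M(B),M(C)\subseteq M(A)$, $M(B\otimes C)\subseteq M(A\otimes A)$. $E$ is a regular separability idempotent in $M(B\otimes C)$: $E\in M(B\otimes C)$ is idempotent; $E(b\otimes 1)$, $(b\otimes 1)E$, $E(1\otimes c)$, $(1\otimes c)E$ belong to $B\otimes C$ for all $b\in B$, $c\in C$; $E$ is full, i.e. $B$ and $C$ are the smallest subspaces containing respectively the left legs of all $E(1\otimes c)$, $(1\otimes c)E$ and the right legs of all $E(b\otimes 1)$, $(b\otimes 1)E$; and there are anti-isomorphisms $S_B:B\to C$, $S_C:C\to B$ with $E(b\otimes 1)=E(1\otimes S_B(b))$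 and $(1\otimes c)E=(S_C(c)\otimes 1)E$. Put $F_1=(\iota\otimes S_C)E$, $F_2=(S_B\otimes\iota)E$, $F_3=(\iota\otimes S_B^{-1})E$, $F_4=(S_C^{-1}\otimes\iota)E$; $F_1,F_3\in M(B\otimes B)$ and $F_2,F_4\in M(C\otimes C)$. Integrals: $(\iota\otimes\varphi)\Delta(a)$ is the multiplier of $A$ defined by $c\mapsto(\iota\otimes\varphi)(\Delta(a)(c\otimes 1))$ and $c\mapsto (\iota\otimes\varphi)((c\otimes 1)\Delta(a))$; similarly $(\psi\otimes\iota)\Delta(a)$. A left integral is a non-zero linear functional $\varphi$ on $A$ with $(\iota\otimes\varphi)\Delta(a)\in M(C)$ for all $a\in A$; a right integral is a non-zero linear functional $\psi$ with $(\psi\otimes\iota)\Delta(a)\in M(B)$ for all $a\in A$. The paper's convention is to consider only integrals that satisfy moreover, for all $a\in A$: $(\iota\otimes\varphi)\Delta(a)=(\iota\otimes\varphi)((1\otimes a)F_4)=(\iota\otimes\varphi)(F_2(1\otimes a))$, respectively $(\psi\otimes\iota)\Delta(a)=(\psi\otimes\iota)((a\otimes 1)F_1)=(\psi\otimes\iota)(F_3(a\otimes 1))$. A set $\mathcal F$ of linear functionals on $A$ is left faithful if, for $a\in A$, $\omega(ab)=0$ for all $b\in A$, $\omega\in\mathcal F$ implies $a=0$; right faithful if $\omega(ba)=0$ for all $b\in A$, $\omega\in\mathcal F$ implies $a=0$; faithful if both. Weak multiplier Hopf algebra: a pair $(A,\Delta)$ of a non-degenerate idempotent algebra ($A^2=A$)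 with a full coproduct with $T_1,T_2$ regular, such that there is an idempotent $E\in M(A\otimes A)$ with $T_1(A\otimes A)=E(A\otimes A)$, $T_2(A\otimes A)=(A\otimes A)E$, $(\Delta\otimes\iota)E=(E\otimes 1)(1\otimes E)=(1\otimes E)(E\otimes 1)$, and $\mathrm{Ker}(T_1)=(1-G_1)(A\otimes A)$, $\mathrm{Ker}(T_2)=(1-G_2)(A\otimes A)$, where $G_1,G_2:A\otimes A\to A\otimes A$ are the linear maps determined by $(G_1\otimes\iota)(\Delta_{13}(a)(1\otimes b\otimes c))=\Delta_{13}(a)(1\otimes E)(1\otimes b\otimes c)$ and $(\iota\otimes G_2)((a\otimes b\otimes 1)\Delta_{13}(c))=(a\otimes b\otimes 1)(E\otimes 1)\Delta_{13}(c)$. Here $\Delta_{13}(a)\in M(A\otimes A\otimes A)$ is $\Delta(a)$ with its legs in the first and third factor. It is regular if moreover $\Delta$ is a regular coproduct and $(A,\Delta^{\rm cop})$ with $\Delta^{\rm cop}=\zeta\Delta$ is also a weak multiplier Hopf algebra. *)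

(* Defs.v *)
From HB Require Import structures.
From mathcomp Require Import all_boot all_algebra.
From mathcomp Require Import generic_quotient boolp classical_sets reals.
From mathcomp Require Import complex.
Set Implicit Arguments.
Unset Strict Implicit.
Unset Printing Implicit Defensive.
Import GRing.Theory.
Local Open Scope ring_scope.
Local Open Scope classical_set_scope.
Local Open Scope quotient_scope.

HB.mixin Record Lmodule_isNUAlgebra (K : fieldType) A of GRing.Lmodule K A := {
  nmul : A -> A -> A;
  nmulA : associative nmul;
  nmulDl : left_distributive nmul +%R;
  nmulDr : right_distributive nmul +%R;
  nscaleAl : forall (k : K) a b, nmul (k *: a) b = k *: nmul a b;
  nscaleAr : forall (k : K) a b, nmul a (k *: b) = k *: nmul a b }.

(* Associative, not necessarily unital. *)
#[short(type="nuAlgType")]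
HB.structure Definition NUAlgebra (K : fieldType) :=
  {A of Lmodule_isNUAlgebra K A & GRing.Lmodule K A}.

Notation "a ** b" := (nmul a b) (at level 40, left associativity) : ring_scope.

Section Subspaces.
Variables (K : fieldType) (V : lmodType K).

Definition is_subspace (W : set V) : Prop :=
  W 0 /\ forall (k : K) u v, W u -> W v -> W (k *: u + v).

Definition lspan (S : set V) : set V :=
  [set v | exists n (k : 'I_n -> K) (x : 'I_n -> V),
      (forall i, S (x i)) /\ v = \sum_i k i *: x i].

End Subspaces.

Section Tensor.
Variables (K : fieldType) (A B : lmodType K).
Implicit Types (s t : seq (A * B)).

(* A list of pairs stands for the formal sum of its elementary tensors; [teq]
   is the additive congruence generated by the bilinearity relations. *)
Inductive teq : seq (A * B) -> seq (A * B) -> Prop :=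
| teq_refl s : teq s s
| teq_sym s t : teq s t -> teq t s
| teq_trans s t u : teq s t -> teq t u -> teq s u
| teq_cat s s' t t' : teq s s' -> teq t t' -> teq (s ++ t) (s' ++ t')
| teq_comm s t : teq (s ++ t) (t ++ s)
| teq_zero b : teq [:: (0, b)] [::]
| teq_addl a a' b : teq [:: (a + a', b)] [:: (a, b); (a', b)]
| teq_addr a b b' : teq [:: (a, b + b')] [:: (a, b); (a, b')]
| teq_scale k a b : teq [:: (k *: a, b)] [:: (a, k *: b)].

Definition teqb s t : bool := `[< teq s t >].

Lemma teqb_equiv : equiv_class_of teqb.
Proof.
split=> [s|s t|t s u].
- by apply/asboolP/teq_refl.
- by apply/asboolP/asboolP => /teq_sym.
- by move=> /asboolP st /asboolP tu; apply/asboolP/(teq_trans st tu).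
Qed.
Canonical teqb_equivRel := EquivRelPack teqb_equiv.

Definition tensor : Type := {eq_quot teqb}.
HB.instance Definition _ := Choice.on tensor.
HB.instance Definition _ := EqQuotient.on tensor.

Definition tpi s : tensor := \pi_tensor s.

Lemma tpiP s t : tpi s = tpi t <-> teq s t.
Proof. by split=> [/eqmodP/asboolP|st] //; apply/eqmodP/asboolP. Qed.

Lemma tpi_repr (x : tensor) : tpi (repr x) = x.
Proof. exact: reprK. Qed.

Lemma repr_tpi s : teq (repr (tpi s)) s.
Proof. by apply/tpiP; rewrite tpi_repr. Qed.

Lemma tpiW (P : tensor -> Prop) : (forall s, P (tpi s)) -> forall x, P x.
Proof. by move=> h x; rewrite -(tpi_repr x). Qed.

Definition smap (k : K) s := [seq (k *: p.1, p.2) | p <- s].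

Lemma teq_smap k s t : teq s t -> teq (smap k s) (smap k t).
Proof.
elim=> {s t} => [s|s t _|s t u _ IH1 _|s s' t t' _ IH1 _ IH2|s t|b|a a' b|a b b'|l a b].
- exact: teq_refl.
- exact: teq_sym.
- exact: teq_trans.
- by rewrite /smap !map_cat; apply: teq_cat.
- by rewrite /smap !map_cat; apply: teq_comm.
- by rewrite /= scaler0; apply: teq_zero.
- by rewrite /= scalerDr; apply: teq_addl.
- exact: teq_addr.
- by rewrite /= scalerA mulrC -scalerA; apply: teq_scale.
Qed.

Definition tadd (x y : tensor) := tpi (repr x ++ repr y).
Definition tscale k (x : tensor) := tpi (smap k (repr x)).

Lemma taddE s t : tadd (tpi s) (tpi t) = tpi (s ++ t).
Proof. by apply/tpiP/teq_cat; apply: repr_tpi. Qed.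
Lemma tscaleE k s : tscale k (tpi s) = tpi (smap k s).
Proof. by apply/tpiP/teq_smap/repr_tpi. Qed.

Lemma taddA : associative tadd.
Proof.
by elim/tpiW=> s; elim/tpiW=> t; elim/tpiW=> u; rewrite !taddE catA.
Qed.
Lemma taddC : commutative tadd.
Proof.
by elim/tpiW=> s; elim/tpiW=> t; rewrite !taddE; apply/tpiP/teq_comm.
Qed.
Lemma tadd0 : left_id (tpi [::]) tadd.
Proof. by elim/tpiW=> s; rewrite taddE. Qed.

Lemma tscaleDl k l x : tscale (k + l) x = tadd (tscale k x) (tscale l x).
Proof.
have consE p s : tpi (p :: s) = tadd (tpi [:: p]) (tpi s) by rewrite taddE.
elim/tpiW: x => s; rewrite !tscaleE; elim: s => [|[a b] s IH].
  by rewrite taddE.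
rewrite /= (consE _ (smap (k + l) s)) (consE _ (smap k s)) (consE _ (smap l s)).
rewrite IH scalerDl.
have -> : tpi [:: (k *: a + l *: a, b)] =
          tadd (tpi [:: (k *: a, b)]) (tpi [:: (l *: a, b)]).
  by rewrite taddE; apply/tpiP/teq_addl.
by rewrite -!taddA; congr tadd; rewrite !taddA; congr tadd; exact: taddC.
Qed.

Lemma tscale0 x : tscale 0 x = tpi [::].
Proof.
elim/tpiW: x => s; rewrite tscaleE; elim: s => [|[a b] s IH] //=.
rewrite -[tpi (_ :: _)]/(tpi ([:: (0 *: a, b)] ++ smap 0 s)) -taddE IH.
by rewrite taddE cats0 scale0r; apply/tpiP/teq_zero.
Qed.

Lemma tscale1 : left_id 1 tscale.
Proof.
elim/tpiW=> s; rewrite tscaleE /smap; congr tpi; rewrite -[RHS]map_id.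
by apply: eq_map => -[a b] /=; rewrite scale1r.
Qed.

Lemma taddN : left_inverse (tpi [::]) (tscale (-1)) tadd.
Proof. by move=> x; rewrite -[x in tadd _ x]tscale1 -tscaleDl addNr tscale0. Qed.

HB.instance Definition _ := GRing.isZmodule.Build tensor taddA taddC tadd0 taddN.

Lemma tscaleA k l x : tscale k (tscale l x) = tscale (k * l) x.
Proof.
elim/tpiW: x => s; rewrite !tscaleE /smap -map_comp; congr tpi.
by apply: eq_map => -[a b] /=; rewrite scalerA.
Qed.
Lemma tscaleDr : right_distributive tscale +%R.
Proof.
move=> k; elim/tpiW=> s; elim/tpiW=> t.
have addE u v : tpi u + tpi v = tpi (u ++ v) by exact: taddE.
by rewrite addE !tscaleE addE /smap map_cat.
Qed.

HB.instance Definition _ := GRing.Zmodule_isLmodule.Build K tensor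
  tscaleA tscale1 tscaleDr (fun x k l => tscaleDl k l x).

Definition tens (a : A) (b : B) : tensor := tpi [:: (a, b)].

Definition bilin (V : lmodType K) (f : A -> B -> V) : Prop :=
  (forall b, linear (f^~ b)) /\ (forall a, linear (f a)).

(* The linear map on the tensor product induced by a bilinear map [f] (it is
   independent of the chosen representatives only when [f] is bilinear). *)
Definition tlift (V : lmodType K) (f : A -> B -> V) (x : tensor) : V :=
  \sum_(p <- repr x) f p.1 p.2.

End Tensor.

Arguments tensor {K} (A B)%_type.
Notation "A ⊗ B" := (tensor A B) (at level 40, left associativity) : type_scope.
Notation "a ⊗ b" := (tens a b) (at level 40, left associativity) : ring_scope.

Section TensorTheory.
Variables (K : fieldType) (A B : lmodType K).
Implicit Types (V : lmodType K) (x y : (A ⊗ B)%type).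

Lemma tens_bilin : bilin (@tens K A B).
Proof.
split=> [b k a a'|a k b b'].
- rewrite {2}/GRing.scale /= {2}/GRing.add /= tscaleE taddE.
  exact/tpiP/teq_addl.
- rewrite {2}/GRing.scale /= {2}/GRing.add /= tscaleE taddE.
  apply/tpiP/(teq_trans (teq_addr _ _ _)).
  exact/(@teq_cat _ _ _ [:: _] [:: _] [:: _] [:: _])/teq_refl/teq_sym/teq_scale.
Qed.

Lemma tensor_ind (P : A ⊗ B -> Prop) :
  P 0 -> (forall a b x, P x -> P (a ⊗ b + x)) -> forall x, P x.
Proof.
move=> P0 PD; elim/tpiW; elim=> [|[a b] s IH] //.
by have := PD a b _ IH; rewrite /GRing.add /= taddE.
Qed.

Section Lift.
Variables (V : lmodType K) (f : A -> B -> V).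
Hypothesis f_bilin : bilin f.

Lemma bilinDl a a' b : f (a + a') b = f a b + f a' b.
Proof. by have := f_bilin.1 b 1 a a'; rewrite !scale1r. Qed.
Lemma bilinDr a b b' : f a (b + b') = f a b + f a b'.
Proof. by have := f_bilin.2 a 1 b b'; rewrite !scale1r. Qed.
Lemma bilin0l b : f 0 b = 0.
Proof. by apply: (addrI (f 0 b)); rewrite -bilinDl !addr0. Qed.
Lemma bilin0r a : f a 0 = 0.
Proof. by apply: (addrI (f a 0)); rewrite -bilinDr !addr0. Qed.
Lemma bilinZl k a b : f (k *: a) b = k *: f a b.
Proof. by have := f_bilin.1 b k a 0; rewrite !addr0 bilin0l addr0. Qed.
Lemma bilinZr k a b : f a (k *: b) = k *: f a b.
Proof. by have := f_bilin.2 a k b 0; rewrite !addr0 bilin0r addr0. Qed.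

Lemma teq_sum s t :
  teq s t -> \sum_(p <- s) f p.1 p.2 = \sum_(p <- t) f p.1 p.2.
Proof.
elim=> {s t} [s|s t _|s t u _ IH1 _|s s' t t' _ IH1 _ IH2|s t|b|a a' b|a b b'|l a b] //.
- by rewrite IH1.
- by rewrite !big_cat /= IH1 IH2.
- by rewrite !big_cat /= addrC.
- by rewrite big_seq1 big_nil bilin0l.
- by rewrite !big_cons !big_nil /= !addr0 bilinDl.
- by rewrite !big_cons !big_nil /= !addr0 bilinDr.
- by rewrite !big_seq1 bilinZl bilinZr.
Qed.

Lemma tlift_tpi s : tlift f (tpi s) = \sum_(p <- s) f p.1 p.2.
Proof. exact/teq_sum/repr_tpi. Qed.

Lemma tliftE a b : tlift f (a ⊗ b) = f a b.
Proof. by rewrite tlift_tpi big_seq1. Qed.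

Lemma tlift_linear : linear (tlift f).
Proof.
move=> k; elim/tpiW=> s; elim/tpiW=> t.
rewrite {1}/GRing.scale /= {1}/GRing.add /= tscaleE taddE !tlift_tpi.
rewrite big_cat big_map /=; congr (_ + _); rewrite scaler_sumr.
by apply: eq_bigr => p _; rewrite bilinZl.
Qed.

End Lift.

Lemma linear_tensor_ext V (f g : A ⊗ B -> V) : linear f -> linear g ->
  (forall a b, f (a ⊗ b) = g (a ⊗ b)) -> f =1 g.
Proof.
move=> lf lg fg.
have add0 h : linear h -> h 0 = 0 :> V.
  move=> lh; have := lh 1 0 0; rewrite !scale1r addr0 => /(congr1 (+%R^~ (- h 0))).
  by rewrite addrK subrr.
elim/tensor_ind=> [|a b x IH]; first by rewrite !add0.
by have := lf 1 (a ⊗ b) x; have := lg 1 (a ⊗ b) x; rewrite !scale1r => -> ->;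
  rewrite fg IH.
Qed.

End TensorTheory.

Section LinearFacts.
Variables (K : fieldType) (U V : lmodType K) (f : U -> V).
Hypothesis f_lin : linear f.

Lemma linD u v : f (u + v) = f u + f v.
Proof. by have := f_lin 1 u v; rewrite !scale1r. Qed.
Lemma lin0 : f 0 = 0.
Proof. by apply: (addrI (f 0)); rewrite -linD !addr0. Qed.
Lemma linZ k u : f (k *: u) = k *: f u.
Proof. by have := f_lin k u 0; rewrite lin0 !addr0. Qed.

End LinearFacts.

Lemma linear_comp (K : fieldType) (U V W : lmodType K) (g : V -> W)
  (f : U -> V) : linear g -> linear f -> linear (g \o f).
Proof. by move=> lg lf k u v /=; rewrite lf lg. Qed.

Lemma linear_id (K : fieldType) (U : lmodType K) : linear (@id U).
Proof. by []. Qed.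

Section TensorMap.
Variables (K : fieldType).

Lemma tlift_funP (A B V : lmodType K) (k : K) (f g : A -> B -> V) x :
  tlift (fun a b => k *: f a b + g a b) x = k *: tlift f x + tlift g x.
Proof. by rewrite /tlift big_split scaler_sumr. Qed.

Definition tmap (A B A' B' : lmodType K) (f : A -> A') (g : B -> B') :
  A ⊗ B -> A' ⊗ B' := tlift (fun a b => f a ⊗ g b).

Variables (A B A' B' : lmodType K) (f : A -> A') (g : B -> B').
Hypotheses (f_lin : linear f) (g_lin : linear g).

Lemma tmap_bilin : bilin (fun a b => f a ⊗ g b).
Proof.
by split=> [b k a a'|a k b b'] /=;
  rewrite ?f_lin ?g_lin; [apply: (tens_bilin _ _).1 | apply: (tens_bilin _ _).2].
Qed.
Lemma tmapE a b : tmap f g (a ⊗ b) = f a ⊗ g b.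
Proof. exact/tliftE/tmap_bilin. Qed.
Lemma tmap_linear : linear (tmap f g).
Proof. exact/tlift_linear/tmap_bilin. Qed.

End TensorMap.

Section TensorAlgebra.
Variables (K : fieldType) (A B : nuAlgType K).
Implicit Types (x y z : (A ⊗ B)%type).

Definition tmul x y : A ⊗ B :=
  tlift (fun a b => tmap (nmul a) (nmul b) y) x.

Lemma nmull_linear (C : nuAlgType K) (a : C) : linear (nmul a).
Proof. by move=> k u v; rewrite nmulDr nscaleAr. Qed.
Lemma nmulr_linear (C : nuAlgType K) (a : C) : linear (fun b => nmul b a).
Proof. by move=> k u v; rewrite nmulDl nscaleAl. Qed.

Lemma tmul_bilin y : bilin (fun a b => tmap (nmul a) (nmul b) y).
Proof.
split=> [b k a a'|a k b b']; rewrite /tmap -tlift_funP; congr (tlift _ y);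
  apply/funext => u; apply/funext => v.
- by rewrite nmulDl nscaleAl (tens_bilin _ _).1.
- by rewrite nmulDl nscaleAl (tens_bilin _ _).2.
Qed.

Lemma tmulr_linear y : linear (fun x => tmul x y).
Proof. exact/tlift_linear/tmul_bilin. Qed.

Lemma tmull_linear x : linear (tmul x).
Proof.
move=> k y z; rewrite /tmul -tlift_funP; congr (tlift _ x).
apply/funext => a; apply/funext => b.
by rewrite tmap_linear //; apply: nmull_linear.
Qed.

Lemma tmulE a b a' b' : tmul (a ⊗ b) (a' ⊗ b') = (a ** a') ⊗ (b ** b').
Proof.
rewrite /tmul tliftE; last exact: tmul_bilin.
by rewrite tmapE //; apply: nmull_linear.
Qed.

Lemma tmulDl : left_distributive tmul +%R.
Proof. by move=> x y z; rewrite (linD (tmulr_linear z)). Qed.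
Lemma tmulDr : right_distributive tmul +%R.
Proof. by move=> x y z; rewrite (linD (tmull_linear x)). Qed.
Lemma tmulZl (k : K) x y : tmul (k *: x) y = k *: tmul x y.
Proof. by rewrite (linZ (tmulr_linear y)). Qed.
Lemma tmulZr (k : K) x y : tmul x (k *: y) = k *: tmul x y.
Proof. by rewrite (linZ (tmull_linear x)). Qed.
Lemma tmul0 x : tmul x 0 = 0.
Proof. exact: lin0 (tmull_linear x). Qed.
Lemma t0mul x : tmul 0 x = 0.
Proof. exact: lin0 (tmulr_linear x). Qed.

Lemma tmulA : associative tmul.
Proof.
elim/tensor_ind=> [|a b x IH] y z; first by rewrite !t0mul.
rewrite !tmulDl IH; congr (_ + _) => {x IH}; elim/tensor_ind: y => [|a' b' y IH].
  by rewrite !(t0mul, tmul0).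
rewrite tmulDr !tmulDl tmulDr IH; congr (_ + _) => {y IH}.
elim/tensor_ind: z => [|a2 b2 z IH]; first by rewrite !tmul0.
by rewrite !tmulDr IH !tmulE !nmulA.
Qed.

HB.instance Definition _ := Lmodule_isNUAlgebra.Build K (A ⊗ B)%type
  tmulA tmulDl tmulDr tmulZl tmulZr.

Lemma tens_mul (a a' : A) (b b' : B) :
  (a ⊗ b) ** (a' ⊗ b') = (a ** a') ⊗ (b ** b').
Proof. exact: tmulE. Qed.

End TensorAlgebra.

Lemma nmul0 (K : fieldType) (A : nuAlgType K) (a : A) : a ** 0 = 0.
Proof. exact: lin0 (nmull_linear a). Qed.
Lemma n0mul (K : fieldType) (A : nuAlgType K) (a : A) : 0 ** a = 0.
Proof. exact: lin0 (nmulr_linear a). Qed.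

#[local] Obligation Tactic := idtac.

Section Multiplier.
Variables (K : fieldType) (A : nuAlgType K).

(* [ml m a] is the product m a and [mr m a] is the product a m. *)
Record multiplier := Multiplier {
  ml : A -> A;
  mr : A -> A;
  ml_linear : linear ml;
  mr_linear : linear mr;
  ml_mul : forall a b, ml (a ** b) = ml a ** b;
  mr_mul : forall a b, mr (a ** b) = a ** mr b;
  mlr : forall a b, a ** ml b = mr a ** b }.

Lemma multiplierP m n : ml m =1 ml n -> mr m =1 mr n -> m = n.
Proof.
case: m n => [l r l1 r1 l2 r2 lr] [l' r' l1' r1' l2' r2' lr'] /= /funext el /funext er.
by subst l' r'; congr Multiplier; exact: Prop_irrelevance.
Qed.

HB.instance Definition _ := gen_eqMixin multiplier.
HB.instance Definition _ := gen_choiceMixin multiplier.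

Program Definition mzero := @Multiplier (fun=> 0) (fun=> 0) _ _ _ _ _.
Next Obligation. by move=> k u v /=; rewrite scaler0 addr0. Qed.
Next Obligation. by move=> k u v /=; rewrite scaler0 addr0. Qed.
Next Obligation. by move=> a b /=; rewrite n0mul. Qed.
Next Obligation. by move=> a b /=; rewrite nmul0. Qed.
Next Obligation. by move=> a b /=; rewrite nmul0 n0mul. Qed.

Definition mone : multiplier :=
  @Multiplier id id (fun _ _ _ => erefl) (fun _ _ _ => erefl)
    (fun _ _ => erefl) (fun _ _ => erefl) (fun _ _ => erefl).

Program Definition madd m n :=
  @Multiplier (fun a => ml m a + ml n a) (fun a => mr m a + mr n a) _ _ _ _ _.
Next Obligation.
by move=> m n k u v; rewrite !ml_linear scalerDr !addrA; congr (_ + _); rewrite addrAC.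
Qed.
Next Obligation.
by move=> m n k u v; rewrite !mr_linear scalerDr !addrA; congr (_ + _); rewrite addrAC.
Qed.
Next Obligation. by move=> m n a b /=; rewrite !ml_mul nmulDl. Qed.
Next Obligation. by move=> m n a b /=; rewrite !mr_mul nmulDr. Qed.
Next Obligation. by move=> m n a b /=; rewrite nmulDl nmulDr !mlr. Qed.

Program Definition mscale (k : K) m :=
  @Multiplier (fun a => k *: ml m a) (fun a => k *: mr m a) _ _ _ _ _.
Next Obligation.
by move=> k m l u v; rewrite !ml_linear scalerDr !scalerA mulrC.
Qed.
Next Obligation.
by move=> k m l u v; rewrite !mr_linear scalerDr !scalerA mulrC.
Qed.
Next Obligation. by move=> k m a b /=; rewrite ml_mul nscaleAl. Qed.
Next Obligation. by move=> k m a b /=; rewrite mr_mul nscaleAr. Qed.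
Next Obligation. by move=> k m a b /=; rewrite nscaleAl nscaleAr mlr. Qed.

Program Definition mmul m n :=
  @Multiplier (fun a => ml m (ml n a)) (fun a => mr n (mr m a)) _ _ _ _ _.
Next Obligation. by move=> m n k u v /=; rewrite !ml_linear. Qed.
Next Obligation. by move=> m n k u v /=; rewrite !mr_linear. Qed.
Next Obligation. by move=> m n a b /=; rewrite !ml_mul. Qed.
Next Obligation. by move=> m n a b /=; rewrite !mr_mul. Qed.
Next Obligation. by move=> m n a b /=; rewrite !mlr. Qed.

Lemma maddA : associative madd.
Proof. by move=> m n p; apply: multiplierP => a /=; rewrite addrA. Qed.
Lemma maddC : commutative madd.
Proof. by move=> m n; apply: multiplierP => a /=; rewrite addrC. Qed.
Lemma madd0 : left_id mzero madd.
Proof. by move=> m; apply: multiplierP => a /=; rewrite add0r. Qed.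
Lemma maddN : left_inverse mzero (mscale (-1)) madd.
Proof. by move=> m; apply: multiplierP => a /=; rewrite scaleN1r addNr. Qed.
HB.instance Definition _ :=
  GRing.isZmodule.Build multiplier maddA maddC madd0 maddN.

Lemma mscaleA k l m : mscale k (mscale l m) = mscale (k * l) m.
Proof. by apply: multiplierP => a /=; rewrite scalerA. Qed.
Lemma mscale1 : left_id 1 mscale.
Proof. by move=> m; apply: multiplierP => a /=; rewrite scale1r. Qed.
Lemma mscaleDr : right_distributive mscale +%R.
Proof. by move=> k m n; apply: multiplierP => a /=; rewrite scalerDr. Qed.
Lemma mscaleDl m : {morph mscale^~ m : k l / k + l}.
Proof. by move=> k l; apply: multiplierP => a /=; rewrite scalerDl. Qed.
HB.instance Definition _ := GRing.Zmodule_isLmodule.Build K multiplier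
  mscaleA mscale1 mscaleDr mscaleDl.

Lemma mmulA : associative mmul.
Proof. by move=> m n p; apply: multiplierP. Qed.
Lemma m1mul : left_id mone mmul.
Proof. by move=> m; apply: multiplierP. Qed.
Lemma mmul1 : right_id mone mmul.
Proof. by move=> m; apply: multiplierP. Qed.
Lemma mmulDl : left_distributive mmul +%R.
Proof.
by move=> m n p; apply: multiplierP => a //=; rewrite (linD (mr_linear p)).
Qed.
Lemma mmulDr : right_distributive mmul +%R.
Proof.
by move=> m n p; apply: multiplierP => a //=; rewrite (linD (ml_linear m)).
Qed.
HB.instance Definition _ := GRing.Zmodule_isPzRing.Build multiplier
  mmulA m1mul mmul1 mmulDl mmulDr.

Program Definition emb (a : A) :=
  @Multiplier (fun b => a ** b) (fun b => b ** a) _ _ _ _ _.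
Next Obligation. exact: nmull_linear. Qed.
Next Obligation. exact: nmulr_linear. Qed.
Next Obligation. by move=> a b c /=; rewrite nmulA. Qed.
Next Obligation. by move=> a b c /=; rewrite nmulA. Qed.
Next Obligation. by move=> a b c /=; rewrite nmulA. Qed.

Definition nondegenerate_alg : Prop :=
  (forall a : A, (forall b, a ** b = 0) -> a = 0) /\
  (forall a : A, (forall b, b ** a = 0) -> a = 0).

Definition idempotent_alg : Prop :=
  lspan [set x | exists a b : A, x = a ** b] = setT.

End Multiplier.

Arguments multiplier {K} A%_type.

Section MultiplierTensor.
Variables (K : fieldType) (A B : nuAlgType K).

Program Definition mtens (m : multiplier A) (n : multiplier B) :
    multiplier (A ⊗ B) :=
  @Multiplier _ _ (tmap (ml m) (ml n)) (tmap (mr m) (mr n)) _ _ _ _ _.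
Next Obligation. by move=> m n; apply: tmap_linear; apply: ml_linear. Qed.
Next Obligation. by move=> m n; apply: tmap_linear; apply: mr_linear. Qed.
Next Obligation.
move=> m n x y; have lt := tmap_linear (@ml_linear _ _ m) (@ml_linear _ _ n).
elim/tensor_ind: x => [|a b x IH].
  by rewrite n0mul !(lin0 lt) n0mul.
rewrite nmulDl !(linD lt) nmulDl IH; congr (_ + _) => {x IH}.
elim/tensor_ind: y => [|a' b' y IH']; first by rewrite !nmul0 (lin0 lt).
rewrite !nmulDr (linD lt) IH' tens_mul !tmapE ?tens_mul ?ml_mul //; exact: ml_linear.
Qed.
Next Obligation.
move=> m n x y; have lt := tmap_linear (@mr_linear _ _ m) (@mr_linear _ _ n).
elim/tensor_ind: y => [|a b y IH].
  by rewrite nmul0 !(lin0 lt) nmul0.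
rewrite nmulDr !(linD lt) nmulDr IH; congr (_ + _) => {y IH}.
elim/tensor_ind: x => [|a' b' x IH']; first by rewrite !n0mul (lin0 lt).
rewrite !nmulDl (linD lt) IH' tens_mul !tmapE ?tens_mul ?mr_mul //; exact: mr_linear.
Qed.
Next Obligation.
move=> m n x y; have lt := tmap_linear (@ml_linear _ _ m) (@ml_linear _ _ n).
have rt := tmap_linear (@mr_linear _ _ m) (@mr_linear _ _ n).
elim/tensor_ind: x => [|a b x IH].
  by rewrite (lin0 rt) !n0mul.
rewrite nmulDl (linD rt) nmulDl IH; congr (_ + _) => {x IH}.
elim/tensor_ind: y => [|a' b' y IH']; first by rewrite (lin0 lt) !nmul0.
rewrite (linD lt) !nmulDr IH' !tmapE ?tens_mul ?mlr //;
  first [exact: mr_linear | exact: ml_linear].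
Qed.

End MultiplierTensor.

Section Trilinear.
Variables (K : fieldType) (X Y Z V : lmodType K).

Definition trilin (g : X -> Y -> Z -> V) : Prop :=
  [/\ forall y z, linear (fun x => g x y z),
      forall x z, linear (fun y => g x y z) &
      forall x y, linear (g x y)].

Definition tliftl g : X ⊗ Y ⊗ Z -> V :=
  tlift (fun t z => tlift (fun x y => g x y z) t).
Definition tliftr g : X ⊗ (Y ⊗ Z) -> V :=
  tlift (fun x t => tlift (g x) t).

Variable g : X -> Y -> Z -> V.
Hypothesis g_tri : trilin g.

Let bil_l z : bilin (fun x y => g x y z).
Proof. by case: g_tri => g1 g2 g3; split. Qed.
Let bil_r x : bilin (g x).
Proof. by case: g_tri => g1 g2 g3; split. Qed.

Lemma tliftl_bilin : bilin (fun t z => tlift (fun x y => g x y z) t).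
Proof.
case: g_tri => g1 g2 g3; split=> [z|t k z z']; first exact/tlift_linear.
rewrite -tlift_funP; congr (tlift _ t).
by apply/funext => x; apply/funext => y; rewrite g3.
Qed.

Lemma tliftr_bilin : bilin (fun x t => tlift (g x) t).
Proof.
case: g_tri => g1 g2 g3; split=> [t k x x'|x]; last exact/tlift_linear.
rewrite -tlift_funP; congr (tlift _ t).
by apply/funext => y; apply/funext => z; rewrite g1.
Qed.

Lemma tliftl_linear : linear (tliftl g).
Proof. exact/tlift_linear/tliftl_bilin. Qed.
Lemma tliftr_linear : linear (tliftr g).
Proof. exact/tlift_linear/tliftr_bilin. Qed.
Lemma tliftlE x y z : tliftl g (x ⊗ y ⊗ z) = g x y z.
Proof. by rewrite /tliftl tliftE ?tliftE //; exact: tliftl_bilin. Qed.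
Lemma tliftrE x y z : tliftr g (x ⊗ (y ⊗ z)) = g x y z.
Proof. by rewrite /tliftr tliftE ?tliftE //; exact: tliftr_bilin. Qed.

End Trilinear.

Section TensorExt.
Variables (K : fieldType) (X Y Z V : lmodType K).

Lemma ext3l (f g : X ⊗ Y ⊗ Z -> V) : linear f -> linear g ->
  (forall x y z, f (x ⊗ y ⊗ z) = g (x ⊗ y ⊗ z)) -> f =1 g.
Proof.
move=> lf lg fg; apply: linear_tensor_ext => // t z.
apply: (linear_tensor_ext (f := fun t => f (t ⊗ z)) (g := fun t => g (t ⊗ z))) => //.
- by move=> k u v; rewrite (tens_bilin _ _).1 lf.
- by move=> k u v; rewrite (tens_bilin _ _).1 lg.
Qed.

Lemma ext3r (f g : X ⊗ (Y ⊗ Z) -> V) : linear f -> linear g ->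
  (forall x y z, f (x ⊗ (y ⊗ z)) = g (x ⊗ (y ⊗ z))) -> f =1 g.
Proof.
move=> lf lg fg; apply: linear_tensor_ext => // x t.
apply: (linear_tensor_ext (f := fun t => f (x ⊗ t)) (g := fun t => g (x ⊗ t))) => //.
- by move=> k u v; rewrite (tens_bilin _ _).2 lf.
- by move=> k u v; rewrite (tens_bilin _ _).2 lg.
Qed.

End TensorExt.

Section Iso.
Variables (K : fieldType).

Record nuiso (X Y : nuAlgType K) := NUIso {
  iso_to : X -> Y;
  iso_inv : Y -> X;
  iso_to_linear : linear iso_to;
  iso_inv_linear : linear iso_inv;
  iso_mul : forall x y, iso_to (x ** y) = iso_to x ** iso_to y;
  iso_toK : cancel iso_to iso_inv;
  iso_invK : cancel iso_inv iso_to }.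

Arguments nuiso (X Y)%_type.

Lemma iso_inv_mul X Y (f : nuiso X Y) x y :
  iso_inv f (x ** y) = iso_inv f x ** iso_inv f y.
Proof. by apply: (can_inj (iso_toK f)); rewrite iso_mul !iso_invK. Qed.

Program Definition mpull X Y (f : nuiso X Y) (m : multiplier Y) : multiplier X :=
  @Multiplier K X (fun x => iso_inv f (ml m (iso_to f x)))
    (fun x => iso_inv f (mr m (iso_to f x))) _ _ _ _ _.
Next Obligation.
by move=> X Y f m k u v; rewrite iso_to_linear ml_linear iso_inv_linear.
Qed.
Next Obligation.
by move=> X Y f m k u v; rewrite iso_to_linear mr_linear iso_inv_linear.
Qed.
Next Obligation.
by move=> X Y f m a b /=; rewrite iso_mul ml_mul iso_inv_mul iso_toK.
Qed.
Next Obligation.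
by move=> X Y f m a b /=; rewrite iso_mul mr_mul iso_inv_mul iso_toK.
Qed.
Next Obligation.
move=> X Y f m a b /=; rewrite -{1}[a](iso_toK f) -{2}[b](iso_toK f).
by rewrite -!iso_inv_mul mlr.
Qed.


Section Flip.
Variables X Y : nuAlgType K.

Lemma flip_bilin : bilin (fun (x : X) (y : Y) => y ⊗ x).
Proof. by split=> [y|x]; [apply: (tens_bilin _ _).2|apply: (tens_bilin _ _).1]. Qed.

Definition tflip : X ⊗ Y -> Y ⊗ X := tlift (fun x y => y ⊗ x).

Lemma tflip_linear : linear tflip.
Proof. exact/tlift_linear/flip_bilin. Qed.
Lemma tflipE x y : tflip (x ⊗ y) = y ⊗ x.
Proof. exact/tliftE/flip_bilin. Qed.
Lemma tflip_mul u v : tflip (u ** v) = tflip u ** tflip v.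
Proof.
apply: (linear_tensor_ext (f := fun u => tflip (u ** v))
  (g := fun u => tflip u ** tflip v)) => [k a b|k a b|x y].
- by rewrite nmulDl nscaleAl tflip_linear.
- by rewrite tflip_linear nmulDl nscaleAl.
apply: (linear_tensor_ext (f := fun v => tflip (x ⊗ y ** v))
  (g := fun v => tflip (x ⊗ y) ** tflip v)) => [k a b|k a b|x' y'].
- by rewrite nmulDr nscaleAr tflip_linear.
- by rewrite tflip_linear nmulDr nscaleAr.
by rewrite !(tens_mul, tflipE).
Qed.

End Flip.

Lemma tflipK (X Y : nuAlgType K) : cancel (@tflip X Y) (@tflip Y X).
Proof.
apply: (linear_tensor_ext (f := @tflip Y X \o @tflip X Y) (g := id)) => //.
  by apply: linear_comp; apply: tflip_linear.
by move=> a b /=; rewrite !tflipE.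
Qed.

Definition flip_iso (X Y : nuAlgType K) : nuiso (X ⊗ Y) (Y ⊗ X) :=
  NUIso (@tflip_linear X Y) (@tflip_linear Y X) (@tflip_mul X Y)
    (@tflipK X Y) (@tflipK Y X).

Lemma mul_ext3l (X Y Z U : nuAlgType K) (f : X ⊗ Y ⊗ Z -> U) : linear f ->
  (forall x y z x' y' z',
     f ((x ⊗ y ⊗ z) ** (x' ⊗ y' ⊗ z')) = f (x ⊗ y ⊗ z) ** f (x' ⊗ y' ⊗ z')) ->
  forall u v, f (u ** v) = f u ** f v.
Proof.
move=> lf H u v.
apply: (ext3l (f := fun u => f (u ** v)) (g := fun u => f u ** f v))
  => [k a b|k a b|x y z].
- by rewrite nmulDl nscaleAl lf.
- by rewrite lf nmulDl nscaleAl.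
apply: (ext3l (f := fun v => f (x ⊗ y ⊗ z ** v))
  (g := fun v => f (x ⊗ y ⊗ z) ** f v)) => [k a b|k a b|x' y' z'] //.
- by rewrite nmulDr nscaleAr lf.
- by rewrite lf nmulDr nscaleAr.
Qed.

Lemma tens_lin_l (X Y U : lmodType K) (f : X -> Y) (y : U) :
  linear f -> linear (fun x => f x ⊗ y).
Proof. by move=> lf k u v; rewrite lf (tens_bilin _ _).1. Qed.
Lemma tens_lin_r (X Y U : lmodType K) (f : X -> Y) (y : U) :
  linear f -> linear (fun x => y ⊗ f x).
Proof. by move=> lf k u v; rewrite lf (tens_bilin _ _).2. Qed.

Section Swap.
Variables X Y Z : nuAlgType K.

Lemma swap_trilin : trilin (fun (x : X) (y : Y) (z : Z) => x ⊗ z ⊗ y).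
Proof.
split=> *; do ?[exact: linear_id | apply: tens_lin_l | apply: tens_lin_r].
Qed.

Definition tswap : X ⊗ Y ⊗ Z -> X ⊗ Z ⊗ Y := tliftl (fun x y z => x ⊗ z ⊗ y).

Lemma tswap_linear : linear tswap.
Proof. exact/tliftl_linear/swap_trilin. Qed.
Lemma tswapE x y z : tswap (x ⊗ y ⊗ z) = x ⊗ z ⊗ y.
Proof. exact/tliftlE/swap_trilin. Qed.
Lemma tswap_mul u v : tswap (u ** v) = tswap u ** tswap v.
Proof.
by apply: mul_ext3l u v => *; [exact: tswap_linear|rewrite !(tens_mul, tswapE)].
Qed.

End Swap.

Lemma tswapK (X Y Z : nuAlgType K) : cancel (@tswap X Y Z) (@tswap X Z Y).
Proof.
apply: (ext3l (f := @tswap X Z Y \o @tswap X Y Z) (g := id)) => //.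
  by apply: linear_comp; apply: tswap_linear.
by move=> a b c /=; rewrite !tswapE.
Qed.

Definition swap_iso (X Y Z : nuAlgType K) : nuiso (X ⊗ Y ⊗ Z) (X ⊗ Z ⊗ Y) :=
  NUIso (@tswap_linear X Y Z) (@tswap_linear X Z Y) (@tswap_mul X Y Z)
    (@tswapK X Y Z) (@tswapK X Z Y).

Section Assoc.
Variables X Y Z : nuAlgType K.

Lemma assoc_trilin : trilin (fun (x : X) (y : Y) (z : Z) => x ⊗ (y ⊗ z)).
Proof.
split=> *; do ?[exact: linear_id | apply: tens_lin_l | apply: tens_lin_r].
Qed.
Lemma assoc_inv_trilin : trilin (fun (x : X) (y : Y) (z : Z) => x ⊗ y ⊗ z).
Proof.
split=> *; do ?[exact: linear_id | apply: tens_lin_l | apply: tens_lin_r].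
Qed.

Definition tassoc : X ⊗ Y ⊗ Z -> X ⊗ (Y ⊗ Z) := tliftl (fun x y z => x ⊗ (y ⊗ z)).
Definition tassoc_inv : X ⊗ (Y ⊗ Z) -> X ⊗ Y ⊗ Z :=
  tliftr (fun x y z => x ⊗ y ⊗ z).

Lemma tassoc_linear : linear tassoc.
Proof. exact/tliftl_linear/assoc_trilin. Qed.
Lemma tassocE x y z : tassoc (x ⊗ y ⊗ z) = x ⊗ (y ⊗ z).
Proof. exact/tliftlE/assoc_trilin. Qed.
Lemma tassoc_inv_linear : linear tassoc_inv.
Proof. exact/tliftr_linear/assoc_inv_trilin. Qed.
Lemma tassoc_invE x y z : tassoc_inv (x ⊗ (y ⊗ z)) = x ⊗ y ⊗ z.
Proof. exact/tliftrE/assoc_inv_trilin. Qed.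
Lemma tassoc_mul u v : tassoc (u ** v) = tassoc u ** tassoc v.
Proof.
by apply: mul_ext3l u v => *; [exact: tassoc_linear|rewrite !(tens_mul, tassocE)].
Qed.
Lemma tassocK : cancel tassoc tassoc_inv.
Proof.
apply: (ext3l (f := tassoc_inv \o tassoc) (g := id)) => //.
  by apply: linear_comp; [apply: tassoc_inv_linear|apply: tassoc_linear].
by move=> a b c /=; rewrite tassocE tassoc_invE.
Qed.
Lemma tassoc_invK : cancel tassoc_inv tassoc.
Proof.
apply: (ext3r (f := tassoc \o tassoc_inv) (g := id)) => //.
  by apply: linear_comp; [apply: tassoc_linear|apply: tassoc_inv_linear].
by move=> a b c /=; rewrite tassoc_invE tassocE.
Qed.

Definition assoc_iso : nuiso (X ⊗ Y ⊗ Z) (X ⊗ (Y ⊗ Z)) :=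
  NUIso tassoc_linear tassoc_inv_linear tassoc_mul tassocK tassoc_invK.

End Assoc.
End Iso.
Arguments nuiso {K} (X Y)%_type.

Notation "m ⊠ n" := (mtens m n) (at level 40, left associativity) : ring_scope.

(* X is identified with its image in M(X). *)
Definition in_alg (K : fieldType) (X : nuAlgType K) (m : multiplier X) : Prop :=
  exists x, m = emb x.

Definition tens_sub (K : fieldType) (A B : lmodType K) (V : set A) (W : set B)
  : set (A ⊗ B) := lspan [set t | exists v w, [/\ V v, W w & t = v ⊗ w]].

Definition in_tens (K : fieldType) (A B : nuAlgType K) (V : set A) (W : set B)
  (m : multiplier (A ⊗ B)) : Prop := exists2 t, tens_sub V W t & m = emb t.

Section Extension.
Variables (K : fieldType) (X Y : nuAlgType K).

Definition alg_hom (f : X -> multiplier Y) : Prop :=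
  linear f /\ forall x y, f (x ** y) = f x * f y.

Definition hom_extension (f : X -> multiplier Y) (p : multiplier Y)
    (F : multiplier X -> multiplier Y) : Prop :=
  [/\ linear F, forall m n, F (m * n) = F m * F n,
      forall x, F (emb x) = f x & F 1 = p].

(* For non-degenerate Y there is at most one such F in the cases of interest:
   p = 1 for inclusions of subalgebras of M(Y), and p = E ⊗ 1 for Δ ⊗ ι. *)
Definition extends_to (f : X -> multiplier Y) (p : multiplier Y)
    (m : multiplier X) (n : multiplier Y) : Prop :=
  exists F, hom_extension f p F /\ F m = n.

(* An algebra sitting in a multiplier algebra is given by its inclusion map. *)
Definition sits_nondegenerately (f : X -> multiplier Y) : Prop :=
  [/\ alg_hom f, injective f,
      lspan [set z | exists x y, z = ml (f x) y] = setT &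
      lspan [set z | exists x y, z = mr (f x) y] = setT].

(* Membership in M(X), seen inside M(Y) through the unital extension of [f]. *)
Definition in_multiplier (f : X -> multiplier Y) (n : multiplier Y) : Prop :=
  exists m, extends_to f 1 m n.

End Extension.

Definition tens_hom (K : fieldType) (A B C : nuAlgType K)
    (f : B -> multiplier A) (g : C -> multiplier A) :
  B ⊗ C -> multiplier (A ⊗ A) := tlift (fun b c => f b ⊠ g c).

Section Coproduct.
Variables (K : fieldType) (A : nuAlgType K) (D : A -> multiplier (A ⊗ A)).

Definition T1 : A ⊗ A -> multiplier (A ⊗ A) :=
  tlift (fun a b => D a * (1 ⊠ emb b)).
Definition T2 : A ⊗ A -> multiplier (A ⊗ A) :=
  tlift (fun c a => (emb c ⊠ 1) * D a).
Definition T3 : A ⊗ A -> multiplier (A ⊗ A) :=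
  tlift (fun a b => (1 ⊠ emb b) * D a).
Definition T4 : A ⊗ A -> multiplier (A ⊗ A) :=
  tlift (fun c a => D a * (emb c ⊠ 1)).

Definition regular_map (T : A ⊗ A -> multiplier (A ⊗ A)) : Prop :=
  forall x, in_alg (T x).

(* Δ ⊗ ι and ι ⊗ Δ on A ⊗ A; all threefold tensor products are bracketed to
   the left, so the latter is transported along the associativity isomorphism. *)
Definition D_id : A ⊗ A -> multiplier (A ⊗ A ⊗ A) :=
  tlift (fun a b => D a ⊠ emb b).
Definition id_D (t : A ⊗ A) : multiplier (A ⊗ A ⊗ A) :=
  mpull (assoc_iso A A A) (tlift (fun a b => emb a ⊠ D b) t).

Definition coassociative : Prop := forall a b c t1 t2,
  emb t1 = D a * (1 ⊠ emb b) -> emb t2 = (emb c ⊠ 1) * D a ->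
  (emb c ⊠ 1 ⊠ 1) * D_id t1 = id_D t2 * (1 ⊠ 1 ⊠ emb b).

Definition coproduct : Prop :=
  [/\ alg_hom D, regular_map T1, regular_map T2 & coassociative].

Definition regular_coproduct : Prop :=
  [/\ coproduct, regular_map T3 & regular_map T4].

Definition full_coproduct : Prop :=
  (forall V : set A, is_subspace V ->
     (forall a b, in_tens V setT (D a * (1 ⊠ emb b))) -> V = setT) /\
  (forall W : set A, is_subspace W ->
     (forall a c, in_tens setT W ((emb c ⊠ 1) * D a)) -> W = setT).

Definition D13 (a : A) : multiplier (A ⊗ A ⊗ A) :=
  mpull (swap_iso A A A) (D a ⊠ 1).

Definition E12 (E : multiplier (A ⊗ A)) : multiplier (A ⊗ A ⊗ A) := E ⊠ 1.
Definition E23 (E : multiplier (A ⊗ A)) : multiplier (A ⊗ A ⊗ A) :=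
  mpull (assoc_iso A A A) (1 ⊠ E).

(* (Δ ⊗ ι)E = (E ⊗ 1)(1 ⊗ E) = (1 ⊗ E)(E ⊗ 1), for the extension of Δ ⊗ ι
   with unit going to E ⊗ 1. *)
Definition coproduct_of_idempotent (E : multiplier (A ⊗ A)) : Prop :=
  extends_to D_id (E12 E) E (E12 E * E23 E) /\ E12 E * E23 E = E23 E * E12 E.

Definition is_G1 (E : multiplier (A ⊗ A)) (G : A ⊗ A -> A ⊗ A) : Prop :=
  linear G /\ forall a b c, exists t,
    emb t = D13 a * (1 ⊠ emb b ⊠ emb c) /\
    emb (tmap G id t) = D13 a * E23 E * (1 ⊠ emb b ⊠ emb c).

Definition is_G2 (E : multiplier (A ⊗ A)) (G : A ⊗ A -> A ⊗ A) : Prop :=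
  linear G /\ forall a b c, exists t,
    emb t = (emb a ⊠ emb b ⊠ 1) * D13 c /\
    emb (tassoc_inv (tmap id G (tassoc t))) =
      (emb a ⊠ emb b ⊠ 1) * E12 E * D13 c.

Definition weak_multiplier_hopf : Prop :=
  [/\ nondegenerate_alg A, idempotent_alg A, coproduct, full_coproduct &
   exists E : multiplier (A ⊗ A),
   [/\ E * E = E,
       range T1 = range (fun x => emb (ml E x)) /\
       range T2 = range (fun x => emb (mr E x)),
       coproduct_of_idempotent E,
       exists2 G1, is_G1 E G1 &
         [set x | T1 x = 0] = range (fun x => x - G1 x) &
       exists2 G2, is_G2 E G2 &
         [set x | T2 x = 0] = range (fun x => x - G2 x)]].

End Coproduct.

Definition cop (K : fieldType) (A : nuAlgType K)
    (D : A -> multiplier (A ⊗ A)) (a : A) : multiplier (A ⊗ A) :=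
  mpull (flip_iso A A) (D a).

Definition regular_weak_multiplier_hopf (K : fieldType) (A : nuAlgType K)
    (D : A -> multiplier (A ⊗ A)) : Prop :=
  [/\ weak_multiplier_hopf D, regular_coproduct D & weak_multiplier_hopf (cop D)].

Record anti_iso (K : fieldType) (B C : nuAlgType K) := AntiIso {
  anti_to :> B -> C;
  anti_inv : C -> B;
  anti_to_linear : linear anti_to;
  anti_mul : forall x y, anti_to (x ** y) = anti_to y ** anti_to x;
  anti_toK : cancel anti_to anti_inv;
  anti_invK : cancel anti_inv anti_to }.

Section Separability.
Variables (K : fieldType) (B C : nuAlgType K) (E : multiplier (B ⊗ C)).

Definition full_idempotent : Prop :=
  (forall V : set B, is_subspace V ->
     (forall c, in_tens V setT (E * (1 ⊠ emb c)) /\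
                in_tens V setT ((1 ⊠ emb c) * E)) -> V = setT) /\
  (forall W : set C, is_subspace W ->
     (forall b, in_tens setT W (E * (emb b ⊠ 1)) /\
                in_tens setT W ((emb b ⊠ 1) * E)) -> W = setT).

Definition regular_separability_idempotent
    (SB : anti_iso B C) (SC : anti_iso C B) : Prop :=
  [/\ E * E = E,
      forall b, in_alg (E * (emb b ⊠ 1)) /\ in_alg ((emb b ⊠ 1) * E),
      forall c, in_alg (E * (1 ⊠ emb c)) /\ in_alg ((1 ⊠ emb c) * E),
      full_idempotent &
      (forall b, E * (emb b ⊠ 1) = E * (1 ⊠ emb (SB b))) /\
      (forall c, (1 ⊠ emb c) * E = (emb (SC c) ⊠ 1) * E)].

(* [S] reverses products, so (ι ⊗ S)E is the multiplier F with
   F(b ⊗ S(c)) = (ι ⊗ S)((1 ⊗ c)E(b ⊗ 1)) and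
   (b ⊗ S(c))F = (ι ⊗ S)((b ⊗ 1)E(1 ⊗ c)); similarly for (S ⊗ ι)E. *)
Definition is_id_anti (D : nuAlgType K) (S : C -> D) (F : multiplier (B ⊗ D))
  : Prop := forall b c,
  (exists2 t, emb t = (1 ⊠ emb c) * E * (emb b ⊠ 1) &
     ml F (b ⊗ S c) = tmap id S t) /\
  (exists2 t, emb t = (emb b ⊠ 1) * E * (1 ⊠ emb c) &
     mr F (b ⊗ S c) = tmap id S t).

Definition is_anti_id (D : nuAlgType K) (S : B -> D) (F : multiplier (D ⊗ C))
  : Prop := forall b c,
  (exists2 t, emb t = (emb b ⊠ 1) * E * (1 ⊠ emb c) &
     ml F (S b ⊗ c) = tmap S id t) /\
  (exists2 t, emb t = (1 ⊠ emb c) * E * (emb b ⊠ 1) &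
     mr F (S b ⊗ c) = tmap S id t).

End Separability.

Section Integrals.
Variables (K : fieldType) (A : nuAlgType K).

Definition id_fun_slice (phi : {scalar A}) : A ⊗ A -> A :=
  tlift (fun a b => phi b *: a).
Definition fun_id_slice (psi : {scalar A}) : A ⊗ A -> A :=
  tlift (fun a b => psi a *: b).

(* [n] is the multiplier (ι ⊗ φ)m, resp. (ψ ⊗ ι)m, of A. *)
Definition is_id_fun (phi : {scalar A}) (m : multiplier (A ⊗ A))
    (n : multiplier A) : Prop := forall c,
  (exists2 t, emb t = m * (emb c ⊠ 1) & ml n c = id_fun_slice phi t) /\
  (exists2 t, emb t = (emb c ⊠ 1) * m & mr n c = id_fun_slice phi t).
Definition is_fun_id (psi : {scalar A}) (m : multiplier (A ⊗ A))
    (n : multiplier A) : Prop := forall c,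
  (exists2 t, emb t = m * (1 ⊠ emb c) & ml n c = fun_id_slice psi t) /\
  (exists2 t, emb t = (1 ⊠ emb c) * m & mr n c = fun_id_slice psi t).

Definition left_integral (D : A -> multiplier (A ⊗ A)) (C : nuAlgType K)
    (iC : C -> multiplier A) (F2 F4 : multiplier (C ⊗ C)) (phi : {scalar A})
  : Prop :=
  (exists a, phi a <> 0) /\
  forall a, exists n,
    [/\ is_id_fun phi (D a) n, in_multiplier iC n,
        exists2 m, extends_to (tens_hom iC iC) 1 F4 m &
          is_id_fun phi ((1 ⊠ emb a) * m) n &
        exists2 m, extends_to (tens_hom iC iC) 1 F2 m &
          is_id_fun phi (m * (1 ⊠ emb a)) n].

Definition right_integral (D : A -> multiplier (A ⊗ A)) (B : nuAlgType K)
    (iB : B -> multiplier A) (F1 F3 : multiplier (B ⊗ B)) (psi : {scalar A})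
  : Prop :=
  (exists a, psi a <> 0) /\
  forall a, exists n,
    [/\ is_fun_id psi (D a) n, in_multiplier iB n,
        exists2 m, extends_to (tens_hom iB iB) 1 F1 m &
          is_fun_id psi ((emb a ⊠ 1) * m) n &
        exists2 m, extends_to (tens_hom iB iB) 1 F3 m &
          is_fun_id psi (m * (emb a ⊠ 1)) n].

Definition left_faithful (F : set {scalar A}) : Prop :=
  forall a : A, (forall b w, F w -> w (a ** b) = 0) -> a = 0.
Definition right_faithful (F : set {scalar A}) : Prop :=
  forall a : A, (forall b w, F w -> w (b ** a) = 0) -> a = 0.
Definition faithful (F : set {scalar A}) : Prop :=
  left_faithful F /\ right_faithful F.

End Integrals.

(* Main.v *)
(* Coassociativity says that the slice maps (ω(c·) ⊗ ι)Δ and (ι ⊗ φ(·b))Δ of A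
   commute, and this is the form in which it is used. Let T_1(a ⊗ b) = Δ(a)(1 ⊗ b)
   and G_1(a ⊗ b) = (a ⊗ 1)F_1(1 ⊗ b). If T_1 x = 0, then T_1((p ⊗ 1)x) = Δ(p)T_1 x = 0
   for all p, and applying ψ ⊗ ι, for the right integrals ψ, gives G_1 x = 0 by right
   faithfulness. Let V be the left leg of Δ, which is spanned by the slices
   (ι ⊗ φ)(Δ(p)(1 ⊗ q)) for the left integrals φ. The classical formula for the
   surjectivity of T_1 yields E(V ⊗ A) = T_1(V ⊗ A). Therefore T_1(V ⊗ A) = T_1(A ⊗ A),
   and by the statement on the kernel G_1(A ⊗ A) is contained in V ⊗ A, which forces
   V = A: the coproduct is full on the left and T_1(A ⊗ A) = E(A ⊗ A). Finally,
   fullness and coassociativity give Δ(ab) = Δ(a)(1 ⊗ b) for b in B, whence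
   T_1 G_1 = T_1 and Ker T_1 = (1 - G_1)(A ⊗ A). The statements on T_2 are those on T_1
   for (A^op, Δ^cop), and the regular case follows from the same results for
   (A, Δ^cop). *)
Require Import Defs.
From HB Require Import structures.
From mathcomp Require Import all_boot all_algebra.
From mathcomp Require Import boolp classical_sets reals complex.
Set Implicit Arguments.
Unset Strict Implicit.
Unset Printing Implicit Defensive.
Import GRing.Theory.
Local Open Scope ring_scope.
Local Open Scope classical_set_scope.

(** The obstacle is circularity: the usual definition of G_1 through Δ_13 presupposes that the left
    leg of Δ is all of A, which is only known late. Here G_1 is characterised by (ψ(p·) ⊗ ι)G_1 x =
    (ψ ⊗ ι)T_1((p ⊗ 1)x) for the right integrals ψ. Invariance provides an element with these slices
    and faithfulness makes it unique; linearity follows. The equality A^2 = A has a separate source: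
    E(A ⊗ A) = Δ(A)(A ⊗ A) lies in A^2 ⊗ A, while the left legs of E(A ⊗ A) span BA = A. One
    computation has to serve T_1 and T_2, for Δ and for Δ^cop. The hypotheses are therefore brought
    into a form that is stable under these symmetries, which requires two consequences of
    separability: (S_C ⊗ S_B)ζE = E, and E_1 S_C(E_2) = 1 = S_B(E_1)E_2. Moreover, the formula for
    (Δ^cop ⊗ ι)ζE amounts to one for (ι ⊗ Δ)E, which has to be derived; it results from Δ(ca) = (c ⊗
    1)Δ(a) for c in C, the mirror image of Δ(ab) = Δ(a)(1 ⊗ b) for b in B. *)

(** * Subspaces and separation by linear functionals *)

Section Functionals.
Variables (K : fieldType) (V : lmodType K).
Implicit Types W : set V.

Lemma subspaceD W u v : is_subspace W -> W u -> W v -> W (u + v).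
Proof. by case=> _ WD Wu Wv; have := WD 1 u v Wu Wv; rewrite scale1r. Qed.

Lemma subspaceZ W k u : is_subspace W -> W u -> W (k *: u).
Proof. by case=> W0 WD Wu; have := WD k u 0 Wu W0; rewrite addr0. Qed.

Lemma subspaceB W u v : is_subspace W -> W u -> W v -> W (u - v).
Proof.
by move=> sW Wu Wv; rewrite -scaleN1r; apply: subspaceD => //; apply: subspaceZ.
Qed.

Lemma subspace_sum W (I : Type) (r : seq I) (F : I -> V) : is_subspace W ->
  (forall i, W (F i)) -> W (\sum_(i <- r) F i).
Proof.
move=> sW WF; elim/big_ind: _ => // [|u v]; first by case: sW.
exact: subspaceD.
Qed.

Lemma lspan_subspace (S : set V) : is_subspace (lspan S).
Proof.
split=> [|k u v [n [c [x [Sx ->]]]] [m [d [y [Sy ->]]]]].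
  by exists 0%N, (fun=> 0), (fun=> 0); split=> [[]|] //; rewrite big_ord0.
pose c' i := match fintype.split i with inl j => k * c j | inr j => d j end.
pose x' i := match fintype.split i with inl j => x j | inr j => y j end.
exists (n + m)%N, c', x'; split=> [i|].
  by rewrite /x'; case: (fintype.split i).
rewrite big_split_ord scaler_sumr /=; congr (_ + _); apply: eq_bigr => i _;
  rewrite /c' /x'.
- by rewrite (unsplitK (inl i)) scalerA.
- by rewrite (unsplitK (inr i)).
Qed.

Lemma lspan_incl (S : set V) v : S v -> lspan S v.
Proof.
by move=> Sv; exists 1%N, (fun=> 1), (fun=> v); rewrite big_ord1 scale1r.
Qed.

Lemma lspan_sub (S : set V) W : is_subspace W -> S `<=` W -> lspan S `<=` W.
Proof.
move=> sW SW _ [n [c [x [Sx ->]]]]; apply: subspace_sum => // i.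
by apply: subspaceZ => //; apply: SW.
Qed.

Lemma lspanT_ind (S : set V) (P : V -> Prop) : lspan S = setT ->
  is_subspace P -> (forall v, S v -> P v) -> forall v, P v.
Proof. by move=> ST sP SP v; apply: (lspan_sub sP SP); rewrite ST. Qed.

Lemma eq_subspace (U : lmodType K) (f g : {linear V -> U}) :
  is_subspace [set v | f v = g v].
Proof.
by split=> [|k u v /= fgu fgv]; rewrite /= ?linear0 // !linearP fgu fgv.
Qed.

Lemma scalar_of (f : V -> K) : scalar f -> exists w : {scalar V}, w =1 f.
Proof.
move=> lf; by pose w : {scalar V} :=
  HB.pack f (GRing.isLinear.Build K V K *%R f lf); exists w.
Qed.

(* A maximal subspace containing W and avoiding v is a hyperplane. *)
Lemma functional_sep W v : is_subspace W -> ~ W v ->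
  exists w : {scalar V}, (forall u, W u -> w u = 0) /\ w v = 1.
Proof.
move=> sW Wv.
pose P X := X = set0 \/ [/\ is_subspace X, W `<=` X & ~ X v].
have [F FP tF|M [PM maxM]] := @Zorn_bigcup V P.
  have [[X FX nX]|noX] := pselect (exists2 X, F X & X <> set0); last first.
    left; apply/seteqP; split=> // x [X FX Xx]; apply: noX.
    by exists X => // X0; rewrite X0 in Xx.
  have [//|[sX WX Xv]] := FP _ FX; right; split=> [|w /WX Xw|[Y FY Yv]].
  - split=> [|k x y [Y FY Yx] [Z FZ Zy]]; first by exists X => //; case: sX.
    have [[_ YZ]|[_ ZY]] : (F Y /\ Y `<=` Z) \/ (F Z /\ Z `<=` Y).
      by have [] := tF _ _ FY FZ; [left|right].
    + exists Z => //; have [Z0|[[_ sZ] _ _]] := FP _ FZ; first by rewrite Z0 in Zy.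
      by apply: sZ => //; apply: YZ.
    + exists Y => //; have [Y0|[[_ sY] _ _]] := FP _ FY; first by rewrite Y0 in Yx.
      by apply: sY => //; apply: ZY.
  - by exists X.
  - by have [Y0|[]] := FP _ FY; first by rewrite Y0 in Yv.
have [M0|[sM WM Mv]] := PM.
  have W0 : W 0 by case: sW.
  case: (maxM W); last by rewrite /P; right; split.
  by rewrite M0; split=> [x|/(_ _ W0)].
have ex y : exists k, M (y - k *: v).
  have [My|My] := pselect (M y); first by exists 0; rewrite scale0r subr0.
  (* [N] is M + Ky. By maximality it contains v, and since v is not in M this puts y in M + Kv. *)
  pose N := [set z | exists k, M (z - k *: y)].
  have sN : is_subspace N.
    split=> [|c z z' [k Mz] [l Mz']].
      by exists 0; rewrite scale0r subr0; case: sM.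
    exists (c * k + l); have := sM.2 c _ _ Mz Mz'.
    by rewrite scalerDl scalerBr scalerA opprD addrACA.
  have MN : M `<=` N by move=> z Mz; exists 0; rewrite scale0r subr0.
  have [[k Mk]|Nv] := pselect (N v); last first.
    case: (maxM N); last by rewrite /P; right; split=> // w /WM /MN.
    split=> // NM; apply/My/NM; exists 1; rewrite scale1r subrr; by case: sM.
  have k0 : k != 0.
    by apply/eqP => k0; apply: Mv; rewrite k0 scale0r subr0 in Mk.
  exists k^-1; have := subspaceZ (- k^-1) sM Mk.
  by rewrite scalerBr scalerA mulNr mulVf // scaleN1r opprK scaleNr addrC.
have uniq y k l : M (y - k *: v) -> M (y - l *: v) -> k = l.
  move=> Mk Ml; have [|/negP kl] := pselect (k == l :> K).
    exact/eqP.
  case: Mv; have := subspaceB sM Mk Ml.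
  rewrite opprB addrC addrA subrK -scalerBl => /(subspaceZ (l - k)^-1 sM).
  by rewrite scalerA mulVf ?scale1r // subr_eq0 eq_sym.
have [f fP] := choice ex.
have [|w wf] := @scalar_of f.
  move=> k x y; apply: uniq (fP _) _; rewrite scalerDl -scalerA opprD addrACA -scalerBr.
  exact: sM.2.
exists w; split=> [u /WM Mu|]; rewrite wf; apply: uniq (fP _) _.
- by rewrite scale0r subr0.
- by rewrite scale1r subrr; case: sM.
Qed.

Lemma functional0 v : (forall w : {scalar V}, w v = 0) -> v = 0.
Proof.
have s0 : is_subspace [set (0 : V)].
  by split=> // k u u' -> ->; rewrite scaler0 addr0.
move=> wv; apply: contrapT => v0.
have [w [_]] := functional_sep s0 (v0 : ~ [set 0] v).
by rewrite wv => /eqP; rewrite eq_sym oner_eq0.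
Qed.

Lemma functional_inj u v : (forall w : {scalar V}, w u = w v) -> u = v.
Proof.
move=> uv; apply/eqP; rewrite -subr_eq0; apply/eqP/functional0 => w.
by rewrite linearB uv subrr.
Qed.

Lemma subspace_setT W : is_subspace W ->
  (forall w : {scalar V}, (forall u, W u -> w u = 0) -> forall v, w v = 0) ->
  W = setT.
Proof.
move=> sW wW; apply/seteqP; split=> // v _; apply: contrapT => /(functional_sep sW).
by case=> w [/wW -> /eqP]; rewrite eq_sym oner_eq0.
Qed.

End Functionals.

(** * Tensors and their slices *)

Definition linfun_of (K : fieldType) (U V : lmodType K) (f : U -> V)
  (lf : linear f) : {linear U -> V} :=
  HB.pack f (GRing.isLinear.Build K U V *:%R f lf).

Section Bundling.
Variable K : fieldType.

HB.instance Definition _ (A : nuAlgType K) (m : multiplier A) :=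
  GRing.isLinear.Build K A A *:%R (ml m) (@ml_linear K A m).
HB.instance Definition _ (A : nuAlgType K) (m : multiplier A) :=
  GRing.isLinear.Build K A A *:%R (mr m) (@mr_linear K A m).
HB.instance Definition _ (A : nuAlgType K) (a : A) :=
  GRing.isLinear.Build K A A *:%R (nmul a) (nmull_linear a).
HB.instance Definition _ (U V : lmodType K) (u : U) :=
  GRing.isLinear.Build K V (U ⊗ V)%type *:%R (tens u) ((tens_bilin U V).2 u).
HB.instance Definition _ (U V U' V' : lmodType K) (f : {linear U -> V})
    (g : {linear U' -> V'}) :=
  GRing.isLinear.Build K (U ⊗ U')%type (V ⊗ V')%type *:%R (tmap f g)
    (tmap_linear (@linearP _ _ _ _ f) (@linearP _ _ _ _ g)).

Lemma tens0l (U V : lmodType K) (v : V) : (0 : U) ⊗ v = 0.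
Proof. exact: lin0 ((tens_bilin U V).1 v). Qed.
Lemma tensDl (U V : lmodType K) (u u' : U) (v : V) :
  (u + u') ⊗ v = u ⊗ v + u' ⊗ v.
Proof. exact: linD ((tens_bilin U V).1 v) _ _. Qed.
Lemma tensZl (U V : lmodType K) k (u : U) (v : V) :
  (k *: u) ⊗ v = k *: (u ⊗ v).
Proof. exact: linZ ((tens_bilin U V).1 v) _ _. Qed.

Lemma tmap_tens (U V U' V' : lmodType K) (f : {linear U -> V})
  (g : {linear U' -> V'}) u u' : tmap f g (u ⊗ u') = f u ⊗ g u'.
Proof. by apply: tmapE; apply: linearP. Qed.

Lemma tmap_comp (U V W U' V' W' : lmodType K) (f : {linear V -> W})
  (f' : {linear V' -> W'}) (g : {linear U -> V}) (g' : {linear U' -> V'}) t :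
  tmap f f' (tmap g g' t) = tmap (f \o g) (f' \o g') t.
Proof.
elim/tensor_ind: t => [|u u' t IH]; first by rewrite !linear0.
by rewrite !linearD /= IH !tmap_tens.
Qed.


Lemma tmap_idfun (U V : lmodType K) (t : U ⊗ V) : tmap idfun idfun t = t.
Proof.
elim/tensor_ind: t => [|u u' t IH]; first by rewrite !linear0.
by rewrite !linearD /= IH !tmap_tens.
Qed.

Lemma tensor_ext (U V W : lmodType K) (f g : {linear (U ⊗ V)%type -> W}) :
  (forall u v, f (u ⊗ v) = g (u ⊗ v)) -> f =1 g.
Proof. by apply: linear_tensor_ext; apply: linearP. Qed.

End Bundling.

Section Slices.
Variables (K : fieldType) (U V : lmodType K).
Implicit Types (t : (U ⊗ V)%type).

Lemma slice1_bilin (w : {scalar U}) : bilin (fun u (v : V) => w u *: v).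
Proof.
split=> [v k u u'|u k v v']; first by rewrite linearP scalerDl scalerA.
by rewrite scalerDr !scalerA mulrC.
Qed.
Lemma slice2_bilin (w : {scalar V}) : bilin (fun (u : U) v => w v *: u).
Proof.
split=> [v k u u'|u k v v']; last by rewrite linearP scalerDl scalerA.
by rewrite scalerDr !scalerA mulrC.
Qed.

Definition slice1 (w : {scalar U}) : U ⊗ V -> V := tlift (fun u v => w u *: v).
Definition slice2 (w : {scalar V}) : U ⊗ V -> U := tlift (fun u v => w v *: u).

HB.instance Definition _ w := GRing.isLinear.Build K (U ⊗ V)%type V *:%R
  (slice1 w) (tlift_linear (slice1_bilin w)).
HB.instance Definition _ w := GRing.isLinear.Build K (U ⊗ V)%type U *:%R
  (slice2 w) (tlift_linear (slice2_bilin w)).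

Lemma slice1E w u v : slice1 w (u ⊗ v) = w u *: v.
Proof. exact/tliftE/slice1_bilin. Qed.
Lemma slice2E w u v : slice2 w (u ⊗ v) = w v *: u.
Proof. exact/tliftE/slice2_bilin. Qed.

Lemma slice1D w t t' : slice1 w (t + t') = slice1 w t + slice1 w t'.
Proof. exact: linearD. Qed.
Lemma slice1P w k t t' : slice1 w (k *: t + t') = k *: slice1 w t + slice1 w t'.
Proof. exact: linearP. Qed.
Lemma slice2P w k t t' : slice2 w (k *: t + t') = k *: slice2 w t + slice2 w t'.
Proof. exact: linearP. Qed.
Lemma slice10 w : slice1 w 0 = 0. Proof. exact: linear0. Qed.

Lemma slice12 (w : {scalar U}) (w' : {scalar V}) t :
  w' (slice1 w t) = w (slice2 w' t).
Proof.
elim/tensor_ind: t => [|u v t IH]; first by rewrite !linear0.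
by rewrite !linearD /= IH slice1E slice2E !linearZ /= mulrC.
Qed.

Lemma eq_slice1 (w w' : {scalar U}) t : w =1 w' -> slice1 w t = slice1 w' t.
Proof.
move=> ww'; elim/tensor_ind: t => [|u v t IH]; first by rewrite !linear0.
by rewrite !linearD /= IH !slice1E ww'.
Qed.
Lemma eq_slice2 (w w' : {scalar V}) t : w =1 w' -> slice2 w t = slice2 w' t.
Proof.
move=> ww'; elim/tensor_ind: t => [|u v t IH]; first by rewrite !linear0.
by rewrite !linearD /= IH !slice2E ww'.
Qed.

Lemma slice1_idfun (w : {scalar U}) t : slice1 (w \o idfun) t = slice1 w t.
Proof. exact: eq_slice1. Qed.
Lemma slice2_idfun (w : {scalar V}) t : slice2 (w \o idfun) t = slice2 w t.
Proof. exact: eq_slice2. Qed.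

Lemma tens_sub_subspace (W : set U) (W' : set V) : is_subspace (tens_sub W W').
Proof. exact: lspan_subspace. Qed.

Lemma tens_sub_tens (W : set U) (W' : set V) u v :
  W u -> W' v -> tens_sub W W' (u ⊗ v).
Proof. by move=> Wu Wv; apply: lspan_incl; exists u, v. Qed.

Lemma slice1_sub (W : set U) (w : {scalar U}) t : (forall u, W u -> w u = 0) ->
  tens_sub W setT t -> slice1 w t = 0.
Proof.
move=> wW [n [c [x [xW ->]]]]; rewrite linear_sum big1 // => i _.
by have [u [v [Wu _ ->]]] := xW i; rewrite linearZ /= slice1E wW // scale0r scaler0.
Qed.

Lemma tpi_sum (r : seq (U * V)) : tpi r = \sum_(p <- r) p.1 ⊗ p.2 :> (U ⊗ V)%type.
Proof.
elim: r => [|[a b] r IH]; first by rewrite big_nil.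
by rewrite big_cons -IH /tens [RHS]taddE.
Qed.

(** If x is a combination of first legs a_i with coefficients k_i, then x ⊗ v is the sum of the a_i
    ⊗ k_i v, which only alters second legs. The number of terms does not grow, as the induction in
    [tens_subP] demands. *)
Lemma absorb_first_leg (r : seq (U * V)) x v : lspan [set` map fst r] x ->
  exists2 r', map fst r' = map fst r & x ⊗ v + tpi r = tpi r'.
Proof.
move=> rx; pose P x := forall v r', map fst r' = map fst r ->
  exists2 r2, map fst r2 = map fst r & x ⊗ v + tpi r' = tpi r2 :> (U ⊗ V)%type.
suff : P x by apply.
move: x rx {v}; apply: lspan_sub => [|x /= xr v r' r'r].
  split=> [v r' r'r|k x y Px Py v r' r'r]; first by exists r'; rewrite ?tens0l ?add0r.
  have [r2 r2r r2E] := Py v r' r'r; have [r3 r3r r3E] := Px (k *: v) r2 r2r.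
  by exists r3 => //; rewrite tensDl tensZl -addrA r2E -r3E linearZ.
rewrite -r'r in xr *; elim: r' {r'r} xr => // -[a b] s IH /=; rewrite inE.
case/predU1P=> [->|/IH [s' <- s'E]].
  by exists ((a, b + v) :: s) => //; rewrite !tpi_sum !big_cons addrA linearD
     [a ⊗ v + _]addrC.
by exists ((a, b) :: s') => //; rewrite !tpi_sum !big_cons -!tpi_sum -s'E addrCA.
Qed.

(* Induction on the length of an expression of t: if the first leg of the first
   elementary tensor lies in the span of W and of the other first legs, it can
   be absorbed by the others; otherwise the slice of t by a functional that
   separates it shows that its second leg is 0. *)
Lemma tens_subP (W : set U) t : is_subspace W ->
  (forall w : {scalar U}, (forall u, W u -> w u = 0) -> slice1 w t = 0) ->
  tens_sub W setT t.
Proof.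
move=> sW; elim/tpiW: t => s; have [n] := ubnP (size s).
have sT : is_subspace (tens_sub W (@setT V)) by apply: tens_sub_subspace.
elim: n s => // n IH [|[u v] s] /= sn H; first by case: sT.
pose N := [set x | exists2 y, W y & lspan [set` map fst s] (x - y)].
have [sl0 slD] := lspan_subspace [set` map fst s].
have sN : is_subspace N.
  split=> [|k x x' [y Wy xy] [y' Wy' xy']].
    by exists 0; rewrite ?subr0; case: sW.
  exists (k *: y + y'); first exact: sW.2.
  by have := slD k _ _ xy xy'; rewrite scalerBr addrACA opprD.
have tE : tpi ((u, v) :: s) = u ⊗ v + tpi s by rewrite !tpi_sum big_cons.
have [[y Wy uy]|Nu] := pselect (N u).
  have [s' s's s'E] := absorb_first_leg v uy.
  have Wyv : tens_sub W setT (y ⊗ v) by apply: tens_sub_tens.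
  have tE' : tpi ((u, v) :: s) = y ⊗ v + tpi s'.
    by rewrite tE -s'E addrA -tensDl [y + _]addrC subrK.
  rewrite tE'; apply: (subspaceD sT Wyv); apply: IH => [|w wW].
    by rewrite -(size_map fst) s's size_map.
  by have := H w wW; rewrite tE' linearD /= (slice1_sub wW Wyv) add0r.
have [w [wN wu]] := functional_sep sN Nu.
have wW x : W x -> w x = 0 by move=> Wx; apply: wN; exists x; rewrite ?subrr.
have ws p : p \in s -> w p.1 = 0.
  move=> ps; apply: wN; exists 0; first by case: sW.
  by rewrite subr0; apply: lspan_incl; apply: map_f.
have v0 : v = 0.
  have := H w wW; rewrite tE linearD /= slice1E wu scale1r tpi_sum linear_sum.
  by rewrite big_seq big1 ?addr0 // => p /ws wp; rewrite /= slice1E wp scale0r.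
rewrite tE v0 linear0 add0r; apply: IH => // w' w'W.
by have := H w' w'W; rewrite tE v0 linear0 add0r.
Qed.

(** The case W = 0 of [tens_subP]. It reduces identities between tensors to identities in one
    factor. *)
Lemma slice1_eq0 t : (forall w : {scalar U}, slice1 w t = 0) -> t = 0.
Proof.
move=> t0; have s0 : is_subspace [set (0 : U)].
  by split=> // k u u' -> ->; rewrite scaler0 addr0.
have [//|n [c [x [xW ->]]]] := @tens_subP [set 0] t s0.
by rewrite big1 // => i _; have [u [v [-> _ ->]]] := xW i; rewrite tens0l scaler0.
Qed.

Lemma slice1_inj t t' : (forall w : {scalar U}, slice1 w t = slice1 w t') -> t = t'.
Proof.
move=> tt'; apply/eqP; rewrite -subr_eq0; apply/eqP/slice1_eq0 => w.
by rewrite linearB /= tt' subrr.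
Qed.

Lemma slice2_inj t t' : (forall w : {scalar V}, slice2 w t = slice2 w t') -> t = t'.
Proof.
move=> tt'; apply: slice1_inj => w; apply: functional_inj => w'.
by rewrite !slice12 tt'.
Qed.

End Slices.

Section TensorSwap.
Variables (K : fieldType) (U V : lmodType K).

Lemma tensor_swap_bilin : bilin (fun (u : U) (v : V) => v ⊗ u).
Proof. by split=> [v|u]; [apply: (tens_bilin _ _).2|apply: (tens_bilin _ _).1]. Qed.
(** A flip for bare vector spaces, whereas [tflip] is defined for algebras: in the setting B and C
    carry only their linear structure. *)
Definition tensor_swap : {linear (U ⊗ V)%type -> (V ⊗ U)%type} :=
  linfun_of (tlift_linear tensor_swap_bilin).
Lemma tensor_swapE u v : tensor_swap (u ⊗ v) = v ⊗ u.
Proof. exact/tliftE/tensor_swap_bilin. Qed.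

Lemma slice1_swap (w : {scalar V}) t : slice1 w (tensor_swap t) = slice2 w t.
Proof.
apply: (tensor_ext (f := slice1 w \o tensor_swap) (g := slice2 w)) => u v.
by rewrite -[LHS]/(slice1 w (tensor_swap _)) -[RHS]/(slice2 w _) tensor_swapE slice1E slice2E.
Qed.
Lemma slice2_swap (w : {scalar U}) t : slice2 w (tensor_swap t) = slice1 w t.
Proof.
apply: (tensor_ext (f := slice2 w \o tensor_swap) (g := slice1 w)) => u v.
by rewrite -[LHS]/(slice2 w (tensor_swap _)) -[RHS]/(slice1 w _) tensor_swapE slice1E slice2E.
Qed.

Lemma tens_subP2 (W : set V) (t : U ⊗ V) : is_subspace W ->
  (forall w : {scalar V}, (forall v, W v -> w v = 0) -> slice2 w t = 0) ->
  tens_sub setT W t.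
Proof.
move=> sW t0.
have [|n [c [x [xW tE]]]] := @tens_subP K V U W (tensor_swap t) sW.
  by move=> w /t0; rewrite slice1_swap.
have swapI : injective tensor_swap.
  move=> s s' ss'; apply: slice2_inj => w.
  by rewrite -!slice1_swap ss'.
have swap' i : exists2 y, tens_sub setT W y & tensor_swap y = c i *: x i.
  have [v [u [Wv _ ->]]] := xW i; exists (c i *: (u ⊗ v)).
    by apply: (subspaceZ _ (tens_sub_subspace _ _)); apply: tens_sub_tens.
  by rewrite linearZ tensor_swapE.
have [y yW yE] : exists2 y : 'I_n -> (U ⊗ V)%type,
    forall i, tens_sub setT W (y i) & forall i, tensor_swap (y i) = c i *: x i.
  have [y yP] := choice (fun i => let: ex_intro2 y yW yE := swap' i in
    ex_intro (fun y => tens_sub setT W y /\ tensor_swap y = c i *: x i) y (conj yW yE)).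
  by exists y => i; case: (yP i).
have -> : t = \sum_i y i.
  by apply: swapI; rewrite tE linear_sum; apply: eq_bigr => i _; rewrite -yE.
by apply: subspace_sum => //; apply: tens_sub_subspace.
Qed.

End TensorSwap.

Lemma tensor_swap_tmap (K : fieldType) (U V U' V' : lmodType K)
  (f : {linear U -> U'}) (g : {linear V -> V'}) t :
  tensor_swap _ _ (tmap f g t) = tmap g f (tensor_swap _ _ t).
Proof.
apply: (tensor_ext (f := tensor_swap U' V' \o tmap f g)
  (g := tmap g f \o tensor_swap U V)) => u v.
rewrite -[LHS]/(tensor_swap _ _ (tmap _ _ _)) -[RHS]/(tmap _ _ (tensor_swap _ _ _)).
by rewrite !tmap_tens !tensor_swapE tmap_tens.
Qed.

Section SliceMap.
Variables (K : fieldType) (U V U' V' : lmodType K).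
Variables (f : {linear U -> V}) (f' : {linear U' -> V'}).

Lemma slice1_tmap (w : {scalar V}) t :
  slice1 w (tmap f f' t) = f' (slice1 (w \o f) t).
Proof.
elim/tensor_ind: t => [|u v t IH]; first by rewrite !linear0.
by rewrite !linearD /= IH tmap_tens !slice1E linearZ.
Qed.
Lemma slice2_tmap (w : {scalar V'}) t :
  slice2 w (tmap f f' t) = f (slice2 (w \o f') t).
Proof.
elim/tensor_ind: t => [|u v t IH]; first by rewrite !linear0.
by rewrite !linearD /= IH tmap_tens !slice2E linearZ.
Qed.

End SliceMap.

(** * Multipliers *)

Section Multipliers.
Variables (K : fieldType) (A : nuAlgType K).
Implicit Types (m n : multiplier A) (a b : A).

Lemma emb_ml m a : emb (ml m a) = m * emb a.
Proof. by apply: multiplierP => b /=; rewrite ?ml_mul ?mlr. Qed.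
Lemma emb_mr m a : emb (mr m a) = emb a * m.
Proof. by apply: multiplierP => b /=; rewrite ?mr_mul ?mlr. Qed.
Lemma embM a b : emb (a ** b) = emb a * emb b.
Proof. exact: (emb_ml (emb a)). Qed.

Lemma mlD m a b : ml m (a + b) = ml m a + ml m b. Proof. exact: linearD. Qed.
Lemma mrD m a b : mr m (a + b) = mr m a + mr m b. Proof. exact: linearD. Qed.
Lemma ml0 m : ml m 0 = 0. Proof. exact: linear0. Qed.
Lemma mr0 m : mr m 0 = 0. Proof. exact: linear0. Qed.

Lemma emb_linear : linear (@emb K A).
Proof.
move=> k a b; apply: multiplierP => c /=.
- by rewrite nmulDl nscaleAl.
- by rewrite nmulDr nscaleAr.
Qed.
HB.instance Definition _ :=
  GRing.isLinear.Build K A (multiplier A) *:%R (@emb K A) emb_linear.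

Lemma multZl k m n : (k *: m) * n = k *: (m * n).
Proof. by apply: multiplierP => a //=; rewrite linearZ. Qed.
Lemma multZr k m n : m * (k *: n) = k *: (m * n).
Proof. by apply: multiplierP => a //=; rewrite linearZ. Qed.

(** One-sided multiplications as bundled linear maps, so that identities between multipliers can be
    tested on elementary tensors with [tensor_ext]. *)
Definition mlmul m n : multiplier A := m * n.
Definition mrmul n m : multiplier A := m * n.
Lemma mlmul_linear m : linear (mlmul m).
Proof. by move=> k n p; rewrite /mlmul mulrDr multZr. Qed.
Lemma mrmul_linear m : linear (mrmul m).
Proof. by move=> k n p; rewrite /mrmul mulrDl multZl. Qed.
HB.instance Definition _ m :=
  GRing.isLinear.Build K (multiplier A) (multiplier A) *:%R (mlmul m) (mlmul_linear m).
HB.instance Definition _ m :=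
  GRing.isLinear.Build K (multiplier A) (multiplier A) *:%R (mrmul m) (mrmul_linear m).

Hypothesis ndA : nondegenerate_alg A.

Lemma nmull_inj a b : (forall c, c ** a = c ** b) -> a = b.
Proof.
move=> ab; apply/eqP; rewrite -subr_eq0; apply/eqP/ndA.2 => c.
by rewrite linearB /= ab subrr.
Qed.
Lemma nmulr_inj a b : (forall c, a ** c = b ** c) -> a = b.
Proof.
move=> ab; apply/eqP; rewrite -subr_eq0; apply/eqP/ndA.1 => c.
by have := linearB (mr (emb c)) a b => /= ->; rewrite ab subrr.
Qed.

Lemma emb_inj : injective (@emb K A).
Proof. by move=> a b ab; apply: nmulr_inj => c; rewrite -[LHS]/(ml (emb a) c) ab. Qed.

(** The identity a(mb) = (am)b determines am as soon as the left action of m is known. *)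
Lemma ml_inj m n : ml m =1 ml n -> m = n.
Proof.
by move=> mn; apply: multiplierP => // a; apply: nmulr_inj => b; rewrite -!mlr mn.
Qed.
Lemma mr_inj m n : mr m =1 mr n -> m = n.
Proof.
by move=> mn; apply: multiplierP => // a; apply: nmull_inj => b; rewrite !mlr mn.
Qed.

End Multipliers.

Section MultiplierTensors.
Variables (K : fieldType) (A B : nuAlgType K).
Implicit Types (m : multiplier A) (n : multiplier B) (t z : (A ⊗ B)%type).

Lemma mul_tens1 m n a b : ml (m ⊠ n) (a ⊗ b) = ml m a ⊗ ml n b.
Proof. exact: tmap_tens. Qed.
Lemma mul_tens2 m n a b : mr (m ⊠ n) (a ⊗ b) = mr m a ⊗ mr n b.
Proof. exact: tmap_tens. Qed.

Lemma emb_tens a b : emb (a ⊗ b) = emb a ⊠ emb b :> multiplier (A ⊗ B).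
Proof.
apply: multiplierP => t /=; elim/tensor_ind: t => [|a' b' t IH].
- by rewrite nmul0 (linear0 (tmap (nmul a) (nmul b))).
- by rewrite nmulDr IH linearD /= tens_mul tmap_tens.
- by rewrite n0mul (linear0 (mr (emb a ⊠ emb b))).
- by rewrite nmulDl IH (linearD (mr (emb a ⊠ emb b))) tens_mul /= (tmap_tens (mr (emb a)) (mr (emb b))).
Qed.

Lemma mtensM m m' n n' : (m ⊠ n) * (m' ⊠ n') = (m * m') ⊠ (n * n').
Proof. by apply: multiplierP => t; apply: tmap_comp. Qed.
Lemma mtens11 : 1 ⊠ 1 = 1 :> multiplier (A ⊗ B).
Proof. by apply: multiplierP => t; apply: tmap_idfun. Qed.
Lemma mtens_linear1 n : linear (fun m => m ⊠ n).
Proof.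
move=> k m m'; apply: multiplierP => t; rewrite /= /tmap -tlift_funP;
  congr (tlift _ t); apply/funext => a; apply/funext => b; exact: (tens_bilin A B).1.
Qed.
Lemma mtens_linear2 m : linear (fun n => m ⊠ n).
Proof.
move=> k n n'; apply: multiplierP => t; rewrite /= /tmap -tlift_funP;
  congr (tlift _ t); apply/funext => a; apply/funext => b; exact: (tens_bilin A B).2.
Qed.

Lemma slice1_ml2 w n t : slice1 w (ml (1 ⊠ n) t) = ml n (slice1 w t).
Proof. by rewrite (slice1_tmap idfun (ml n)) slice1_idfun. Qed.
Lemma slice1_mr2 w n t : slice1 w (mr (1 ⊠ n) t) = mr n (slice1 w t).
Proof. by rewrite (slice1_tmap idfun (mr n)) slice1_idfun. Qed.
Lemma slice2_ml1 w m t : slice2 w (ml (m ⊠ 1) t) = ml m (slice2 w t).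
Proof. by rewrite (slice2_tmap (ml m) idfun) slice2_idfun. Qed.
Lemma slice2_mr1 w m t : slice2 w (mr (m ⊠ 1) t) = mr m (slice2 w t).
Proof. by rewrite (slice2_tmap (mr m) idfun) slice2_idfun. Qed.

Hypotheses (ndA : nondegenerate_alg A) (ndB : nondegenerate_alg B).

Lemma cancel_ml1 z z' : (forall a, ml (emb a ⊠ 1) z = ml (emb a ⊠ 1) z') -> z = z'.
Proof.
move=> zz'; apply: slice2_inj => w; apply: nmull_inj => // a.
by have := congr1 (slice2 w) (zz' a); rewrite !slice2_ml1.
Qed.
Lemma cancel_ml2 z z' : (forall b, ml (1 ⊠ emb b) z = ml (1 ⊠ emb b) z') -> z = z'.
Proof.
move=> zz'; apply: slice1_inj => w; apply: nmull_inj => // a.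
by have := congr1 (slice1 w) (zz' a); rewrite !slice1_ml2.
Qed.
Lemma cancel_mr1 z z' : (forall a, mr (emb a ⊠ 1) z = mr (emb a ⊠ 1) z') -> z = z'.
Proof.
move=> zz'; apply: slice2_inj => w; apply: nmulr_inj => // a.
by have := congr1 (slice2 w) (zz' a); rewrite !slice2_mr1.
Qed.
Lemma cancel_mr2 z z' : (forall b, mr (1 ⊠ emb b) z = mr (1 ⊠ emb b) z') -> z = z'.
Proof.
move=> zz'; apply: slice1_inj => w; apply: nmulr_inj => // a.
by have := congr1 (slice1 w) (zz' a); rewrite !slice1_mr2.
Qed.

(** Multiplication in one leg commutes with slicing the other, so the two legs can be cancelled one
    after the other. *)
Lemma nondegenerate_tens : nondegenerate_alg (A ⊗ B)%type.
Proof.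
split=> t t0.
- apply: cancel_mr1 => a; rewrite linear0; apply: cancel_mr2 => b; rewrite linear0.
  rewrite -[LHS]/(mr ((emb a ⊠ 1) * (1 ⊠ emb b)) t) mtensM mulr1 mul1r -emb_tens.
  exact: t0.
- apply: cancel_ml1 => a; rewrite linear0; apply: cancel_ml2 => b; rewrite linear0.
  rewrite -[LHS]/(ml ((1 ⊠ emb b) * (emb a ⊠ 1)) t) mtensM mulr1 mul1r -emb_tens.
  exact: t0.
Qed.

End MultiplierTensors.

Lemma ml_tens_inj (K : fieldType) (A B : nuAlgType K) (m n : multiplier (A ⊗ B)) :
  nondegenerate_alg A -> nondegenerate_alg B ->
  (forall a b, ml m (a ⊗ b) = ml n (a ⊗ b)) -> m = n.
Proof.
move=> ndA ndB mn; apply: ml_inj; first exact: nondegenerate_tens.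
exact: linear_tensor_ext (@ml_linear _ _ m) (@ml_linear _ _ n) mn.
Qed.

Section MapCommute.
Variables (K : fieldType) (X X' Y : nuAlgType K) (h : {linear X -> X'}).

Lemma tmap_ml2 (n : multiplier Y) t :
  tmap h idfun (ml (1 ⊠ n) t) = ml (1 ⊠ n) (tmap h idfun t).
Proof.
apply: (tensor_ext (f := tmap h idfun \o ml (1 ⊠ n))
  (g := ml (1 ⊠ n) \o tmap h idfun)) => x y.
rewrite -[LHS]/(tmap _ _ (ml _ _)) -[RHS]/(ml _ (tmap _ _ _)).
by rewrite mul_tens1 !tmap_tens mul_tens1.
Qed.
Lemma tmap_mr2 (n : multiplier Y) t :
  tmap h idfun (mr (1 ⊠ n) t) = mr (1 ⊠ n) (tmap h idfun t).
Proof.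
apply: (tensor_ext (f := tmap h idfun \o mr (1 ⊠ n))
  (g := mr (1 ⊠ n) \o tmap h idfun)) => x y.
rewrite -[LHS]/(tmap _ _ (mr _ _)) -[RHS]/(mr _ (tmap _ _ _)).
by rewrite mul_tens2 !tmap_tens mul_tens2.
Qed.
Lemma tmap_ml1 (n : multiplier Y) t :
  tmap idfun h (ml (n ⊠ 1) t) = ml (n ⊠ 1) (tmap idfun h t).
Proof.
apply: (tensor_ext (f := tmap idfun h \o ml (n ⊠ 1))
  (g := ml (n ⊠ 1) \o tmap idfun h)) => x y.
rewrite -[LHS]/(tmap _ _ (ml _ _)) -[RHS]/(ml _ (tmap _ _ _)).
by rewrite mul_tens1 !tmap_tens mul_tens1.
Qed.
Lemma tmap_mr1 (n : multiplier Y) t :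
  tmap idfun h (mr (n ⊠ 1) t) = mr (n ⊠ 1) (tmap idfun h t).
Proof.
apply: (tensor_ext (f := tmap idfun h \o mr (n ⊠ 1))
  (g := mr (n ⊠ 1) \o tmap idfun h)) => x y.
rewrite -[LHS]/(tmap _ _ (mr _ _)) -[RHS]/(mr _ (tmap _ _ _)).
by rewrite mul_tens2 !tmap_tens mul_tens2.
Qed.

End MapCommute.

Section Pull.
Variables (K : fieldType) (X Y : nuAlgType K) (f : nuiso X Y).

Lemma mpullM (m n : multiplier Y) : mpull f (m * n) = mpull f m * mpull f n.
Proof. by apply: multiplierP => x /=; rewrite iso_invK. Qed.
Lemma mpull_emb y : mpull f (emb y) = emb (iso_inv f y).
Proof. by apply: multiplierP => x /=; rewrite iso_inv_mul iso_toK. Qed.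
Lemma mpull_linear : linear (mpull f).
Proof. by move=> k m n; apply: multiplierP => x /=; rewrite iso_inv_linear. Qed.

End Pull.

Section FlipMap.
Variable K : fieldType.

HB.instance Definition _ (X Y : nuAlgType K) := GRing.isLinear.Build K
  (X ⊗ Y)%type (Y ⊗ X)%type *:%R (@tflip K X Y) (@tflip_linear K X Y).

Lemma tflip_tmap (X Y X' Y' : nuAlgType K) (f : {linear X -> X'})
  (g : {linear Y -> Y'}) t : tflip (tmap f g t) = tmap g f (tflip t).
Proof.
elim/tensor_ind: t => [|u v t IH]; first by rewrite !linear0.
by rewrite !linearD /= IH tflipE !tmap_tens tflipE.
Qed.

Lemma slice1_flip (X Y : nuAlgType K) (w : {scalar Y}) (t : X ⊗ Y) :
  slice1 w (tflip t) = slice2 w t.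
Proof.
elim/tensor_ind: t => [|u v t IH]; first by rewrite !linear0.
by rewrite !linearD /= IH tflipE slice1E slice2E.
Qed.
Lemma slice2_flip (X Y : nuAlgType K) (w : {scalar X}) (t : X ⊗ Y) :
  slice2 w (tflip t) = slice1 w t.
Proof. by rewrite -[t in RHS]tflipK slice1_flip. Qed.

End FlipMap.

Section FlipPull.
Variables (K : fieldType) (A B : nuAlgType K).

Lemma mflip_tens (m : multiplier A) (n : multiplier B) :
  mpull (flip_iso B A) (m ⊠ n) = n ⊠ m.
Proof.
by apply: multiplierP => t; rewrite /= ?(tflip_tmap (ml m) (ml n))
  ?(tflip_tmap (mr m) (mr n)) tflipK.
Qed.


End FlipPull.

(** * The setting *)

Section Evaluation.
Variables (K : fieldType) (A : nuAlgType K).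

Definition evl (a : A) (m : multiplier A) : A := ml m a.
Definition evr (a : A) (m : multiplier A) : A := mr m a.
Lemma evl_linear a : linear (evl a). Proof. by []. Qed.
Lemma evr_linear a : linear (evr a). Proof. by []. Qed.
HB.instance Definition _ a :=
  GRing.isLinear.Build K (multiplier A) A *:%R (evl a) (evl_linear a).
HB.instance Definition _ a :=
  GRing.isLinear.Build K (multiplier A) A *:%R (evr a) (evr_linear a).

End Evaluation.

Section TensHom.
Variables (K : fieldType) (A : nuAlgType K) (B C : lmodType K).
Variables (iB : {linear B -> multiplier A}) (iC : {linear C -> multiplier A}).

(* [tens_hom] only uses the linear structures of B and C. *)
Definition thom (x : B ⊗ C) : multiplier (A ⊗ A) :=
  tlift (fun b c => iB b ⊠ iC c) x.

Lemma thom_bilin : bilin (fun b c => iB b ⊠ iC c).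
Proof.
split=> [c k b b'|b k c c']; rewrite linearP.
- exact: mtens_linear1.
- exact: mtens_linear2.
Qed.
HB.instance Definition _ := GRing.isLinear.Build K (B ⊗ C)%type
  (multiplier (A ⊗ A)) *:%R thom (tlift_linear thom_bilin).

Lemma thomE b c : thom (b ⊗ c) = iB b ⊠ iC c.
Proof. exact/tliftE/thom_bilin. Qed.

Lemma ml_thom x a a' : ml (thom x) (a ⊗ a') = tmap (evl a \o iB) (evl a' \o iC) x.
Proof.
apply: (tensor_ext (f := evl (a ⊗ a') \o thom) (g := tmap _ _)) => b c.
by rewrite /= thomE tmap_tens; apply: mul_tens1.
Qed.

End TensHom.

HB.instance Definition _ (K : fieldType) (X Y Z : nuAlgType K) :=
  GRing.isLinear.Build K (X ⊗ Y ⊗ Z)%type (X ⊗ Z ⊗ Y)%type *:%R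
  (@tswap K X Y Z) (@tswap_linear K X Y Z).

Section Setting.
Variables (K : fieldType) (A : nuAlgType K) (D : A -> multiplier (A ⊗ A)).
Variables (E : multiplier (A ⊗ A)) (t1 t2 t3 t4 : A -> A -> A ⊗ A).
Variables (B C : lmodType K).
Variables (iB : {linear B -> multiplier A}) (iC : {linear C -> multiplier A}).
Variables (SB : {linear B -> C}) (SC : {linear C -> B}).
Variables (TB : {linear C -> B}) (TC : {linear B -> C}).
Variables (e1 : B -> B ⊗ C) (e3 : C -> B ⊗ C).

Lemma anti_flip_bilin : bilin (fun b c => SC c ⊗ SB b).
Proof.
split=> [c k b b'|b k c c']; rewrite linearP ?linearP //.
by rewrite tensDl tensZl.
Qed.
Definition anti_flip : {linear (B ⊗ C)%type -> (B ⊗ C)%type} :=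
  linfun_of (tlift_linear anti_flip_bilin).
Lemma anti_flipE b c : anti_flip (b ⊗ c) = SC c ⊗ SB b.
Proof. exact/tliftE/anti_flip_bilin. Qed.

Lemma mulBC_bilin : bilin (fun b c => iB b * iB (SC c)).
Proof.
split=> [c k b b'|b k c c']; rewrite !linearP.
- exact: (mrmul_linear (iB (SC c))).
- exact: (mlmul_linear (iB b)).
Qed.
(** Applied to (b ⊗ 1)E it gives bE_1 S_C(E_2), so that [mul_e1] expresses E_1 S_C(E_2) = 1 inside B
    ⊗ C. In the same way [mulCB] and [mul_e3] express S_B(E_1)E_2 = 1. *)
Definition mulBC : {linear (B ⊗ C)%type -> multiplier A} :=
  linfun_of (tlift_linear mulBC_bilin).
Lemma mulBCE b c : mulBC (b ⊗ c) = iB b * iB (SC c).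
Proof. exact/tliftE/mulBC_bilin. Qed.

Lemma mulCB_bilin : bilin (fun b c => iC (SB b) * iC c).
Proof.
split=> [c k b b'|b k c c']; rewrite !linearP.
- exact: (mrmul_linear (iC c)).
- exact: (mlmul_linear (iC (SB b))).
Qed.
Definition mulCB : {linear (B ⊗ C)%type -> multiplier A} :=
  linfun_of (tlift_linear mulCB_bilin).
Lemma mulCBE b c : mulCB (b ⊗ c) = iC (SB b) * iC c.
Proof. exact/tliftE/mulCB_bilin. Qed.

(* The hypotheses on (A, Δ, E, B, C) in a form that is invariant under the
   passages to (A, Δ^cop) and to (A^op, Δ^cop). The elements [t1 a b], [t2 a c],
   [t3 a b], [t4 a c] are Δ(a)(1 ⊗ b), (c ⊗ 1)Δ(a), (1 ⊗ b)Δ(a), Δ(a)(c ⊗ 1);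
   [e1 b] and [e3 c] are (b ⊗ 1)E and E(1 ⊗ c); [anti_flip] is (S_C ⊗ S_B)ζ.
   Coassociativity says that slicing by a functional on the left commutes with
   slicing by a functional on the right. *)
Record setting : Prop := Setting {
  ndA : nondegenerate_alg A;
  D_linear : linear D;
  D_mul : forall a b, D (a ** b) = D a * D b;
  ED : forall a, E * D a = D a;
  DE : forall a, D a * E = D a;
  emb_t1 : forall a b, emb (t1 a b) = D a * (1 ⊠ emb b);
  emb_t2 : forall a c, emb (t2 a c) = (emb c ⊠ 1) * D a;
  emb_t3 : forall a b, emb (t3 a b) = (1 ⊠ emb b) * D a;
  emb_t4 : forall a c, emb (t4 a c) = D a * (emb c ⊠ 1);
  coass12 : forall w c w' b a, slice1 w (t2 (slice2 w' (t1 a b)) c) =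
    slice2 w' (t1 (slice1 w (t2 a c)) b);
  coass34 : forall w c w' b a, slice1 w (t4 (slice2 w' (t3 a b)) c) =
    slice2 w' (t3 (slice1 w (t4 a c)) b);
  spanBA : lspan [set z | exists x y, z = ml (iB x) y] = setT;
  spanAB : lspan [set z | exists x y, z = mr (iB x) y] = setT;
  spanCA : lspan [set z | exists x y, z = ml (iC x) y] = setT;
  spanAC : lspan [set z | exists x y, z = mr (iC x) y] = setT;
  SBK : cancel SB TB; TBK : cancel TB SB;
  SCK : cancel SC TC; TCK : cancel TC SC;
  iB_inj : injective iB;
  iC_inj : injective iC;
  E_SB : forall b, E * (iB b ⊠ 1) = E * (1 ⊠ iC (SB b));
  E_SC : forall c, (1 ⊠ iC c) * E = (iB (SC c) ⊠ 1) * E;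
  thom_e1 : forall b, thom iB iC (e1 b) = (iB b ⊠ 1) * E;
  thom_e1_flip : forall b, thom iB iC (anti_flip (e1 b)) = E * (iB b ⊠ 1);
  thom_e3 : forall c, thom iB iC (e3 c) = E * (1 ⊠ iC c);
  thom_e3_flip : forall c, thom iB iC (anti_flip (e3 c)) = (1 ⊠ iC c) * E;
  mul_e1 : forall b, mulBC (e1 b) = iB b;
  mul_e3 : forall c, mulCB (e3 c) = iC c;
  leg1_e1 : forall f : {scalar B}, (forall b, slice1 f (e1 b) = 0) -> forall b, f b = 0;
  leg1_e3 : forall f : {scalar B}, (forall c, slice1 f (e3 c) = 0) -> forall b, f b = 0;
  leg2_e1 : forall f : {scalar C}, (forall b, slice2 f (e1 b) = 0) -> forall c, f c = 0;
  leg2_e3 : forall f : {scalar C}, (forall c, slice2 f (e3 c) = 0) -> forall c, f c = 0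
}.

(* aβ_i ⊗ S_C(γ_i)b, for β_i ⊗ γ_i in B ⊗ C. *)
Definition rho a b : {linear (B ⊗ C)%type -> (A ⊗ A)%type} :=
  tmap (evr a \o iB) (evl b \o (iB \o SC)).
Definition rho3 a b : {linear (B ⊗ C)%type -> (A ⊗ A)%type} :=
  tmap (evr a \o iB) (evr b \o (iB \o SC)).
(** The counterparts for F_2 = (S_B ⊗ ι)E of the maps for F_1: the passage to (A^op, Δ^cop) turns
    [lam3] into [rho] and [lam] into [rho3]. *)
Definition lam a b : {linear (B ⊗ C)%type -> (A ⊗ A)%type} :=
  tmap (evl b \o (iC \o SB)) (evl a \o iC).
Definition lam3 a b : {linear (B ⊗ C)%type -> (A ⊗ A)%type} :=
  tmap (evr b \o (iC \o SB)) (evl a \o iC).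

(* The integral formulas (ψ ⊗ ι)Δ(a) = (ψ ⊗ ι)((a ⊗ 1)F_1) and
   (ι ⊗ φ)Δ(a) = (ι ⊗ φ)(F_2(1 ⊗ a)), with F_1 and F_2 written out. *)
Definition right_formula (psi : {scalar A}) : Prop :=
  [/\ forall a b x, slice1 psi (t1 (mr (iB x) a) b) = slice1 psi (rho a b (e1 x)),
      forall a b x, slice1 psi (t1 a (ml (iB x) b)) = slice1 psi (rho a b (e1 x)) &
      forall a b x, slice1 psi (t3 a (mr (iB (SC x)) b)) =
        slice1 psi (rho3 a b (e3 x))].
Definition left_formula (phi : {scalar A}) : Prop :=
  [/\ forall a b x, slice2 phi (t2 (ml (iC x) a) b) = slice2 phi (lam3 a b (e3 x)),
      forall a b x, slice2 phi (t2 a (mr (iC x) b)) = slice2 phi (lam3 a b (e3 x)) &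
      forall a b x, slice2 phi (t4 a (ml (iC (SB x)) b)) =
        slice2 phi (lam a b (e1 x))].

End Setting.

(** * The range and the kernel of the first canonical map *)

(* What the setting yields for T_1; the second and the last fields are the
   statements T_1(A ⊗ A) = E(A ⊗ A) and
   (G_1 ⊗ ι)(Δ_13(a)(1 ⊗ b ⊗ c)) = Δ_13(a)(1 ⊗ E)(1 ⊗ b ⊗ c), evaluated in
   A ⊗ A and A ⊗ A ⊗ A. *)
Record T1_spec (K : fieldType) (A : nuAlgType K) (D : A -> multiplier (A ⊗ A))
    (E : multiplier (A ⊗ A)) (t1 : A -> A -> A ⊗ A) (B : lmodType K)
    (iB : B -> multiplier A) (G : A ⊗ A -> A ⊗ A) : Prop := T1Spec {
  spec_full : forall W : set A, is_subspace W ->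
    (forall a b, tens_sub W setT (t1 a b)) -> W = setT;
  spec_range : forall y, exists y', tlift t1 y' = ml E y;
  spec_mulB : forall a x, D (mr (iB x) a) = D a * (1 ⊠ iB x);
  spec_linear : linear G;
  spec_ker : [set y | tlift t1 y = 0] = range (fun y => y - G y);
  spec_D13 : forall a b c, tmap G idfun (tswap (t1 a c ⊗ b)) =
    tlift (fun b' c' => tswap (t1 a c' ⊗ b')) (ml E (b ⊗ c))
}.

Section FirstCanonicalMap.
Variables (K : fieldType) (A : nuAlgType K) (D : A -> multiplier (A ⊗ A)).
Variables (E : multiplier (A ⊗ A)) (t1 t2 t3 t4 : A -> A -> A ⊗ A).
Variables (B C : lmodType K).
Variables (iB : {linear B -> multiplier A}) (iC : {linear C -> multiplier A}).
Variables (SB : {linear B -> C}) (SC : {linear C -> B}).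
Variables (TB : {linear C -> B}) (TC : {linear B -> C}).
Variables (e1 : B -> B ⊗ C) (e3 : C -> B ⊗ C).
Hypothesis S : setting D E t1 t2 t3 t4 iB iC SB SC TB TC e1 e3.
Variables (L1 L2 : set {scalar A}).
Hypothesis L1_faithful : right_faithful L1.
Hypothesis L2_faithful : left_faithful L2.
Hypothesis L1_formula : forall psi, L1 psi -> right_formula t1 t3 iB SC e1 e3 psi.
Hypothesis L2_formula : forall phi, L2 phi -> left_formula t2 t4 iC SB e1 e3 phi.

Let ndA : nondegenerate_alg A := ndA S.
Let ndAA : nondegenerate_alg (A ⊗ A)%type := nondegenerate_tens ndA ndA.
Let embI : injective (@emb K (A ⊗ A)%type) := emb_inj ndAA.

Lemma t1_bilin : bilin t1.
Proof.
split=> [b k a a'|a k b b']; apply: embI; rewrite [in RHS]emb_linear !(emb_t1 S).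
- rewrite (D_linear S); exact: (mrmul_linear (1 ⊠ emb b)).
- rewrite emb_linear (mtens_linear2 1); exact: (mlmul_linear (D a)).
Qed.

Definition T : {linear (A ⊗ A)%type -> (A ⊗ A)%type} :=
  linfun_of (tlift_linear t1_bilin).
Lemma TE a b : T (a ⊗ b) = t1 a b.
Proof. exact/tliftE/t1_bilin. Qed.

Lemma t1_mulr a b b' : t1 a (b ** b') = mr (1 ⊠ emb b') (t1 a b).
Proof. by apply: embI; rewrite emb_mr !(emb_t1 S) -mulrA mtensM mulr1 embM. Qed.

Lemma t1_mull a a' b : t1 (a ** a') b = ml (D a) (t1 a' b).
Proof. by apply: embI; rewrite emb_ml !(emb_t1 S) (D_mul S) mulrA. Qed.

Lemma t2_t1 p q c : mr (1 ⊠ emb q) (t2 p c) = ml (emb c ⊠ 1) (t1 p q).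
Proof. by apply: embI; rewrite emb_mr emb_ml (emb_t1 S) (emb_t2 S) mulrA. Qed.

Lemma D_tens s u v : ml (D s) (u ⊗ v) = mr (emb u ⊠ 1) (t1 s v).
Proof.
by apply: embI; rewrite emb_mr emb_ml (emb_t1 S) -mulrA mtensM mulr1 mul1r emb_tens.
Qed.

Lemma D_t4 s q b : ml (D s) (t4 q b) = t4 (s ** q) b.
Proof. by apply: embI; rewrite emb_ml !(emb_t4 S) (D_mul S) mulrA. Qed.

(** Δ(a) absorbs E on both sides and thus inherits the exchange relations of E with B and C. *)
Lemma D_iB a x : D a * (iB x ⊠ 1) = D a * (1 ⊠ iC (SB x)).
Proof. by rewrite -(DE S) -!mulrA (E_SB S). Qed.

Lemma iC_D a x : (1 ⊠ iC x) * D a = (iB (SC x) ⊠ 1) * D a.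
Proof. by rewrite -(ED S) !mulrA (E_SC S). Qed.

Lemma t1_iB a c x : mr (iB x ⊠ 1) (t1 a c) = t1 a (ml (iC (SB x)) c).
Proof.
apply: embI; rewrite emb_mr !(emb_t1 S) emb_ml -mulrA mtensM mulr1 mul1r.
have -> : iB x ⊠ emb c = (iB x ⊠ 1) * (1 ⊠ emb c) by rewrite mtensM mulr1 mul1r.
by rewrite mulrA D_iB -mulrA mtensM mulr1.
Qed.

Lemma t2_iC p c x : ml (1 ⊠ iC x) (t2 p c) = t2 p (mr (iB (SC x)) c).
Proof.
apply: embI; rewrite emb_ml !(emb_t2 S) emb_mr mulrA mtensM mulr1 mul1r.
have -> : emb c ⊠ iC x = (emb c ⊠ 1) * (1 ⊠ iC x) by rewrite mtensM mulr1 mul1r.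
by rewrite -mulrA iC_D mulrA mtensM mulr1.
Qed.

Lemma iB_ind (P : A -> Prop) : is_subspace P ->
  (forall x a, P (ml (iB x) a)) -> forall a, P a.
Proof.
by move=> sP Px; apply: lspanT_ind (spanBA S) sP _ => _ [x [y ->]].
Qed.
Lemma iBr_ind (P : A -> Prop) : is_subspace P ->
  (forall x a, P (mr (iB x) a)) -> forall a, P a.
Proof.
by move=> sP Px; apply: lspanT_ind (spanAB S) sP _ => _ [x [y ->]].
Qed.
Lemma iC_ind (P : A -> Prop) : is_subspace P ->
  (forall x a, P (ml (iC (SB x)) a)) -> forall a, P a.
Proof.
move=> sP Px; apply: lspanT_ind (spanCA S) sP _ => _ [x [y ->]].
by rewrite -[x](TBK S).
Qed.

(** Right faithfulness says that the functionals ψ(p·) separate the points of A; slicing the second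
    leg carries this over to A ⊗ A. *)
Lemma L1_inj (y y' : A ⊗ A) :
  (forall psi p, L1 psi -> slice1 (psi \o nmul p) y = slice1 (psi \o nmul p) y') ->
  y = y'.
Proof.
move=> yy'; apply: slice2_inj => w; apply/eqP; rewrite -subr_eq0; apply/eqP.
apply: L1_faithful => p psi L1psi; rewrite linearB linearB /=.
by have := congr1 w (yy' psi p L1psi); rewrite !slice12 /= => ->; rewrite subrr.
Qed.

Notation rho := (rho iB SC).

Lemma slice_rho (psi : {scalar A}) p a b x :
  slice1 (psi \o nmul p) (rho a b x) = slice1 psi (rho (p ** a) b x).
Proof.
rewrite /rho !slice1_tmap; congr (_ _); apply: eq_slice1 => y /=.
by rewrite /evr mr_mul.
Qed.

(* ψ(p·) ranges over a separating family of functionals, and the values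
   prescribed here are those of (a ⊗ 1)F_1(1 ⊗ b) for t = a ⊗ b. *)
Lemma G_ex t : exists y, forall psi p, L1 psi ->
  slice1 (psi \o nmul p) y = slice1 psi (T (ml (emb p ⊠ 1) t)).
Proof.
elim/tensor_ind: t => [|a b t [y yP]].
  by exists 0 => psi p _; rewrite ml0 !linear0.
suff [z zP] : exists z, forall psi p, L1 psi ->
    slice1 (psi \o nmul p) z = slice1 psi (t1 (p ** a) b).
  exists (z + y) => psi p Lpsi; rewrite slice1D zP // yP //.
  by rewrite mlD mul_tens1 [T (_ + _)]linearD TE slice1D.
move: a; apply: iBr_ind => [|x a].
  split=> [|k a a' [z zP] [z' z'P]].
    by exists 0 => psi p _; rewrite nmul0 (lin0 (t1_bilin.1 b)) !slice10.
  exists (k *: z + z') => psi p Lpsi; rewrite slice1P zP // z'P //.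
  by rewrite nmulDr nscaleAr (t1_bilin.1 b) slice1P.
exists (rho a b (e1 x)) => psi p Lpsi; rewrite slice_rho.
by have [/(_ (p ** a) b x) <- _ _] := L1_formula Lpsi; rewrite mr_mul.
Qed.
(** By [L1_inj] the element chosen is the only possible one, whence the linearity of [G]. *)
Definition G : A ⊗ A -> A ⊗ A := projT1 (choice G_ex).
Lemma GE t psi p : L1 psi ->
  slice1 (psi \o nmul p) (G t) = slice1 psi (T (ml (emb p ⊠ 1) t)).
Proof. exact: (projT2 (choice G_ex)). Qed.

Lemma G_linear : linear G.
Proof.
move=> k t t'; apply: L1_inj => psi p Lpsi.
by rewrite slice1P !GE // ml_linear linearP slice1P.
Qed.
Definition Gl : {linear (A ⊗ A)%type -> (A ⊗ A)%type} := linfun_of G_linear.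

Lemma G_iBr a b x : G (mr (iB x) a ⊗ b) = rho a b (e1 x).
Proof.
apply: L1_inj => psi p Lpsi; rewrite GE // mul_tens1 TE slice_rho.
by have [<- _ _] := L1_formula Lpsi; rewrite mr_mul.
Qed.
(** The value is that of [G_iBr]: as (x ⊗ 1)F_1 = F_1(1 ⊗ x), the factor x may stand in either
    leg. *)
Lemma G_iB a b x : G (a ⊗ ml (iB x) b) = rho a b (e1 x).
Proof.
apply: L1_inj => psi p Lpsi; rewrite GE // mul_tens1 TE slice_rho.
by have [_ <- _] := L1_formula Lpsi.
Qed.

Lemma T_mull p t : T (ml (emb p ⊠ 1) t) = ml (D p) (T t).
Proof.
apply: (tensor_ext (f := T \o ml (emb p ⊠ 1)) (g := ml (D p) \o T)) => a b.
rewrite -[LHS]/(T (ml _ _)) -[RHS]/(ml _ (T _)).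
by rewrite mul_tens1 !TE -t1_mull.
Qed.

Lemma kerT_kerG t : T t = 0 -> G t = 0.
Proof.
by move=> Tt; apply: L1_inj => psi p Lpsi; rewrite GE // T_mull Tt !linear0.
Qed.

Definition V : set A :=
  lspan [set z | exists phi p q, L2 phi /\ z = slice2 phi (t1 p q)].

Lemma V_subspace : is_subspace V. Proof. exact: lspan_subspace. Qed.

Lemma VA_subspace : is_subspace (tens_sub V (@setT A)).
Proof. exact: tens_sub_subspace. Qed.

(** If w vanishes on V, then φ((w ⊗ ι)(Δ(a)(1 ⊗ b))b') = w((ι ⊗ φ)(Δ(a)(1 ⊗ bb'))) = 0 for all b'
    and φ, and left faithfulness shows that the slice by w is 0. *)
Lemma t1_V a b : tens_sub V setT (t1 a b).
Proof.
apply: (tens_subP V_subspace) => w wV; apply: L2_faithful => b' phi L2phi.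
rewrite -[_ ** _]/(mr (emb b') _) -slice1_mr2 -t1_mulr slice12 wV //.
by apply: lspan_incl; exists phi, a, (b ** b').
Qed.

Lemma theta_bilin (phi : {scalar A}) p :
  bilin (fun u v : A => slice2 phi (t1 p v) ⊗ u).
Proof.
split=> [v k u u'|u k v v']; first exact: linearP.
by rewrite (t1_bilin.2 p) slice2P tensDl tensZl.
Qed.
(** In Sweedler notation, u ⊗ v is sent to p_1 φ(p_2 v) ⊗ u. Its value at Δ(q)(b ⊗ 1) is the
    preimage of E(p_1 φ(p_2 q) ⊗ b) under T that the classical formula prescribes. *)
Definition theta phi p : {linear (A ⊗ A)%type -> (A ⊗ A)%type} :=
  linfun_of (tlift_linear (theta_bilin phi p)).
Lemma thetaE phi p u v : theta phi p (u ⊗ v) = slice2 phi (t1 p v) ⊗ u.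
Proof. exact/tliftE/theta_bilin. Qed.

Lemma slice_T w c a u :
  slice1 w (ml (emb c ⊠ 1) (T (a ⊗ u))) = slice1 w (t2 a c) ** u.
Proof.
by rewrite TE -t2_t1 slice1_mr2.
Qed.

(** Both sides are w(cp_1)p_2 u φ(p_3 v); by coassociativity the slices by w and by φ can be taken
    in either order. *)
Lemma slice_T_theta w c phi p y :
  slice1 w (ml (emb c ⊠ 1) (T (theta phi p y))) =
  slice2 phi (ml (D (slice1 w (t2 p c))) y).
Proof.
apply: (tensor_ext (f := slice1 w \o (ml (emb c ⊠ 1) \o (T \o theta phi p)))
  (g := slice2 phi \o ml (D (slice1 w (t2 p c))))) => u v.
rewrite -[LHS]/(slice1 w (ml _ (T (theta phi p _)))).
rewrite -[RHS]/(slice2 phi (ml (D _) _)) thetaE slice_T D_tens (coass12 S).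
by rewrite slice2_mr1.
Qed.

(** Since E(1 ⊗ S_B(x)) = E(x ⊗ 1) is (S_C ⊗ S_B)ζ applied to (x ⊗ 1)E, the idempotent acts here
    through an element of B ⊗ C. *)
Lemma E_iC g b x : ml E (g ⊗ ml (iC (SB x)) b) =
  tmap (evl g \o iB) (evl b \o iC) (anti_flip SB SC (e1 x)).
Proof.
rewrite -ml_thom (thom_e1_flip S) (E_SB S) /=.
by rewrite (tmap_tens idfun (ml (iC (SB x)))).
Qed.

Lemma t4_linear a : linear (t4 a).
Proof.
move=> k b b'; apply: embI; rewrite [in RHS]emb_linear !(emb_t4 S).
by rewrite emb_linear (mtens_linear1 1); apply: (mlmul_linear (D a)).
Qed.

(* In Sweedler notation, with a = p_1 φ(p_2 q): coassociativity gives
   p_1 ⊗ p_2 q_1 b φ(p_3 q_2) = p_1 ⊗ S_B(E_1) b φ(E_2 p_2 q), left invariance of φ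
   being used in the second leg, and this is E(a ⊗ b) because
   (1 ⊗ c)Δ(p) = (S_C(c) ⊗ 1)Δ(p) and (S_C ⊗ S_B)ζE = E. *)
Lemma T_theta_t4 phi p q b : L2 phi ->
  T (theta phi p (t4 q b)) = ml E (slice2 phi (t1 p q) ⊗ b).
Proof.
move=> L2phi; apply: (cancel_ml1 ndA) => c; apply: slice1_inj => w.
rewrite slice_T_theta D_t4; set h := slice1 w _; set g := slice2 phi (t1 p q).
move: b; apply: iC_ind => [|x b].
  exact: (@eq_subspace K A A (slice2 phi \o linfun_of (@t4_linear (h ** q)))
    (slice1 w \o (ml (emb c ⊠ 1) \o (ml E \o tens g)))).
have [_ _ ->] := L2_formula L2phi; rewrite E_iC.
apply: (tensor_ext (f := slice2 phi \o lam iC SB (h ** q) b)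
  (g := slice1 w \o (ml (emb c ⊠ 1) \o (tmap (evl g \o iB) (evl b \o iC) \o
     anti_flip SB SC)))) => y z.
rewrite -[LHS]/(slice2 phi (tmap _ _ _)).
rewrite -[RHS]/(slice1 w (ml _ (tmap _ _ (anti_flip SB SC _)))).
rewrite anti_flipE !tmap_tens mul_tens1 slice2E slice1E /= /evl.
congr (_ *: _).
(* What remains is φ(zhq) = w(cS_C(z)g), and it comes from (1 ⊗ z)Δ(p) = (S_C(z) ⊗ 1)Δ(p). *)
rewrite ml_mul -(slice1_ml2 w) t2_iC -[_ ** q]/(mr (emb q) _) -(slice1_mr2 w) t2_t1.
by rewrite slice12 slice2_ml1 /= mlr.
Qed.

(** The preimage is found inside V ⊗ A because [theta] takes its values there; [V_full] relies on
    this. *)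
Lemma E_V y : tens_sub V setT y -> exists2 y', tens_sub V setT y' & T y' = ml E y.
Proof.
move: y; have [VA0 VAD] := VA_subspace.
apply: lspan_sub => [|_ [v [b [Vv _ ->]]]].
  split=> [|k u u' [y Vy Ty] [y' Vy' Ty']]; first by exists 0; rewrite ?linear0 ?ml0.
  by exists (k *: y + y'); [exact: VAD | rewrite linearP Ty Ty' ml_linear].
move: v Vv; apply: lspan_sub => [|_ [phi [p [q [L2phi ->]]]]].
  split=> [|k u u' [y Vy Ty] [y' Vy' Ty']].
    by exists 0; rewrite ?linear0 // tens0l ml0.
  exists (k *: y + y'); first exact: VAD.
  by rewrite linearP Ty Ty' tensDl tensZl ml_linear.
exists (theta phi p (t4 q b)); last exact: T_theta_t4.
elim/tensor_ind: (t4 q b) => [|u u' y IH]; first by rewrite linear0.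
rewrite linearD; apply: (subspaceD VA_subspace) => //; rewrite thetaE.
by apply: tens_sub_tens => //; apply: lspan_incl; exists phi, p, u'.
Qed.

Lemma E_T y : ml E (T y) = T y.
Proof.
apply: (tensor_ext (f := ml E \o T) (g := T)) => a b.
rewrite -[LHS]/(ml E (T _)) TE; apply: embI.
by rewrite emb_ml (emb_t1 S) mulrA (ED S).
Qed.

Lemma T_V y : tens_sub V setT (T y).
Proof.
elim/tensor_ind: y => [|a b y IH]; first by rewrite linear0; case: VA_subspace.
by rewrite linearD TE; apply: (subspaceD VA_subspace) => //; apply: t1_V.
Qed.

(** By Δ(p)(x ⊗ q) = Δ(p)(1 ⊗ S_B(x)q), multiplying a slice by x amounts to a change of q.
    Consequently G preserves V ⊗ A. *)
Lemma V_iB v x : V v -> V (mr (iB x) v).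
Proof.
move: v; have [V0 VD] := V_subspace; apply: lspan_sub => [|_ [phi [p [q [L2phi ->]]]]].
  by split=> [|k u u' Vu Vu']; rewrite /= ?mr0 // mr_linear; apply: VD.
by rewrite /= -slice2_mr1 t1_iB; apply: lspan_incl; exists phi, p, (ml (iC (SB x)) q).
Qed.

Lemma G_V y : tens_sub V setT y -> tens_sub V setT (G y).
Proof.
move: y; have [VA0 VAD] := VA_subspace.
apply: lspan_sub => [|_ [v [b [Vv _ ->]]]].
  by split=> [|k u u' Vu Vu']; rewrite /= ?(lin0 G_linear) // G_linear; apply: VAD.
move: b; apply: iB_ind => [|x b].
  split=> [|k b b' Vb Vb'].
    by rewrite linear0 (lin0 G_linear).
  by rewrite linearP G_linear; apply: VAD.
rewrite G_iB; elim/tensor_ind: (e1 x) => [|y z u IH]; first by rewrite linear0.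
rewrite linearD /=; apply: (subspaceD VA_subspace) => //; rewrite tmap_tens.
by apply: tens_sub_tens => //; apply: V_iB.
Qed.

(* T(A ⊗ A) is contained in E(V ⊗ A) = T(V ⊗ A), so A ⊗ A is V ⊗ A up to the
   kernel of T, on which G vanishes. Hence G maps A ⊗ A to V ⊗ A, that is, V
   contains AB = A. *)
Lemma V_full : V = setT.
Proof.
have GV a b : tens_sub V setT (G (a ⊗ b)).
  have [y' Vy'] := E_V (T_V (a ⊗ b)); rewrite E_T => Ty'.
  have : G (y' - a ⊗ b) = 0 by apply: kerT_kerG; rewrite linearB Ty' subrr.
  rewrite -[G _]/(Gl _) linearB => /eqP; rewrite subr_eq0 => /eqP Gy'.
  by rewrite -[G _]/(Gl _) -Gy'; apply: G_V.
apply: (subspace_setT V_subspace) => w wV; apply: iBr_ind => [|x a].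
  by split=> [|k a a' wa wa']; rewrite ?linear0 // linearP /= wa wa' mulr0 addr0.
(* By fullness of E it suffices to kill the slices of (x ⊗ 1)E by w(a·). After S_C and evaluation at
   b, such a slice becomes the slice by w of G(ax ⊗ b), and the left leg of this element lies in
   V. *)
apply: (leg1_e1 S (f := w \o (evr a \o iB))) => {}x.
apply: (can_inj (SCK S)); apply: (iB_inj S); rewrite !linear0.
apply: (ml_inj ndA) => b.
have := slice1_sub wV (GV (mr (iB x) a) b); rewrite G_iBr slice1_tmap.
exact.
Qed.

Lemma t1_full (W : set A) : is_subspace W ->
  (forall a b, tens_sub W setT (t1 a b)) -> W = setT.
Proof.
move=> sW Wt1; apply: (subspace_setT sW) => w wW v.
have : V v by rewrite V_full.
move: v; apply: lspan_sub => [|_ [phi [p [q [L2phi ->]]]]].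
  by split=> [|k a a' wa wa']; rewrite /= ?linear0 // linearP /= wa wa' mulr0 addr0.
by rewrite /= -slice12 (slice1_sub wW) ?linear0.
Qed.

Lemma range_T y : exists y', T y' = ml E y.
Proof.
have [|y' _ Ty'] := @E_V y; last by exists y'.
rewrite V_full; elim/tensor_ind: y => [|a b y IH].
  by case: (tens_sub_subspace (@setT A) (@setT A)).
by apply: (subspaceD (tens_sub_subspace _ _)) => //; apply: tens_sub_tens.
Qed.

(* Multiplying a slice (ι ⊗ φ)(Δ(p)(1 ⊗ q)) by x on the right only changes q, and
   these slices span A. *)
Lemma t1_mulB a b x : t1 (mr (iB x) a) b = t1 a (ml (iB x) b).
Proof.
apply: (cancel_ml1 ndA) => c; apply: slice1_inj => w.
rewrite -!TE !slice_T mlr; congr (_ ** _).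
have t2_bilin c' : linear (fun a => t2 a c').
  move=> k u u'; apply: embI; rewrite [in RHS]emb_linear !(emb_t2 S) (D_linear S).
  exact: (mlmul_linear (emb c' ⊠ 1)).
have : V a by rewrite V_full.
move: a; apply: lspan_sub => [|_ [phi [p [q [L2phi ->]]]]].
  exact: (@eq_subspace K A A (slice1 w \o (linfun_of (t2_bilin c) \o mr (iB x)))
    (mr (iB x) \o (slice1 w \o linfun_of (t2_bilin c)))).
have iBg s v : mr (iB x) (slice2 phi (t1 s v)) =
    slice2 phi (t1 s (ml (iC (SB x)) v)).
  by rewrite -slice2_mr1 t1_iB.
by rewrite /= iBg !(coass12 S) iBg.
Qed.

Lemma D_mulB a x : D (mr (iB x) a) = D a * (1 ⊠ iB x).
Proof.
apply: (ml_tens_inj ndA ndA) => u v.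
by rewrite -[RHS]/(ml (D a) (ml (1 ⊠ iB x) _)) mul_tens1 !D_tens t1_mulB.
Qed.

Lemma T_rho a b x : T (rho a b x) = t1 a (ml (mulBC iB SC x) b).
Proof.
apply: (tensor_ext (f := T \o rho a b)
  (g := linfun_of (t1_bilin.2 a) \o (evl b \o mulBC iB SC))) => y z.
rewrite -[LHS]/(T (tmap _ _ _)) -[RHS]/(t1 a (ml (mulBC iB SC _) _)).
by rewrite tmap_tens mulBCE TE; apply: t1_mulB.
Qed.

(** By [t1_mulB], TG(ax ⊗ b) = Δ(a)(1 ⊗ xE_1 S_C(E_2)b), and E_1 S_C(E_2) = 1 leaves Δ(a)(1 ⊗ xb) =
    T(ax ⊗ b). *)
Lemma T_G y : T (G y) = T y.
Proof.
apply: (tensor_ext (f := T \o Gl) (g := T)) => a b; move: a; apply: iBr_ind => [|x a].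
  split=> [|k a a' TG TG']; first by rewrite tens0l !linear0.
  by rewrite tensDl tensZl linearP TG TG' linearP.
by rewrite -[LHS]/(T (G _)) G_iBr T_rho (mul_e1 S) TE t1_mulB.
Qed.

Lemma ker_T : [set y | T y = 0] = range (fun y => y - G y).
Proof.
apply/seteqP; split=> [y Ty|_ [y _ <-]]; last first.
  by have : T (y - G y) = 0 by rewrite linearB T_G subrr.
by exists y => //; rewrite (kerT_kerG Ty) subr0.
Qed.

Lemma tswap_t1_bilin a :
  bilin (fun b c : A => tswap (t1 a c ⊗ b) : (A ⊗ A ⊗ A)%type).
Proof.
split=> [c k b b'|b k c c']; first by rewrite linearP linearP.
by rewrite (t1_bilin.2 a) tensDl tensZl linearP.
Qed.
Definition D13E a : {linear (A ⊗ A)%type -> (A ⊗ A ⊗ A)%type} :=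
  linfun_of (tlift_linear (tswap_t1_bilin a)).
Lemma D13E_tens a b c : D13E a (b ⊗ c) = tswap (t1 a c ⊗ b).
Proof. exact/tliftE/tswap_t1_bilin. Qed.

(** Take xb for b and write (x ⊗ 1)E as a sum of β ⊗ γ. Applying G in the first two legs gives a_1 β
    ⊗ S_C(γ)b ⊗ a_2 c, which is the value of [W] below. Then Δ(a)(β ⊗ c) = Δ(a)(1 ⊗ S_B(β)c) moves β
    to the third leg, and the resulting sum of S_C(γ) ⊗ S_B(β) is E(x ⊗ 1). *)
Lemma G_D13 a b c :
  tmap G idfun (tswap (t1 a c ⊗ b)) = D13E a (ml E (b ⊗ c)).
Proof.
rewrite -[G]/(Gl : _ -> _).
move: b; apply: iB_ind => [|x b].
  exact: (@eq_subspace K A _ (tmap Gl idfun \o (@tswap K A A A \o tens (t1 a c)))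
    (D13E a \o (ml E \o (linfun_of ((tens_bilin A A).1 c))))).
have -> : ml E (ml (iB x) b ⊗ c) =
    tmap (evl b \o iB) (evl c \o iC) (anti_flip SB SC (e1 x)).
  by rewrite -ml_thom (thom_e1_flip S) /= (tmap_tens (ml (iB x)) idfun).
pose one_r := linfun_of (@mtens_linear1 K A A 1).
pose W y : {linear (B ⊗ C)%type -> (A ⊗ A ⊗ A)%type} :=
  @tswap K A A A \o tmap (evr y \o (one_r \o iB)) (evl b \o (iB \o SC)).
have WE y u v : W y (u ⊗ v) = tswap (mr (iB u ⊠ 1) y ⊗ ml (iB (SC v)) b).
  by rewrite -[LHS]/(tswap (tmap _ _ _)) tmap_tens.
have WD y y' X : W (y + y') X = W y X + W y' X.
  apply: (tensor_ext (f := W (y + y')) (g := W y \+ W y')) => u v.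
  by rewrite -[RHS]/(W y _ + W y' _) !WE mrD tensDl linearD.
have GW y : tmap Gl idfun (tswap (y ⊗ ml (iB x) b)) = W y (e1 x).
  elim/tensor_ind: y => [|u v y IH].
    rewrite tens0l !linear0; apply: (addrI (W 0 (e1 x))).
    by rewrite -WD !addr0.
  rewrite WD tensDl !linearD -IH [LHS]/=; congr (_ + _).
  rewrite tswapE -[G]/(Gl : _ -> _) tmap_tens -[Gl _]/(G _) G_iB.
  apply: (tensor_ext (f := linfun_of ((tens_bilin _ _).1 v) \o rho u b)
    (g := W (u ⊗ v))) => u' v'.
  by rewrite WE mul_tens2 tswapE -[LHS]/(tmap _ _ _ ⊗ v) tmap_tens.
rewrite GW; apply: (tensor_ext (f := W (t1 a c))
  (g := D13E a \o (tmap (evl b \o iB) (evl c \o iC) \o anti_flip SB SC))) => u v.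
rewrite WE t1_iB -[RHS]/(D13E a (tmap _ _ (anti_flip _ _ _))).
by rewrite anti_flipE tmap_tens D13E_tens.
Qed.

Lemma setting_T1_spec : T1_spec D E t1 iB G.
Proof.
split; [exact: t1_full|exact: range_T|exact: D_mulB|exact: G_linear|exact: ker_T|].
exact: G_D13.
Qed.

End FirstCanonicalMap.

(** * Opposite and coopposite *)

Section Opposite.
Variable K : fieldType.

(** A copy of A to carry the opposite product. As a vector space it is convertible with A, so
    functionals and tensors need no transport. *)
Definition nop (A : nuAlgType K) : Type := A.

HB.instance Definition _ (A : nuAlgType K) := GRing.Lmodule.on (nop A).

Variable A : nuAlgType K.

Definition opmul (a b : nop A) : nop A := nmul (b : A) (a : A).

Lemma opmulA : associative opmul.
Proof. by move=> a b c; rewrite /opmul nmulA. Qed.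
Lemma opmulDl : left_distributive opmul +%R.
Proof. by move=> a b c; apply: nmulDr. Qed.
Lemma opmulDr : right_distributive opmul +%R.
Proof. by move=> a b c; apply: nmulDl. Qed.
Lemma opscaleAl (k : K) a b : opmul (k *: a) b = k *: opmul a b.
Proof. exact: nscaleAr. Qed.
Lemma opscaleAr (k : K) a b : opmul a (k *: b) = k *: opmul a b.
Proof. exact: nscaleAl. Qed.
HB.instance Definition _ := Lmodule_isNUAlgebra.Build K (nop A)
  opmulA opmulDl opmulDr opscaleAl opscaleAr.

End Opposite.

Section OppositeMultipliers.
Variables (K : fieldType) (A : nuAlgType K).

Lemma op_ml_mul (m : multiplier A) (a b : nop A) : mr m (a ** b : nop A) = (mr m a : nop A) ** b.
Proof. exact: mr_mul. Qed.
Lemma op_mr_mul (m : multiplier A) (a b : nop A) : ml m (a ** b : nop A) = a ** (ml m b : nop A).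
Proof. exact: ml_mul. Qed.
Lemma op_mlr (m : multiplier A) (a b : nop A) : a ** (mr m b : nop A) = (ml m a : nop A) ** b.
Proof. by rewrite -[LHS]/((mr m b : A) ** (a : A)) -mlr. Qed.

Definition mop (m : multiplier A) : multiplier (nop A) :=
  @Multiplier K (nop A) (mr m) (ml m) (@mr_linear _ _ m) (@ml_linear _ _ m)
    (op_ml_mul m) (op_mr_mul m) (op_mlr m).

Lemma mopM m n : mop (m * n) = mop n * mop m.
Proof. exact: multiplierP. Qed.
Lemma mop1 : mop 1 = 1.
Proof. exact: multiplierP. Qed.
Lemma mop_emb (a : A) : mop (emb a) = emb (a : nop A).
Proof. exact: multiplierP. Qed.
Lemma mop_linear : linear mop.
Proof. by move=> k m n; apply: multiplierP. Qed.
Lemma mop_inj : injective mop.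
Proof.
move=> m n mn; apply: multiplierP => a.
- by have := congr1 (fun p : multiplier (nop A) => mr p a) mn.
- by have := congr1 (fun p : multiplier (nop A) => ml p a) mn.
Qed.
HB.instance Definition _ := GRing.isLinear.Build K (multiplier A)
  (multiplier (nop A)) *:%R mop mop_linear.

End OppositeMultipliers.

Section OppositeTensor.
Variables (K : fieldType) (A : nuAlgType K).

(** Opposites commute with tensor products only up to this equality, not by conversion; hence [mop2]
    has to be built separately from [mop]. *)
Lemma op_tens_mul (x y : (nop A ⊗ nop A)%type) :
  x ** y = ((y : (A ⊗ A)%type) ** (x : (A ⊗ A)%type) : (A ⊗ A)%type).
Proof.
apply: (linear_tensor_ext (f := fun x : (A ⊗ A)%type => (x : (nop A ⊗ nop A)%type) ** y)
  (g := fun x : (A ⊗ A)%type => (y : (A ⊗ A)%type) ** x)) => [k u v|k u v|a b].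
- exact: (nmulr_linear y).
- exact: (nmull_linear (y : (A ⊗ A)%type)).
apply: (linear_tensor_ext (f := fun y : (A ⊗ A)%type => (a ⊗ b : (nop A ⊗ nop A)%type) ** (y : (nop A ⊗ nop A)%type))
  (g := fun y : (A ⊗ A)%type => (y : (A ⊗ A)%type) ** (a ⊗ b))) => [k u v|k u v|a' b'].
- exact: (nmull_linear (a ⊗ b : (nop A ⊗ nop A)%type)).
- exact: (nmulr_linear (a ⊗ b : (A ⊗ A)%type)).
by rewrite [RHS]tens_mul [LHS](@tens_mul K (nop A) (nop A)).
Qed.
End OppositeTensor.

Section OppositeTensorMultipliers.
Variables (K : fieldType) (A : nuAlgType K).
Implicit Types m n : multiplier (A ⊗ A).

Lemma op_tens_ml_mul m (x y : (nop A ⊗ nop A)%type) :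
  mr m (x ** y : (nop A ⊗ nop A)%type) = (mr m x : (nop A ⊗ nop A)%type) ** y.
Proof. by rewrite !op_tens_mul; apply: mr_mul. Qed.
Lemma op_tens_mr_mul m (x y : (nop A ⊗ nop A)%type) :
  ml m (x ** y : (nop A ⊗ nop A)%type) = x ** (ml m y : (nop A ⊗ nop A)%type).
Proof. by rewrite !op_tens_mul; apply: ml_mul. Qed.
Lemma op_tens_mlr m (x y : (nop A ⊗ nop A)%type) :
  x ** (mr m y : (nop A ⊗ nop A)%type) = (ml m x : (nop A ⊗ nop A)%type) ** y.
Proof. by rewrite !op_tens_mul [RHS]mlr. Qed.

Definition mop2 m : multiplier (nop A ⊗ nop A) :=
  @Multiplier K (nop A ⊗ nop A)%type (mr m) (ml m)
    (@mr_linear _ _ m) (@ml_linear _ _ m)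
    (op_tens_ml_mul m) (op_tens_mr_mul m) (op_tens_mlr m).

(** Reversing products turns (c ⊗ 1)Δ(a) into Δ(a)(c ⊗ 1), and the flip then puts c into the second
    leg: together they make T_2 a first canonical map. *)
Definition mopc m : multiplier (nop A ⊗ nop A) := mop2 (mpull (flip_iso A A) m).

Lemma mopcM m n : mopc (m * n) = mopc n * mopc m.
Proof. by rewrite /mopc mpullM; apply: multiplierP. Qed.
Lemma mopc_tens (m n : multiplier A) : mopc (m ⊠ n) = mop n ⊠ mop m.
Proof. by rewrite /mopc mflip_tens; apply: multiplierP. Qed.
Lemma mopc_emb (t : A ⊗ A) : mopc (emb t) = emb (tflip t : (nop A ⊗ nop A)%type).
Proof.
by rewrite /mopc mpull_emb; apply: multiplierP => x; rewrite /= op_tens_mul.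
Qed.
Lemma mopc_inj : injective mopc.
Proof.
move=> m n mn; apply: multiplierP => t.
- have := congr1 (fun p : multiplier (nop A ⊗ nop A) => tflip (mr p (tflip t) : A ⊗ A)) mn.
  rewrite -[LHS]/(tflip (tflip (ml m (tflip (tflip t))))).
  by rewrite -[RHS]/(tflip (tflip (ml n (tflip (tflip t))))) !tflipK.
- have := congr1 (fun p : multiplier (nop A ⊗ nop A) => tflip (ml p (tflip t) : A ⊗ A)) mn.
  rewrite -[LHS]/(tflip (tflip (mr m (tflip (tflip t))))).
  by rewrite -[RHS]/(tflip (tflip (mr n (tflip (tflip t))))) !tflipK.
Qed.
Lemma mopc_linear : linear mopc.
Proof. by move=> k m n; rewrite /mopc mpull_linear; apply: multiplierP. Qed.
HB.instance Definition _ := GRing.isLinear.Build K (multiplier (A ⊗ A))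
  (multiplier (nop A ⊗ nop A)) *:%R mopc mopc_linear.

End OppositeTensorMultipliers.

Section OppositeCoopposite.
Variables (K : fieldType) (A : nuAlgType K) (D : A -> multiplier (A ⊗ A)).
Variables (E : multiplier (A ⊗ A)) (t1 t2 t3 t4 : A -> A -> A ⊗ A).
Variables (B C : lmodType K).
Variables (iB : {linear B -> multiplier A}) (iC : {linear C -> multiplier A}).
Variables (SB : {linear B -> C}) (SC : {linear C -> B}).
Variables (TB : {linear C -> B}) (TC : {linear B -> C}).
Variables (e1 : B -> B ⊗ C) (e3 : C -> B ⊗ C).
Hypothesis S : setting D E t1 t2 t3 t4 iB iC SB SC TB TC e1 e3.

Lemma nop_nondegenerate : nondegenerate_alg (nop A).
Proof. by case: (ndA S). Qed.

Let iB' : {linear B -> multiplier (nop A)} := @mop K A \o iB.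
Let iC' : {linear C -> multiplier (nop A)} := @mop K A \o iC.
Let flip2 (t : A -> A -> A ⊗ A) : nop A -> nop A -> nop A ⊗ nop A :=
  fun a b => tflip (t a b).

Lemma thom_op x : thom iC' iB' (tensor_swap _ _ x) = mopc (thom iB iC x).
Proof.
apply: (tensor_ext (f := thom iC' iB' \o tensor_swap B C)
  (g := @mopc K A \o thom iB iC)) => b c.
rewrite -[LHS]/(thom _ _ (tensor_swap _ _ _)) -[RHS]/(mopc (thom _ _ _)).
by rewrite tensor_swapE !thomE mopc_tens.
Qed.

Lemma anti_flip_swap x :
  anti_flip SC SB (tensor_swap _ _ x) = tensor_swap _ _ (anti_flip SB SC x).
Proof.
apply: (tensor_ext (f := anti_flip SC SB \o tensor_swap B C)
  (g := tensor_swap B C \o anti_flip SB SC)) => b c.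
rewrite -[LHS]/(anti_flip _ _ (tensor_swap _ _ _)).
rewrite -[RHS]/(tensor_swap _ _ (anti_flip _ _ _)).
by rewrite tensor_swapE !anti_flipE tensor_swapE.
Qed.

Lemma mulBC_op x : mulBC iC' SB (tensor_swap _ _ x) = mop (mulCB iC SB x).
Proof.
apply: (tensor_ext (f := mulBC iC' SB \o tensor_swap B C)
  (g := @mop K A \o mulCB iC SB)) => b c.
rewrite -[LHS]/(mulBC _ _ (tensor_swap _ _ _)) -[RHS]/(mop (mulCB _ _ _)).
by rewrite tensor_swapE mulBCE mulCBE mopM.
Qed.
Lemma mulCB_op x : mulCB iB' SC (tensor_swap _ _ x) = mop (mulBC iB SC x).
Proof.
apply: (tensor_ext (f := mulCB iB' SC \o tensor_swap B C)
  (g := @mop K A \o mulBC iB SC)) => b c.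
rewrite -[LHS]/(mulCB _ _ (tensor_swap _ _ _)) -[RHS]/(mop (mulBC _ _ _)).
by rewrite tensor_swapE mulBCE mulCBE mopM.
Qed.

(** The symmetry exchanges [t1] with [t2], [t3] with [t4], B with C, S_B with S_C, and the families
    (b ⊗ 1)E and E(1 ⊗ c). *)
Lemma setting_opcop :
  setting (fun a : nop A => mopc (D a)) (mopc E)
    (flip2 t2) (flip2 t1) (flip2 t4) (flip2 t3) iC' iB' SC SB TC TB
    (fun c => tensor_swap _ _ (e3 c)) (fun b => tensor_swap _ _ (e1 b)).
Proof.
have opc1 (m : multiplier A) : mopc (m ⊠ 1) = 1 ⊠ mop m by rewrite mopc_tens mop1.
have opc2 (m : multiplier A) : mopc (1 ⊠ m) = mop m ⊠ 1 by rewrite mopc_tens mop1.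
split.
- exact: nop_nondegenerate.
- by move=> k a b; rewrite (D_linear S) linearP.
- by move=> a b; rewrite -mopcM -(D_mul S).
- by move=> a; rewrite -mopcM (DE S).
- by move=> a; rewrite -mopcM (ED S).
- by move=> a b; rewrite -mop_emb -opc1 -mopcM -(emb_t2 S) mopc_emb.
- by move=> a b; rewrite -mop_emb -opc2 -mopcM -(emb_t1 S) mopc_emb.
- by move=> a b; rewrite -mop_emb -opc1 -mopcM -(emb_t4 S) mopc_emb.
- by move=> a b; rewrite -mop_emb -opc2 -mopcM -(emb_t3 S) mopc_emb.
- move=> w c w' b a; have := coass12 S w' b w c a.
  rewrite -!(@slice1_flip K A A w) -!(@slice2_flip K A A w') => h; exact: esym h.
- move=> w c w' b a; have := coass34 S w' b w c a.
  rewrite -!(@slice1_flip K A A w) -!(@slice2_flip K A A w') => h; exact: esym h.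
- exact: spanAC S.
- exact: spanCA S.
- exact: spanAB S.
- exact: spanBA S.
- exact: SCK S.
- exact: TCK S.
- exact: SBK S.
- exact: TBK S.
- by move=> x y /mop_inj /(iC_inj S).
- by move=> x y /mop_inj /(iB_inj S).
- by move=> c; rewrite -opc2 -opc1 -!mopcM (E_SC S).
- by move=> b; rewrite -opc2 -opc1 -!mopcM (E_SB S).
- by move=> c; rewrite thom_op (thom_e3 S) mopcM opc2.
- by move=> c; rewrite anti_flip_swap thom_op (thom_e3_flip S) mopcM opc2.
- by move=> b; rewrite thom_op (thom_e1 S) mopcM opc1.
- by move=> b; rewrite anti_flip_swap thom_op (thom_e1_flip S) mopcM opc1.
- by move=> c; rewrite mulBC_op (mul_e3 S).
- by move=> b; rewrite mulCB_op (mul_e1 S).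
- by move=> f f0; apply: (leg2_e3 S) => c; rewrite -slice1_swap.
- by move=> f f0; apply: (leg2_e1 S) => c; rewrite -slice1_swap.
- by move=> f f0; apply: (leg1_e3 S) => c; rewrite -slice2_swap.
- by move=> f f0; apply: (leg1_e1 S) => c; rewrite -slice2_swap.
Qed.

Lemma right_formula_opcop (phi : {scalar A}) : left_formula t2 t4 iC SB e1 e3 phi ->
  right_formula (flip2 t2) (flip2 t4) iC' SB
    (fun c => tensor_swap _ _ (e3 c)) (fun b => tensor_swap _ _ (e1 b)) phi.
Proof.
have lamE a b x : slice2 phi (lam3 iC SB a b x) =
    slice1 phi (rho iC' SB a b (tensor_swap _ _ x)).
  apply: (tensor_ext (f := slice2 phi \o lam3 iC SB a b)
    (g := slice1 phi \o (rho iC' SB a b \o tensor_swap B C))) => u v.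
  rewrite -[LHS]/(slice2 phi (tmap _ _ _)).
  rewrite -[RHS]/(slice1 phi (tmap _ _ (tensor_swap _ _ _))).
  by rewrite tensor_swapE !tmap_tens slice1E slice2E.
have lamE' a b x : slice2 phi (lam iC SB a b x) =
    slice1 phi (rho3 iC' SB a b (tensor_swap _ _ x)).
  apply: (tensor_ext (f := slice2 phi \o lam iC SB a b)
    (g := slice1 phi \o (rho3 iC' SB a b \o tensor_swap B C))) => u v.
  rewrite -[LHS]/(slice2 phi (tmap _ _ _)).
  rewrite -[RHS]/(slice1 phi (tmap _ _ (tensor_swap _ _ _))).
  by rewrite tensor_swapE !tmap_tens slice1E slice2E.
case=> f1 f2 f3; split=> a b x.
- by rewrite -lamE -f1; apply: (@slice1_flip K A A phi).
- by rewrite -lamE -f2; apply: (@slice1_flip K A A phi).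
- by rewrite -lamE' -f3; apply: (@slice1_flip K A A phi).
Qed.

Lemma left_formula_opcop (psi : {scalar A}) : right_formula t1 t3 iB SC e1 e3 psi ->
  left_formula (flip2 t1) (flip2 t3) iB' SC
    (fun c => tensor_swap _ _ (e3 c)) (fun b => tensor_swap _ _ (e1 b)) psi.
Proof.
have rhoE a b x : slice1 psi (rho iB SC a b x) =
    slice2 psi (lam3 iB' SC a b (tensor_swap _ _ x)).
  apply: (tensor_ext (f := slice1 psi \o rho iB SC a b)
    (g := slice2 psi \o (lam3 iB' SC a b \o tensor_swap B C))) => u v.
  rewrite -[LHS]/(slice1 psi (tmap _ _ _)).
  rewrite -[RHS]/(slice2 psi (tmap _ _ (tensor_swap _ _ _))).
  by rewrite tensor_swapE !tmap_tens slice1E slice2E.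
have rhoE' a b x : slice1 psi (rho3 iB SC a b x) =
    slice2 psi (lam iB' SC a b (tensor_swap _ _ x)).
  apply: (tensor_ext (f := slice1 psi \o rho3 iB SC a b)
    (g := slice2 psi \o (lam iB' SC a b \o tensor_swap B C))) => u v.
  rewrite -[LHS]/(slice1 psi (tmap _ _ _)).
  rewrite -[RHS]/(slice2 psi (tmap _ _ (tensor_swap _ _ _))).
  by rewrite tensor_swapE !tmap_tens slice1E slice2E.
case=> f1 f2 f3; split=> a b x.
- by rewrite -rhoE -f1; apply: (@slice2_flip K A A psi).
- by rewrite -rhoE -f2; apply: (@slice2_flip K A A psi).
- by rewrite -rhoE' -f3; apply: (@slice2_flip K A A psi).
Qed.

End OppositeCoopposite.

Section Coopposite.
Variables (K : fieldType) (A : nuAlgType K) (D : A -> multiplier (A ⊗ A)).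
Variables (E : multiplier (A ⊗ A)) (t1 t2 t3 t4 : A -> A -> A ⊗ A).
Variables (B C : lmodType K).
Variables (iB : {linear B -> multiplier A}) (iC : {linear C -> multiplier A}).
Variables (SB : {linear B -> C}) (SC : {linear C -> B}).
Variables (TB : {linear C -> B}) (TC : {linear B -> C}).
Variables (e1 : B -> B ⊗ C) (e3 : C -> B ⊗ C).
Hypothesis S : setting D E t1 t2 t3 t4 iB iC SB SC TB TC e1 e3.

Definition mcop (m : multiplier (A ⊗ A)) := mpull (flip_iso A A) m.

Lemma mcopM m n : mcop (m * n) = mcop m * mcop n.
Proof. exact: mpullM. Qed.
Lemma mcop_tens (m n : multiplier A) : mcop (m ⊠ n) = n ⊠ m.
Proof. exact: mflip_tens. Qed.
Lemma mcop_emb (t : A ⊗ A) : mcop (emb t) = emb (tflip t).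
Proof. exact: mpull_emb. Qed.
HB.instance Definition _ := GRing.isLinear.Build K (multiplier (A ⊗ A))
  (multiplier (A ⊗ A)) *:%R mcop (mpull_linear (flip_iso A A)).

Definition flip2 (t : A -> A -> A ⊗ A) a b := tflip (t a b).
Definition swap_anti (x : B ⊗ C) : C ⊗ B := tensor_swap _ _ (anti_flip SB SC x).

Lemma thom_cop (U V : lmodType K) (f : {linear U -> multiplier A})
  (g : {linear V -> multiplier A}) x :
  thom g f (tensor_swap _ _ x) = mcop (thom f g x).
Proof.
apply: (tensor_ext (f := thom g f \o tensor_swap U V)
  (g := mcop \o thom f g)) => b c.
rewrite -[LHS]/(thom _ _ (tensor_swap _ _ _)) -[RHS]/(mcop (thom _ _ _)).
by rewrite tensor_swapE !thomE mcop_tens.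
Qed.

Lemma anti_flip_cop x : anti_flip TB TC (swap_anti x) = tensor_swap _ _ x.
Proof.
apply: (tensor_ext (f := anti_flip TB TC \o (tensor_swap B C \o anti_flip SB SC))
  (g := tensor_swap B C)) => b c.
rewrite -[LHS]/(anti_flip _ _ (tensor_swap _ _ (anti_flip _ _ _))).
by rewrite anti_flipE !tensor_swapE anti_flipE (SBK S) (SCK S).
Qed.

Lemma mulBC_cop x : mulBC iC TC (swap_anti x) = mulCB iC SB x.
Proof.
apply: (tensor_ext (f := mulBC iC TC \o (tensor_swap B C \o anti_flip SB SC))
  (g := mulCB iC SB)) => b c.
rewrite -[LHS]/(mulBC _ _ (tensor_swap _ _ (anti_flip _ _ _))).
by rewrite anti_flipE !tensor_swapE mulBCE mulCBE (SCK S).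
Qed.
Lemma mulCB_cop x : mulCB iB TB (swap_anti x) = mulBC iB SC x.
Proof.
apply: (tensor_ext (f := mulCB iB TB \o (tensor_swap B C \o anti_flip SB SC))
  (g := mulBC iB SC)) => b c.
rewrite -[LHS]/(mulCB _ _ (tensor_swap _ _ (anti_flip _ _ _))).
by rewrite anti_flipE !tensor_swapE mulBCE mulCBE (SBK S).
Qed.

Lemma slice1_swap_anti (f : {scalar C}) x :
  slice1 f (swap_anti x) = SC (slice1 (f \o SB) x).
Proof.
rewrite slice1_swap; apply: (tensor_ext (f := slice2 f \o anti_flip SB SC)
  (g := SC \o slice1 (f \o SB))) => b c.
rewrite -[LHS]/(slice2 f (anti_flip _ _ _)) -[RHS]/(SC (slice1 _ _)).
by rewrite anti_flipE slice1E slice2E linearZ.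
Qed.
Lemma slice2_swap_anti (f : {scalar B}) x :
  slice2 f (swap_anti x) = SB (slice2 (f \o SC) x).
Proof.
rewrite slice2_swap; apply: (tensor_ext (f := slice1 f \o anti_flip SB SC)
  (g := SB \o slice2 (f \o SC))) => b c.
rewrite -[LHS]/(slice1 f (anti_flip _ _ _)) -[RHS]/(SB (slice2 _ _)).
by rewrite anti_flipE slice1E slice2E linearZ.
Qed.

(** The order of products is kept, so the exchange relations of ζE involve the inverses: E(1 ⊗ c) =
    E(S_B^{-1}(c) ⊗ 1) and (b ⊗ 1)E = (1 ⊗ S_C^{-1}(b))E. The role of (b ⊗ 1)E is taken by the flip
    of (1 ⊗ c)E, which is (S_C ⊗ S_B)ζ(E(1 ⊗ c)) before the flip; hence [swap_anti]. *)
Lemma setting_cop :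
  setting (cop D) (mcop E) (flip2 t4) (flip2 t3) (flip2 t2) (flip2 t1)
    iC iB TB TC SB SC (fun c => swap_anti (e3 c)) (fun b => swap_anti (e1 b)).
Proof.
have SB0 : injective SB := can_inj (SBK S); have SC0 : injective SC := can_inj (SCK S).
split.
- exact: ndA S.
- by move=> k a b; rewrite /cop (D_linear S) mpull_linear.
- by move=> a b; rewrite /cop (D_mul S) mpullM.
- by move=> a; rewrite -mcopM (ED S).
- by move=> a; rewrite -mcopM (DE S).
- by move=> a b; rewrite -mcop_tens -mcopM -(emb_t4 S) mcop_emb.
- by move=> a b; rewrite -mcop_tens -mcopM -(emb_t3 S) mcop_emb.
- by move=> a b; rewrite -mcop_tens -mcopM -(emb_t2 S) mcop_emb.
- by move=> a b; rewrite -mcop_tens -mcopM -(emb_t1 S) mcop_emb.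
- move=> w c w' b a; have := coass34 S w' b w c a.
  by rewrite -!(slice1_flip w) -!(slice2_flip w').
- move=> w c w' b a; have := coass12 S w' b w c a.
  by rewrite -!(slice1_flip w) -!(slice2_flip w').
- exact: spanCA S.
- exact: spanAC S.
- exact: spanBA S.
- exact: spanAB S.
- exact: TBK S.
- exact: SBK S.
- exact: TCK S.
- exact: SCK S.
- exact: iC_inj S.
- exact: iB_inj S.
- move=> c; rewrite -(mcop_tens 1 (iC c)) -(mcop_tens (iB (TB c)) 1) -!mcopM.
  by rewrite (E_SB S) (TBK S).
- move=> b; rewrite -(mcop_tens (iB b) 1) -(mcop_tens 1 (iC (TC b))) -!mcopM.
  by rewrite (E_SC S) (TCK S).
- by move=> c; rewrite thom_cop (thom_e3_flip S) mcopM mcop_tens.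
- by move=> c; rewrite anti_flip_cop thom_cop (thom_e3 S) mcopM mcop_tens.
- by move=> b; rewrite thom_cop (thom_e1_flip S) mcopM mcop_tens.
- by move=> b; rewrite anti_flip_cop thom_cop (thom_e1 S) mcopM mcop_tens.
- by move=> c; rewrite mulBC_cop (mul_e3 S).
- by move=> b; rewrite mulCB_cop (mul_e1 S).
- move=> f f0 c; rewrite -[c](TBK S); apply: (leg1_e3 S (f := f \o SB)) => x.
  by apply: SC0; rewrite -slice1_swap_anti f0 linear0.
- move=> f f0 c; rewrite -[c](TBK S); apply: (leg1_e1 S (f := f \o SB)) => x.
  by apply: SC0; rewrite -slice1_swap_anti f0 linear0.
- move=> f f0 c; rewrite -[c](TCK S); apply: (leg2_e3 S (f := f \o SC)) => x.
  by apply: SB0; rewrite -slice2_swap_anti f0 linear0.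
- move=> f f0 c; rewrite -[c](TCK S); apply: (leg2_e1 S (f := f \o SC)) => x.
  by apply: SB0; rewrite -slice2_swap_anti f0 linear0.
Qed.

End Coopposite.

(** * Invariance formulas in terms of F_1 and F_2 *)

Section Formulas.
Variables (K : fieldType) (A : nuAlgType K) (D : A -> multiplier (A ⊗ A)).
Variables (E : multiplier (A ⊗ A)) (t1 t2 t3 t4 : A -> A -> A ⊗ A).
Variables (B C : lmodType K).
Variables (iB : {linear B -> multiplier A}) (iC : {linear C -> multiplier A}).
Variables (SB : {linear B -> C}) (SC : {linear C -> B}).
Variables (TB : {linear C -> B}) (TC : {linear B -> C}).
Variables (e1 : B -> B ⊗ C) (e3 : C -> B ⊗ C).
Hypothesis S : setting D E t1 t2 t3 t4 iB iC SB SC TB TC e1 e3.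

(** The first two conditions have the same right-hand side: S_C reverses products, so F_1(1 ⊗
    S_C(c)) is (ι ⊗ S_C)((1 ⊗ c)E), and (1 ⊗ c)E = (S_C(c) ⊗ 1)E. *)
Definition is_F1 (m : multiplier (A ⊗ A)) : Prop :=
  [/\ forall x, (iB x ⊠ 1) * m = thom iB iB (tmap idfun SC (e1 x)),
      forall x, m * (1 ⊠ iB x) = thom iB iB (tmap idfun SC (e1 x)) &
      forall x, (1 ⊠ iB (SC x)) * m = thom iB iB (tmap idfun SC (e3 x))].
Definition is_F2 (m : multiplier (A ⊗ A)) : Prop :=
  [/\ forall x, m * (1 ⊠ iC x) = thom iC iC (tmap SB idfun (e3 x)),
      forall x, (iC x ⊠ 1) * m = thom iC iC (tmap SB idfun (e3 x)) &
      forall x, m * (iC (SB x) ⊠ 1) = thom iC iC (tmap SB idfun (e1 x))].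

Let embI : injective (@emb K (A ⊗ A)%type) :=
  emb_inj (nondegenerate_tens (ndA S) (ndA S)).

Lemma emb_rho a b x : emb (rho iB SC a b x) =
  (emb a ⊠ 1) * thom iB iB (tmap idfun SC x) * (1 ⊠ emb b).
Proof.
apply: (tensor_ext (f := @emb K _ \o rho iB SC a b)
  (g := mrmul (1 ⊠ emb b) \o (mlmul (emb a ⊠ 1) \o
    (thom iB iB \o tmap idfun SC)))) => u v.
rewrite -[LHS]/(emb (tmap _ _ _)) -[RHS]/(_ * thom _ _ (tmap _ _ _) * _).
by rewrite !tmap_tens thomE emb_tens emb_ml emb_mr !mtensM mul1r mulr1.
Qed.
Lemma emb_rho3 a b x : emb (rho3 iB SC a b x) =
  (emb a ⊠ emb b) * thom iB iB (tmap idfun SC x).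
Proof.
apply: (tensor_ext (f := @emb K _ \o rho3 iB SC a b)
  (g := mlmul (emb a ⊠ emb b) \o (thom iB iB \o tmap idfun SC))) => u v.
rewrite -[LHS]/(emb (tmap _ _ _)) -[RHS]/(_ * thom _ _ (tmap _ _ _)).
by rewrite !tmap_tens thomE emb_tens !emb_mr !mtensM.
Qed.
Lemma emb_lam a b x : emb (lam iC SB a b x) =
  thom iC iC (tmap SB idfun x) * (emb b ⊠ emb a).
Proof.
apply: (tensor_ext (f := @emb K _ \o lam iC SB a b)
  (g := mrmul (emb b ⊠ emb a) \o (thom iC iC \o tmap SB idfun))) => u v.
rewrite -[LHS]/(emb (tmap _ _ _)) -[RHS]/(thom _ _ (tmap _ _ _) * _).
by rewrite !tmap_tens thomE emb_tens !emb_ml !mtensM.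
Qed.
Lemma emb_lam3 a b x : emb (lam3 iC SB a b x) =
  (emb b ⊠ 1) * thom iC iC (tmap SB idfun x) * (1 ⊠ emb a).
Proof.
apply: (tensor_ext (f := @emb K _ \o lam3 iC SB a b)
  (g := mrmul (1 ⊠ emb a) \o (mlmul (emb b ⊠ 1) \o
    (thom iC iC \o tmap SB idfun)))) => u v.
rewrite -[LHS]/(emb (tmap _ _ _)) -[RHS]/(_ * thom _ _ (tmap _ _ _) * _).
by rewrite !tmap_tens thomE emb_tens emb_ml emb_mr !mtensM mul1r mulr1.
Qed.

(** The factor x brings F_1 down to an element of B ⊗ B, so that the equality of the multipliers (ψ
    ⊗ ι)Δ(a) and (ψ ⊗ ι)((a ⊗ 1)F_1), evaluated at b, becomes one between slices of elements of A ⊗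
    A. *)
Lemma right_formula_of (psi : {scalar A}) :
  (forall a, exists n m, [/\ is_fun_id psi (D a) n, is_F1 m &
     is_fun_id psi ((emb a ⊠ 1) * m) n]) ->
  right_formula t1 t3 iB SC e1 e3 psi.
Proof.
move=> h; split=> a b x.
- have [n [m [Dn [m1 m2 m3] mn]]] := h (mr (iB x) a).
  have [[t tE nb] _] := Dn b; have [[t' t'E nb'] _] := mn b.
  rewrite -(emb_t1 S) in tE; rewrite -(embI tE) -[LHS]nb nb' -[LHS]/(slice1 psi t').
  congr (slice1 psi _); apply: embI; rewrite t'E emb_mr emb_rho -m1.
  by rewrite !mulrA mtensM mulr1.
- have [n [m [Dn [m1 m2 m3] mn]]] := h a.
  have [[t tE nb] _] := Dn (ml (iB x) b); have [[t' t'E nb'] _] := mn (ml (iB x) b).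
  rewrite -(emb_t1 S) in tE; rewrite -(embI tE) -[LHS]nb nb' -[LHS]/(slice1 psi t').
  congr (slice1 psi _); apply: embI; rewrite t'E emb_ml emb_rho -m2.
  by rewrite -!mulrA mtensM mulr1.
- have [n [m [Dn [m1 m2 m3] mn]]] := h a.
  have [_ [t tE nb]] := Dn (mr (iB (SC x)) b).
  have [_ [t' t'E nb']] := mn (mr (iB (SC x)) b).
  rewrite -(emb_t3 S) in tE; rewrite -(embI tE) -[LHS]nb nb' -[LHS]/(slice1 psi t').
  congr (slice1 psi _); apply: embI; rewrite t'E emb_mr emb_rho3 -m3.
  by rewrite !mulrA !mtensM !mul1r !mulr1.
Qed.

Lemma left_formula_of (phi : {scalar A}) :
  (forall a, exists n m, [/\ is_id_fun phi (D a) n, is_F2 m &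
     is_id_fun phi (m * (1 ⊠ emb a)) n]) ->
  left_formula t2 t4 iC SB e1 e3 phi.
Proof.
move=> h; split=> a b x.
- have [n [m [Dn [m1 m2 m3] mn]]] := h (ml (iC x) a).
  have [_ [t tE nb]] := Dn b; have [_ [t' t'E nb']] := mn b.
  rewrite -(emb_t2 S) in tE; rewrite -(embI tE) -[LHS]nb nb' -[LHS]/(slice2 phi t').
  congr (slice2 phi _); apply: embI; rewrite t'E emb_ml emb_lam3 -m1.
  by rewrite -!mulrA mtensM mulr1.
- have [n [m [Dn [m1 m2 m3] mn]]] := h a.
  have [_ [t tE nb]] := Dn (mr (iC x) b); have [_ [t' t'E nb']] := mn (mr (iC x) b).
  rewrite -(emb_t2 S) in tE; rewrite -(embI tE) -[LHS]nb nb' -[LHS]/(slice2 phi t').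
  congr (slice2 phi _); apply: embI; rewrite t'E emb_mr emb_lam3 -m2.
  by rewrite !mulrA mtensM mulr1.
- have [n [m [Dn [m1 m2 m3] mn]]] := h a.
  have [[t tE nb] _] := Dn (ml (iC (SB x)) b).
  have [[t' t'E nb'] _] := mn (ml (iC (SB x)) b).
  rewrite -(emb_t4 S) in tE; rewrite -(embI tE) -[LHS]nb nb' -[LHS]/(slice2 phi t').
  congr (slice2 phi _); apply: embI; rewrite t'E emb_ml emb_lam -m3.
  by rewrite -!mulrA !mtensM !mul1r !mulr1.
Qed.

End Formulas.

Section CoopFormulas.
Variables (K : fieldType) (A : nuAlgType K).

Lemma is_fun_id_cop (w : {scalar A}) (m : multiplier (A ⊗ A)) n :
  is_id_fun w m n -> is_fun_id w (mcop m) n.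
Proof.
move=> h c; have [[t tE nc] [t' t'E nc']] := h c; split.
- exists (tflip t); first by rewrite -mcop_emb tE mcopM mcop_tens.
  by rewrite nc; apply/esym/slice1_flip.
- exists (tflip t'); first by rewrite -mcop_emb t'E mcopM mcop_tens.
  by rewrite nc'; apply/esym/slice1_flip.
Qed.
Lemma is_id_fun_cop (w : {scalar A}) (m : multiplier (A ⊗ A)) n :
  is_fun_id w m n -> is_id_fun w (mcop m) n.
Proof.
move=> h c; have [[t tE nc] [t' t'E nc']] := h c; split.
- exists (tflip t); first by rewrite -mcop_emb tE mcopM mcop_tens.
  by rewrite nc; apply/esym/slice2_flip.
- exists (tflip t'); first by rewrite -mcop_emb t'E mcopM mcop_tens.
  by rewrite nc'; apply/esym/slice2_flip.
Qed.

End CoopFormulas.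

(** * Separability idempotents *)

Section Separability.
Variables (K : fieldType) (B C : nuAlgType K) (E : multiplier (B ⊗ C)).
Variables (SB : anti_iso B C) (SC : anti_iso C B).
Hypotheses (ndB : nondegenerate_alg B) (ndC : nondegenerate_alg C).
Hypothesis hsep : regular_separability_idempotent E SB SC.

Definition anti_lin (X Y : nuAlgType K) (f : anti_iso X Y) : {linear X -> Y} :=
  linfun_of (anti_to_linear f).
Lemma anti_inv_linear (X Y : nuAlgType K) (f : anti_iso X Y) : linear (anti_inv f).
Proof.
move=> k u v; apply: (can_inj (anti_toK f)).
by rewrite anti_to_linear !anti_invK.
Qed.
Definition anti_inv_lin (X Y : nuAlgType K) (f : anti_iso X Y) : {linear Y -> X} :=
  linfun_of (anti_inv_linear f).

Let ndBC : nondegenerate_alg (B ⊗ C)%type := nondegenerate_tens ndB ndC.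
Let embI : injective (@emb K (B ⊗ C)%type) := emb_inj ndBC.

Lemma sep_ex1 b : exists t, (emb b ⊠ 1) * E = emb t.
Proof. by case: hsep => _ /(_ b)[]. Qed.
Lemma sep_ex3 c : exists t, E * (1 ⊠ emb c) = emb t.
Proof. by case: hsep => _ _ /(_ c)[]. Qed.
Definition sep1 b : B ⊗ C := projT1 (cid (sep_ex1 b)).
Definition sep3 c : B ⊗ C := projT1 (cid (sep_ex3 c)).
Lemma emb_sep1 b : emb (sep1 b) = (emb b ⊠ 1) * E.
Proof. exact: esym (projT2 (cid (sep_ex1 b))). Qed.
Lemma emb_sep3 c : emb (sep3 c) = E * (1 ⊠ emb c).
Proof. exact: esym (projT2 (cid (sep_ex3 c))). Qed.
Lemma sep_SB b : E * (emb b ⊠ 1) = E * (1 ⊠ emb (SB b)).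
Proof. by case: hsep => _ _ _ _ [/(_ b)]. Qed.
Lemma sep_SC c : (1 ⊠ emb c) * E = (emb (SC c) ⊠ 1) * E.
Proof. by case: hsep => _ _ _ _ [_ /(_ c)]. Qed.
Lemma sep_idem : E * E = E. Proof. by case: hsep. Qed.
Lemma emb_sep2 b : emb (sep3 (SB b)) = E * (emb b ⊠ 1).
Proof. by rewrite emb_sep3 sep_SB. Qed.
Lemma emb_sep4 c : emb (sep1 (SC c)) = (1 ⊠ emb c) * E.
Proof. by rewrite emb_sep1 sep_SC. Qed.

(** Both sides are (1 ⊗ c)E(1 ⊗ c'), which links the left legs of E(1 ⊗ c') to those of (1 ⊗ c)E. *)
Lemma sep4_sep3 c c' : ml (1 ⊠ emb c) (sep3 c') = mr (1 ⊠ emb c') (sep1 (SC c)).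
Proof. by apply: embI; rewrite emb_ml emb_mr emb_sep4 emb_sep3 mulrA. Qed.
Lemma sep1_sep2 b b' : ml (emb b ⊠ 1) (sep3 (SB b')) = mr (emb b' ⊠ 1) (sep1 b).
Proof. by apply: embI; rewrite emb_ml emb_mr emb_sep1 emb_sep2 mulrA. Qed.

(** Fullness concerns the left legs of E(1 ⊗ c) and of (1 ⊗ c)E together. By [sep4_sep3] and the
    non-degeneracy of C, a functional that kills the legs of one family also kills those of the
    other. *)
Lemma sep_leg1 (f : {scalar B}) :
  (forall c, slice1 f (sep3 c) = 0) \/ (forall c, slice1 f (sep1 (SC c)) = 0) ->
  forall b, f b = 0.
Proof.
case: (hsep) => _ _ _ [fullB _] _ f0.
pose S := [set b | exists (h : {scalar C}) c,
  b = slice2 h (sep3 c) \/ b = slice2 h (sep1 (SC c))].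
have s31 (g : {scalar B}) :
    (forall c, slice1 g (sep3 c) = 0) -> forall c, slice1 g (sep1 (SC c)) = 0.
  move=> g0 c; apply: (nmulr_inj ndC) => c'.
  rewrite n0mul -[_ ** c']/(mr (emb c') _) -slice1_mr2.
  by rewrite -sep4_sep3 slice1_ml2 g0 ml0.
have s13 (g : {scalar B}) :
    (forall c, slice1 g (sep1 (SC c)) = 0) -> forall c, slice1 g (sep3 c) = 0.
  move=> g0 c; apply: (nmull_inj ndC) => c'.
  rewrite nmul0 -[c' ** _]/(ml (emb c') _) -slice1_ml2.
  by rewrite sep4_sep3 slice1_mr2 g0 mr0.
have fS b : S b -> f b = 0.
  have [f3 f1] : (forall c, slice1 f (sep3 c) = 0) /\
      (forall c, slice1 f (sep1 (SC c)) = 0).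
    by case: f0 => h; split=> //; [exact: s31|exact: s13].
  by case=> h [c [->|->]]; rewrite -slice12 ?f3 ?f1 linear0.
have leg c : tens_sub (lspan S) setT (sep3 c) /\ tens_sub (lspan S) setT (sep1 (SC c)).
  split; apply: tens_subP (lspan_subspace _) _ => w wS; apply: functional0 => h;
    rewrite slice12 wS //; apply: lspan_incl; exists h, c; by [left|right].
have ST : lspan S = setT.
  apply: (fullB _ (lspan_subspace _)) => c; have [l3 l1] := leg c.
  split; first by exists (sep3 c) => //; rewrite emb_sep3.
  by exists (sep1 (SC c)) => //; rewrite emb_sep4.
move=> b; apply: (lspanT_ind ST (P := fun b => f b = 0)) fS _.
by split=> [|k u v fu fv]; rewrite ?linear0 // linearP /= fu fv mulr0 addr0.
Qed.

Lemma sep_leg2 (f : {scalar C}) :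
  (forall b, slice2 f (sep1 b) = 0) \/ (forall b, slice2 f (sep3 (SB b)) = 0) ->
  forall c, f c = 0.
Proof.
case: (hsep) => _ _ _ [_ fullC] _ f0.
pose S := [set b | exists (h : {scalar B}) c,
  b = slice1 h (sep1 c) \/ b = slice1 h (sep3 (SB c))].
have s31 (g : {scalar C}) :
    (forall b, slice2 g (sep3 (SB b)) = 0) -> forall b, slice2 g (sep1 b) = 0.
  move=> g0 c; apply: (nmulr_inj ndB) => c'.
  rewrite n0mul -[_ ** c']/(mr (emb c') _) -slice2_mr1.
  by rewrite -sep1_sep2 slice2_ml1 g0 ml0.
have s13 (g : {scalar C}) :
    (forall b, slice2 g (sep1 b) = 0) -> forall b, slice2 g (sep3 (SB b)) = 0.
  move=> g0 c; apply: (nmull_inj ndB) => c'.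
  rewrite nmul0 -[c' ** _]/(ml (emb c') _) -slice2_ml1.
  by rewrite sep1_sep2 slice2_mr1 g0 mr0.
have fS b : S b -> f b = 0.
  have [f1 f3] : (forall b, slice2 f (sep1 b) = 0) /\
      (forall b, slice2 f (sep3 (SB b)) = 0).
    by case: f0 => h; split=> //; [exact: s13|exact: s31].
  by case=> h [c [->|->]]; rewrite slice12 ?f3 ?f1 linear0.
have leg b : tens_sub setT (lspan S) (sep3 (SB b)) /\ tens_sub setT (lspan S) (sep1 b).
  split; apply: tens_subP2 (lspan_subspace _) _ => w wS; apply: functional0 => h;
    rewrite -slice12 wS //; apply: lspan_incl; exists h, b; by [right|left].
have ST : lspan S = setT.
  apply: (fullC _ (lspan_subspace _)) => c; have [l3 l1] := leg c.
  split; first by exists (sep3 (SB c)) => //; rewrite emb_sep2.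
  by exists (sep1 c) => //; rewrite emb_sep1.
move=> b; apply: (lspanT_ind ST (P := fun b => f b = 0)) fS _.
by split=> [|k u v fu fv]; rewrite ?linear0 // linearP /= fu fv mulr0 addr0.
Qed.

(** From (z ⊗ 1)E(1 ⊗ c) = 0, z annihilates the left legs of E(1 ⊗ c), and these span B. *)
Lemma sep_zero1 z : (emb z ⊠ 1) * E = 0 -> z = 0.
Proof.
move=> zE; apply: ndB.1 => b; apply: functional0 => h.
apply: (sep_leg1 (f := h \o nmul z)); left=> c; apply: functional0 => g.
rewrite slice12 /= -[nmul z]/(ml (emb z)) -slice2_ml1.
rewrite (_ : ml _ _ = 0) ?linear0 // ?linear0 //; apply: embI.
by rewrite emb_ml emb_sep3 mulrA zE mul0r [RHS]linear0.
Qed.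
Lemma sep_zero2 z : E * (1 ⊠ emb z) = 0 -> z = 0.
Proof.
move=> zE; apply: ndC.2 => c; apply: functional0 => h.
apply: (sep_leg2 (f := h \o mr (emb z))); left=> b; apply: functional0 => g.
rewrite -slice12 /= -[_ ** z]/(mr (emb z) _) -slice1_mr2.
rewrite (_ : mr _ _ = 0) ?linear0 // ?linear0 //; apply: embI.
by rewrite emb_mr emb_sep1 -mulrA zE mulr0 [RHS]linear0.
Qed.

Lemma prodB_bilin : bilin (fun (b : B) (c : C) => b ** SC c).
Proof.
split=> [c|b] k u v; first exact: (nmulr_linear (SC c)).
by rewrite anti_to_linear nmulDr nscaleAr.
Qed.
Definition prodB : {linear (B ⊗ C)%type -> B} := linfun_of (tlift_linear prodB_bilin).
Lemma prodBE b c : prodB (b ⊗ c) = b ** SC c.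
Proof. exact/tliftE/prodB_bilin. Qed.
Lemma prodC_bilin : bilin (fun (b : B) (c : C) => SB b ** c).
Proof.
split=> [c|b] k u v; last exact: (nmull_linear (SB b)).
by rewrite anti_to_linear nmulDl nscaleAl.
Qed.
Definition prodC : {linear (B ⊗ C)%type -> C} := linfun_of (tlift_linear prodC_bilin).
Lemma prodCE b c : prodC (b ⊗ c) = SB b ** c.
Proof. exact/tliftE/prodC_bilin. Qed.

Let left1 : {linear multiplier B -> multiplier (B ⊗ C)} :=
  linfun_of (@mtens_linear1 K B C 1).
Let right1 : {linear multiplier C -> multiplier (B ⊗ C)} :=
  linfun_of (@mtens_linear2 K B C 1).

Lemma emb_E_prodB x : emb x * E = (emb (prodB x) ⊠ 1) * E.
Proof.
apply: (tensor_ext (f := mrmul E \o @emb K (B ⊗ C)%type)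
  (g := mrmul E \o (left1 \o (@emb K B \o prodB)))) => b c.
rewrite -[LHS]/(emb _ * E) -[RHS]/((emb (prodB _) ⊠ 1) * E) prodBE embM.
rewrite (_ : emb (b ⊗ c) = (emb b ⊠ 1) * (1 ⊠ emb c)); last first.
  by rewrite mtensM mulr1 mul1r emb_tens.
by rewrite -mulrA sep_SC mulrA mtensM mulr1.
Qed.

(** The multiplier y is arbitrary because [tau_sep3] uses an element that satisfies the exchange
    relation of E but is not yet known to absorb E. *)
Lemma emb_prodC (y : multiplier (B ⊗ C)) x :
  (forall b, y * (emb b ⊠ 1) = y * (1 ⊠ emb (SB b))) ->
  y * emb x = y * (1 ⊠ emb (prodC x)).
Proof.
move=> yS; apply: (tensor_ext (f := mlmul y \o @emb K (B ⊗ C)%type)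
  (g := mlmul y \o (right1 \o (@emb K C \o prodC)))) => b c.
rewrite -[LHS]/(y * emb _) -[RHS]/(y * (1 ⊠ emb (prodC _))) prodCE embM.
rewrite (_ : emb (b ⊗ c) = (emb b ⊠ 1) * (1 ⊠ emb c)); last first.
  by rewrite mtensM mulr1 mul1r emb_tens.
by rewrite mulrA yS -mulrA mtensM mulr1.
Qed.

(** By [emb_E_prodB], (b ⊗ 1)E = (b ⊗ 1)EE = (bE_1 S_C(E_2) ⊗ 1)E, and [sep_zero1] cancels E. *)
Lemma prodB_sep1 b : prodB (sep1 b) = b.
Proof.
apply/eqP; rewrite -subr_eq0; apply/eqP/sep_zero1.
rewrite -[LHS]/(mrmul E (left1 (@emb K B _))) !linearB; apply/eqP; rewrite subr_eq0.
apply/eqP; rewrite -[LHS]/((emb (prodB _) ⊠ 1) * E) -emb_E_prodB.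
by rewrite emb_sep1 -mulrA sep_idem.
Qed.
Lemma prodC_sep3 c : prodC (sep3 c) = c.
Proof.
apply/eqP; rewrite -subr_eq0; apply/eqP/sep_zero2.
rewrite -[LHS]/(mlmul E (right1 (@emb K C _))) !linearB; apply/eqP; rewrite subr_eq0.
apply/eqP; rewrite -[LHS]/(E * (1 ⊠ emb (prodC _))) -emb_prodC; last exact: sep_SB.
by rewrite emb_sep3 mulrA sep_idem.
Qed.

Notation tau := (anti_flip (anti_lin SB) (anti_lin SC)).

Lemma tau_mr1 c x : mr (emb (SC c) ⊠ 1) (tau x) = tau (ml (1 ⊠ emb c) x).
Proof.
apply: (tensor_ext (f := mr (emb (SC c) ⊠ 1) \o tau)
  (g := tau \o ml (1 ⊠ emb c))) => b d.
rewrite -[LHS]/(mr _ (tau _)) -[RHS]/(tau (ml _ _)) mul_tens1 !anti_flipE.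
by rewrite mul_tens2 /= anti_mul.
Qed.
Lemma tau_mr2 b x : mr (1 ⊠ emb (SB b)) (tau x) = tau (ml (emb b ⊠ 1) x).
Proof.
apply: (tensor_ext (f := mr (1 ⊠ emb (SB b)) \o tau)
  (g := tau \o ml (emb b ⊠ 1))) => b' d.
rewrite -[LHS]/(mr _ (tau _)) -[RHS]/(tau (ml _ _)) mul_tens1 !anti_flipE.
by rewrite mul_tens2 /= anti_mul.
Qed.
Lemma tau_ml2 b x : ml (1 ⊠ emb (SB b)) (tau x) = tau (mr (emb b ⊠ 1) x).
Proof.
apply: (tensor_ext (f := ml (1 ⊠ emb (SB b)) \o tau)
  (g := tau \o mr (emb b ⊠ 1))) => b' d.
rewrite -[LHS]/(ml _ (tau _)) -[RHS]/(tau (mr _ _)) mul_tens2 !anti_flipE.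
by rewrite mul_tens1 /= anti_mul.
Qed.

Lemma emb_tau_E x : emb (tau x) * E = (1 ⊠ emb (prodC x)) * E.
Proof.
apply: (tensor_ext (f := mrmul E \o (@emb K (B ⊗ C)%type \o tau))
  (g := mrmul E \o (right1 \o (@emb K C \o prodC)))) => b c.
rewrite -[LHS]/(emb (tau _) * E) -[RHS]/((1 ⊠ emb (prodC _)) * E) prodCE embM.
rewrite anti_flipE (_ : emb _ = (1 ⊠ emb (SB b)) * (emb (SC c) ⊠ 1)); last first.
  by rewrite mtensM mulr1 mul1r emb_tens.
by rewrite -mulrA -sep_SC mulrA mtensM mulr1.
Qed.

(* Y = (1 ⊗ c)(S_C ⊗ S_B)ζE satisfies YE = (1 ⊗ c)E because S_B(E_1)E_2 = 1, and
   YE = Y because Y(b ⊗ 1) = Y(1 ⊗ S_B(b)). *)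
Lemma tau_sep3 c : tau (sep3 c) = sep1 (SC c).
Proof.
set Y := tau _.
have YS b : emb Y * (emb b ⊠ 1) = emb Y * (1 ⊠ emb (SB b)).
  rewrite -[b](anti_invK SC); set c' := anti_inv SC b.
  rewrite -!emb_mr tau_mr1 tau_mr2; congr (emb (tau _)); apply: embI.
  by rewrite !emb_ml emb_sep3 !mulrA sep_SC.
have YE : mr E Y = Y.
  apply: (cancel_mr2 ndC) => c'; apply: embI.
  by rewrite !emb_mr -mulrA -emb_sep3 emb_prodC // prodC_sep3.
apply: embI; rewrite -YE emb_mr emb_tau_E prodC_sep3.
by rewrite emb_sep4.
Qed.

(** Multiplication by 1 ⊗ S_B(b') leads to the image of (b ⊗ 1)E(b' ⊗ 1). This element is also (b ⊗
    1) times E(1 ⊗ S_B(b')), to which [tau_sep3] applies. *)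
Lemma tau_sep1 b : tau (sep1 b) = sep3 (SB b).
Proof.
apply: (cancel_ml2 ndC) => c; rewrite -[c](anti_invK SB); set b' := anti_inv SB c.
rewrite tau_ml2 -sep1_sep2 -tau_mr2 tau_sep3; apply: embI.
by rewrite emb_ml emb_mr emb_sep4 emb_sep2 sep_SB mulrA.
Qed.

End Separability.

(** * The multipliers (ι ⊗ S)E and (S ⊗ ι)E *)

Section AntiMultiplier.
Variables (K : fieldType) (B C X : nuAlgType K) (E : multiplier (B ⊗ C)).
Hypotheses (ndB : nondegenerate_alg B) (ndC : nondegenerate_alg C).
Hypothesis ndX : nondegenerate_alg X.

Let embI : injective (@emb K (B ⊗ C)%type) := emb_inj (nondegenerate_tens ndB ndC).

Section IdAnti.
Variables (S : anti_iso C X) (F : multiplier (B ⊗ X)).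
Hypothesis hF : is_id_anti E S F.

Notation idS := (tmap (@idfun B) (anti_lin S)).

Lemma mul_idS1 b c x : (b ⊗ S c) ** idS x = idS (ml (emb b ⊠ 1) (mr (1 ⊠ emb c) x)).
Proof.
apply: (tensor_ext (f := nmul (b ⊗ S c) \o idS)
  (g := idS \o (ml (emb b ⊠ 1) \o mr (1 ⊠ emb c)))) => b' c'.
rewrite -[LHS]/(_ ** idS _) -[RHS]/(idS (ml _ (mr _ _))) mul_tens2 mul_tens1.
by rewrite !tmap_tens tens_mul /= anti_mul.
Qed.
Lemma mul_idS2 b c x : idS x ** (b ⊗ S c) = idS (mr (emb b ⊠ 1) (ml (1 ⊠ emb c) x)).
Proof.
apply: (tensor_ext (f := mr (emb (b ⊗ S c)) \o idS)
  (g := idS \o (mr (emb b ⊠ 1) \o ml (1 ⊠ emb c)))) => b' c'.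
rewrite -[LHS]/(idS _ ** _) -[RHS]/(idS (mr _ (ml _ _))) mul_tens1 mul_tens2.
by rewrite !tmap_tens tens_mul /= anti_mul.
Qed.

Lemma id_anti_ext_l (m : multiplier (B ⊗ X)) x :
  (forall b c, ml m (b ⊗ S c) = idS x ** (b ⊗ S c)) -> m = emb (idS x).
Proof.
move=> h; apply: (ml_tens_inj ndB ndX) => b d; rewrite -[d](anti_invK S).
exact: h.
Qed.
Lemma id_anti_ext_r (m : multiplier (B ⊗ X)) x :
  (forall b c, mr m (b ⊗ S c) = (b ⊗ S c) ** idS x) -> m = emb (idS x).
Proof.
move=> h; apply: (mr_inj (nondegenerate_tens ndB ndX)).
apply: (tensor_ext (f := mr m) (g := mr (emb (idS x)))) => b d.
by rewrite -[d](anti_invK S); apply: h.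
Qed.

(** F is known only through its action on the tensors b' ⊗ S(c), which span B ⊗ X since S is onto.
    The factor b is absorbed into b', and the outcome is compared with the action of (ι ⊗ S)x. *)
Lemma id_anti1 b x : emb x = (emb b ⊠ 1) * E -> (emb b ⊠ 1) * F = emb (idS x).
Proof.
move=> xE; apply: id_anti_ext_r => b' c.
rewrite -[LHS]/(mr F (mr _ _)) mul_tens2 /=; have [_ [t tE ->]] := hF (b' ** b) c.
rewrite mul_idS1; congr (tmap _ _ _); apply: embI.
by rewrite tE emb_ml emb_mr xE !mulrA mtensM mulr1 embM.
Qed.
Lemma id_anti2 b x : emb x = E * (emb b ⊠ 1) -> F * (emb b ⊠ 1) = emb (idS x).
Proof.
move=> xE; apply: id_anti_ext_l => b' c.
rewrite -[LHS]/(ml F (ml _ _)) mul_tens1 /=; have [[t tE ->] _] := hF (b ** b') c.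
rewrite mul_idS2; congr (tmap _ _ _); apply: embI.
by rewrite tE emb_mr emb_ml xE -!mulrA mtensM mulr1 embM.
Qed.
Lemma id_anti3 c x : emb x = E * (1 ⊠ emb c) ->
  (1 ⊠ emb (S c)) * F = emb (idS x).
Proof.
move=> xE; apply: id_anti_ext_r => b c'.
rewrite -[LHS]/(mr F (mr _ _)) mul_tens2 /= -anti_mul.
have [_ [t tE ->]] := hF b (c ** c').
rewrite mul_idS1; congr (tmap _ _ _); apply: embI.
by rewrite tE emb_ml emb_mr xE -!mulrA mtensM mulr1 embM.
Qed.
Lemma id_anti4 c x : emb x = (1 ⊠ emb c) * E ->
  F * (1 ⊠ emb (S c)) = emb (idS x).
Proof.
move=> xE; apply: id_anti_ext_l => b c'.
rewrite -[LHS]/(ml F (ml _ _)) mul_tens1 /= -anti_mul.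
have [[t tE ->] _] := hF b (c' ** c).
rewrite mul_idS2; congr (tmap _ _ _); apply: embI.
by rewrite tE emb_mr emb_ml xE !mulrA mtensM mulr1 embM.
Qed.

End IdAnti.

Section AntiId.
Variables (S : anti_iso B X) (F : multiplier (X ⊗ C)).
Hypothesis hF : is_anti_id E S F.

Notation Sid := (tmap (anti_lin S) (@idfun C)).

Lemma mul_Sid1 b c x : (S b ⊗ c) ** Sid x = Sid (ml (1 ⊠ emb c) (mr (emb b ⊠ 1) x)).
Proof.
apply: (tensor_ext (f := nmul (S b ⊗ c) \o Sid)
  (g := Sid \o (ml (1 ⊠ emb c) \o mr (emb b ⊠ 1)))) => b' c'.
rewrite -[LHS]/(_ ** Sid _) -[RHS]/(Sid (ml _ (mr _ _))) mul_tens2 mul_tens1.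
by rewrite !tmap_tens tens_mul /= anti_mul.
Qed.
Lemma mul_Sid2 b c x : Sid x ** (S b ⊗ c) = Sid (mr (1 ⊠ emb c) (ml (emb b ⊠ 1) x)).
Proof.
apply: (tensor_ext (f := mr (emb (S b ⊗ c)) \o Sid)
  (g := Sid \o (mr (1 ⊠ emb c) \o ml (emb b ⊠ 1)))) => b' c'.
rewrite -[LHS]/(Sid _ ** _) -[RHS]/(Sid (mr _ (ml _ _))) mul_tens1 mul_tens2.
by rewrite !tmap_tens tens_mul /= anti_mul.
Qed.

Lemma anti_id_ext_l (m : multiplier (X ⊗ C)) x :
  (forall b c, ml m (S b ⊗ c) = Sid x ** (S b ⊗ c)) -> m = emb (Sid x).
Proof.
move=> h; apply: (ml_tens_inj ndX ndC) => b d; rewrite -[b](anti_invK S).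
exact: h.
Qed.
Lemma anti_id_ext_r (m : multiplier (X ⊗ C)) x :
  (forall b c, mr m (S b ⊗ c) = (S b ⊗ c) ** Sid x) -> m = emb (Sid x).
Proof.
move=> h; apply: (mr_inj (nondegenerate_tens ndX ndC)).
apply: (tensor_ext (f := mr m) (g := mr (emb (Sid x)))) => b d.
by rewrite -[b](anti_invK S); apply: h.
Qed.

Lemma anti_id1 b x : emb x = (emb b ⊠ 1) * E -> F * (emb (S b) ⊠ 1) = emb (Sid x).
Proof.
move=> xE; apply: anti_id_ext_l => b' c.
rewrite -[LHS]/(ml F (ml _ _)) mul_tens1 /= -anti_mul.
have [[t tE ->] _] := hF (b' ** b) c.
rewrite mul_Sid2; congr (tmap _ _ _); apply: embI.
by rewrite tE emb_mr emb_ml xE !mulrA mtensM mulr1 embM.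
Qed.
Lemma anti_id2 b x : emb x = E * (emb b ⊠ 1) -> (emb (S b) ⊠ 1) * F = emb (Sid x).
Proof.
move=> xE; apply: anti_id_ext_r => b' c.
rewrite -[LHS]/(mr F (mr _ _)) mul_tens2 /= -anti_mul.
have [_ [t tE ->]] := hF (b ** b') c.
rewrite mul_Sid1; congr (tmap _ _ _); apply: embI.
by rewrite tE emb_ml emb_mr xE -!mulrA mtensM mulr1 embM.
Qed.
Lemma anti_id3 c x : emb x = E * (1 ⊠ emb c) -> F * (1 ⊠ emb c) = emb (Sid x).
Proof.
move=> xE; apply: anti_id_ext_l => b c'.
rewrite -[LHS]/(ml F (ml _ _)) mul_tens1 /=; have [[t tE ->] _] := hF b (c ** c').
rewrite mul_Sid2; congr (tmap _ _ _); apply: embI.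
by rewrite tE emb_mr emb_ml xE -!mulrA mtensM mulr1 embM.
Qed.
Lemma anti_id4 c x : emb x = (1 ⊠ emb c) * E -> (1 ⊠ emb c) * F = emb (Sid x).
Proof.
move=> xE; apply: anti_id_ext_r => b c'.
rewrite -[LHS]/(mr F (mr _ _)) mul_tens2 /=; have [_ [t tE ->]] := hF b (c' ** c).
rewrite mul_Sid1; congr (tmap _ _ _); apply: embI.
by rewrite tE emb_ml emb_mr xE !mulrA mtensM mulr1 embM.
Qed.

End AntiId.
End AntiMultiplier.

Definition anti_iso_inv (K : fieldType) (X Y : nuAlgType K) (S : anti_iso X Y) :
  anti_iso Y X.
Proof.
refine (@AntiIso K Y X (anti_inv S) S (anti_inv_linear S) _ (anti_invK S) (anti_toK S)).
by move=> x y; apply: (can_inj (anti_toK S)); rewrite anti_mul !anti_invK.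
Defined.

(** * Algebras sitting in M(A) and the extension of their inclusions *)

Section Inclusions.
Variables (K : fieldType) (A : nuAlgType K).
Hypothesis ndA : nondegenerate_alg A.

(** If bB = 0, then b annihilates BA = A and is 0 in M(A); the other side uses AB = A. *)
Lemma sits_nondegenerate (B : nuAlgType K) (iB : B -> multiplier A) :
  sits_nondegenerately iB -> nondegenerate_alg B.
Proof.
case=> -[lB mB] injB spanl spanr.
have iB0 : iB 0 = 0 by apply: (lin0 lB).
split=> b b0; apply: injB; rewrite iB0.
- apply: (ml_inj ndA); apply: (lspanT_ind spanl) => [|_ [x [y ->]]].
    exact: (@eq_subspace K A A (ml (iB b)) (ml 0)).
  by rewrite -[LHS]/(ml (iB b * iB x) y) -mB b0 iB0.
- apply: (mr_inj ndA); apply: (lspanT_ind spanr) => [|_ [x [y ->]]].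
    exact: (@eq_subspace K A A (mr (iB b)) (mr 0)).
  by rewrite -[LHS]/(mr (iB x * iB b) y) -mB b0 iB0.
Qed.

Section Pair.
Variables (B C : nuAlgType K) (iB : B -> multiplier A) (iC : C -> multiplier A).
Hypotheses (hB : sits_nondegenerately iB) (hC : sits_nondegenerately iC).

Definition incl (X : nuAlgType K) (i : X -> multiplier A) (h : sits_nondegenerately i) :
    {linear X -> multiplier A} :=
  let: And4 (conj li _) _ _ _ := h in linfun_of li.
Lemma inclE (X : nuAlgType K) (i : X -> multiplier A) (h : sits_nondegenerately i) :
  incl h = i :> (X -> multiplier A).
Proof. by rewrite /incl; case: h => -[]. Qed.

Notation th := (thom (incl hB) (incl hC)).

Lemma thom_tens_hom x : th x = tens_hom iB iC x.
Proof. by rewrite /thom !inclE. Qed.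

Lemma thom_span (P : A ⊗ A -> Prop) : is_subspace P ->
  (forall x y, P (ml (th x) y)) -> forall t, P t.
Proof.
move=> sP Px; elim/tensor_ind=> [|a a' t Pt]; first by case: sP.
apply: (subspaceD sP) => // {t Pt}; case: (hB) (hC) => _ _ spB _ [_ _ spC _].
move: a; apply: (lspanT_ind spB) => [|_ [b [a ->]]].
  split=> [|k u v Pu Pv]; first by rewrite tens0l; case: sP.
  by rewrite tensDl tensZl; apply: sP.2.
move: a'; apply: (lspanT_ind spC) => [|_ [c [a' ->]]].
  split=> [|k u v Pu Pv]; first by rewrite linear0; case: sP.
  by rewrite linearP; apply: sP.2.
rewrite -mul_tens1; have := Px (b ⊗ c) (a ⊗ a').
by rewrite thomE !inclE.
Qed.

Variable F : multiplier (B ⊗ C) -> multiplier (A ⊗ A).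
Hypothesis hF : hom_extension (tens_hom iB iC) 1 F.

Lemma ext_emb x : F (emb x) = th x.
Proof. by rewrite thom_tens_hom; case: hF. Qed.
Lemma extM m n : F (m * n) = F m * F n.
Proof. by case: hF. Qed.

(** F(m) is prescribed on the products xy, with x in B ⊗ C and y in A ⊗ A, by F(m)F(x) = F(mx), and
    such products span A ⊗ A. This is the means of computing F. *)
Lemma ext_unique m n : (forall x, n * th x = th (ml m x)) -> F m = n.
Proof.
move=> nE; apply: (ml_inj (nondegenerate_tens ndA ndA)).
apply: thom_span => [|x y]; first exact: (@eq_subspace K _ _ (ml (F m)) (ml n)).
rewrite -[LHS]/(ml (F m * th x) y) -[RHS]/(ml (n * th x) y) nE -!ext_emb -extM.
by rewrite emb_ml.
Qed.

Lemma ext_left b : F (emb b ⊠ 1) = iB b ⊠ 1.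
Proof.
apply: ext_unique => x.
apply: (tensor_ext (f := mlmul (iB b ⊠ 1) \o th) (g := th \o ml (emb b ⊠ 1))) => u v.
rewrite -[LHS]/(_ * th _) -[RHS]/(th (ml _ _)) mul_tens1 !thomE mtensM mul1r !inclE /=.
by case: (hB) => -[_ mB] _ _ _; rewrite mB.
Qed.
Lemma ext_right c : F (1 ⊠ emb c) = 1 ⊠ iC c.
Proof.
apply: ext_unique => x.
apply: (tensor_ext (f := mlmul (1 ⊠ iC c) \o th) (g := th \o ml (1 ⊠ emb c))) => u v.
rewrite -[LHS]/(_ * th _) -[RHS]/(th (ml _ _)) mul_tens1 !thomE mtensM mul1r !inclE /=.
by case: (hC) => -[_ mC] _ _ _; rewrite mC.
Qed.

End Pair.
End Inclusions.

(** * Threefold tensor products *)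

Section ThreeLegs.
Variables (K : fieldType) (A : nuAlgType K).
Implicit Types m n p : multiplier A.

HB.instance Definition _ (X Y Z : nuAlgType K) :=
  GRing.isLinear.Build K (X ⊗ Y ⊗ Z)%type (X ⊗ (Y ⊗ Z))%type *:%R
  (@tassoc K X Y Z) (@tassoc_linear K X Y Z).
HB.instance Definition _ (X Y Z : nuAlgType K) :=
  GRing.isLinear.Build K (X ⊗ (Y ⊗ Z))%type (X ⊗ Y ⊗ Z)%type *:%R
  (@tassoc_inv K X Y Z) (@tassoc_inv_linear K X Y Z).

Lemma tensor_ext3 (V : lmodType K) (f g : {linear (A ⊗ A ⊗ A)%type -> V}) :
  (forall x y z, f (x ⊗ y ⊗ z) = g (x ⊗ y ⊗ z)) -> f =1 g.
Proof. by apply: ext3l; apply: linearP. Qed.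

Lemma massoc_tens m n p : mpull (assoc_iso A A A) (m ⊠ (n ⊠ p)) = m ⊠ n ⊠ p.
Proof.
apply: multiplierP.
- apply: (tensor_ext3 (f := ml (mpull (assoc_iso A A A) (m ⊠ (n ⊠ p))))
    (g := ml (m ⊠ n ⊠ p))) => x y z.
  rewrite -[LHS]/(tassoc_inv (ml (m ⊠ (n ⊠ p)) (tassoc _))) tassocE.
  rewrite -[RHS]/(ml (m ⊠ n ⊠ p) _).
  by rewrite !mul_tens1 tassoc_invE.
- apply: (tensor_ext3 (f := mr (mpull (assoc_iso A A A) (m ⊠ (n ⊠ p))))
    (g := mr (m ⊠ n ⊠ p))) => x y z.
  rewrite -[LHS]/(tassoc_inv (mr (m ⊠ (n ⊠ p)) (tassoc _))) tassocE.
  rewrite -[RHS]/(mr (m ⊠ n ⊠ p) _).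
  by rewrite !mul_tens2 tassoc_invE.
Qed.

Lemma mswap_tens m n p : mpull (swap_iso A A A) (m ⊠ n ⊠ p) = m ⊠ p ⊠ n.
Proof.
apply: multiplierP.
- apply: (tensor_ext3 (f := ml (mpull (swap_iso A A A) (m ⊠ n ⊠ p)))
    (g := ml (m ⊠ p ⊠ n))) => x y z.
  rewrite -[LHS]/(tswap (ml (m ⊠ n ⊠ p) (tswap _))) tswapE.
  rewrite -[RHS]/(ml (m ⊠ p ⊠ n) _).
  by rewrite !mul_tens1 tswapE.
- apply: (tensor_ext3 (f := mr (mpull (swap_iso A A A) (m ⊠ n ⊠ p)))
    (g := mr (m ⊠ p ⊠ n))) => x y z.
  rewrite -[LHS]/(tswap (mr (m ⊠ n ⊠ p) (tswap _))) tswapE.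
  rewrite -[RHS]/(mr (m ⊠ p ⊠ n) _).
  by rewrite !mul_tens2 tswapE.
Qed.

(* x ⊗ y ⊗ z |-> z ⊗ y ⊗ x. *)
Definition rev3 : {linear (A ⊗ A ⊗ A)%type -> (A ⊗ A ⊗ A)%type} :=
  @tassoc_inv K A A A \o (@tflip K (A ⊗ A)%type A \o tmap (@tflip K A A) idfun).
Lemma rev3E (t : A ⊗ A) z : rev3 (t ⊗ z) = tassoc_inv (z ⊗ tflip t).
Proof. by rewrite -[LHS]/(tassoc_inv (tflip (tmap _ _ _))) tmap_tens tflipE. Qed.
Lemma rev3_assoc x (s : A ⊗ A) : rev3 (tassoc_inv (x ⊗ s)) = tflip s ⊗ x.
Proof.
apply: (tensor_ext (f := rev3 \o (@tassoc_inv K A A A \o tens x))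
  (g := linfun_of ((tens_bilin _ _).1 x) \o @tflip K A A)) => y z.
rewrite -[LHS]/(rev3 (tassoc_inv (x ⊗ (y ⊗ z)))) -[RHS]/(tflip _ ⊗ x).
by rewrite tassoc_invE rev3E !tflipE tassoc_invE.
Qed.
Lemma rev3K : involutive rev3.
Proof.
apply: (tensor_ext (f := rev3 \o rev3) (g := idfun)) => t z.
by rewrite -[LHS]/(rev3 (rev3 _)) rev3E rev3_assoc tflipK.
Qed.

Lemma E23_rev3 (E : multiplier (A ⊗ A)) u :
  ml (E23 (mcop E)) (rev3 u) = rev3 (ml (E12 E) u).
Proof.
apply: (tensor_ext (f := ml (E23 (mcop E)) \o rev3)
  (g := rev3 \o ml (E12 E))) => t z.
rewrite -[LHS]/(tassoc_inv (ml (1 ⊠ mcop E) (tassoc (rev3 _)))).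
rewrite -[RHS]/(rev3 (ml (E ⊠ 1) _)) rev3E tassoc_invK !mul_tens1 rev3E.
by rewrite -[ml (mcop E) _]/(tflip (ml E (tflip _))) tflipK.
Qed.
Lemma E12_rev3 (E : multiplier (A ⊗ A)) u :
  ml (E12 (mcop E)) (rev3 u) = rev3 (ml (E23 E) u).
Proof.
rewrite -[u]tassocK; move: (tassoc u) => {}u.
apply: (tensor_ext (f := ml (E12 (mcop E)) \o (rev3 \o @tassoc_inv K A A A))
  (g := rev3 \o (ml (E23 E) \o @tassoc_inv K A A A))) => x s.
rewrite -[LHS]/(ml (mcop E ⊠ 1) (rev3 (tassoc_inv _))).
rewrite -[RHS]/(rev3 (tassoc_inv (ml (1 ⊠ E) (tassoc (tassoc_inv _))))).
rewrite tassoc_invK mul_tens1 !rev3_assoc mul_tens1.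
by rewrite -[ml (mcop E) _]/(tflip (ml E (tflip _))) tflipK.
Qed.
(** Conjugation by the reversal of the legs turns E ⊗ 1 into 1 ⊗ ζE and 1 ⊗ E into ζE ⊗ 1, hence
    preserves their commutation. *)
Lemma E12_E23_cop (E : multiplier (A ⊗ A)) : nondegenerate_alg A ->
  E12 E * E23 E = E23 E * E12 E ->
  E12 (mcop E) * E23 (mcop E) = E23 (mcop E) * E12 (mcop E).
Proof.
move=> ndA comm; apply: (ml_inj (nondegenerate_tens (nondegenerate_tens ndA ndA) ndA)).
move=> u; rewrite -[u]rev3K; move: (rev3 u) => {}u.
rewrite -[LHS]/(ml (E12 _) (ml (E23 _) _)) -[RHS]/(ml (E23 _) (ml (E12 _) _)).
rewrite E23_rev3 !E12_rev3 E23_rev3; congr (rev3 _).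
by rewrite -[LHS]/(ml (E23 E * E12 E) u) -comm.
Qed.

End ThreeLegs.
Arguments rev3 {K A}.

(** * Coassociativity in terms of slices *)

Section Coassociativity.
Variables (K : fieldType) (A : nuAlgType K) (D : A -> multiplier (A ⊗ A)).
Hypothesis ndA : nondegenerate_alg A.
Hypothesis D_linear : linear D.

Let ndAA : nondegenerate_alg (A ⊗ A)%type := nondegenerate_tens ndA ndA.
Let embI : injective (@emb K (A ⊗ A)%type) := emb_inj ndAA.

Lemma leg1_linear (f : A -> A -> A ⊗ A) (m : {linear A -> multiplier A}) :
  (forall a b, emb (f a b) = D a * (1 ⊠ m b)) \/
  (forall a b, emb (f a b) = (1 ⊠ m b) * D a) \/
  (forall a b, emb (f a b) = D a * (m b ⊠ 1)) \/
  (forall a b, emb (f a b) = (m b ⊠ 1) * D a) -> bilin f.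
Proof.
by case=> [fE|[fE|[fE|fE]]]; split=> [b k a a'|a k b b']; apply: embI;
  rewrite [in RHS]emb_linear !fE ?D_linear ?(linearP m) ?mtens_linear1 ?mtens_linear2
    ?mulrDl ?mulrDr ?multZl ?multZr.
Qed.

Section T12.
Variables t1 t2 : A -> A -> A ⊗ A.
Hypothesis emb_t1 : forall a b, emb (t1 a b) = D a * (1 ⊠ emb b).
Hypothesis emb_t2 : forall a c, emb (t2 a c) = (emb c ⊠ 1) * D a.

Let t1_bilin : bilin t1. Proof. by apply: (leg1_linear (m := @emb K A)); left. Qed.
Let t2_bilin : bilin t2. Proof. by apply: (leg1_linear (m := @emb K A)); do 3!right. Qed.
Let t1l b : {linear A -> (A ⊗ A)%type} := linfun_of (t1_bilin.1 b).
Let t2l c : {linear A -> (A ⊗ A)%type} := linfun_of (t2_bilin.1 c).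

Lemma D_id_bilin : bilin (fun a b : A => D a ⊠ emb b).
Proof.
split=> [b k a a'|a k b b']; rewrite ?D_linear ?emb_linear.
- exact: mtens_linear1.
- exact: mtens_linear2.
Qed.
Lemma D_id_tens a b : D_id D (a ⊗ b) = D a ⊠ emb b.
Proof. exact/tliftE/D_id_bilin. Qed.
Lemma D_id_linear : linear (D_id D).
Proof. exact/tlift_linear/D_id_bilin. Qed.
Lemma id_D_bilin : bilin (fun a b : A => emb a ⊠ D b).
Proof.
split=> [b k a a'|a k b b']; rewrite ?D_linear ?emb_linear.
- exact: mtens_linear1.
- exact: mtens_linear2.
Qed.
Lemma id_D_tens a b : id_D D (a ⊗ b) = mpull (assoc_iso A A A) (emb a ⊠ D b).
Proof. by congr mpull; apply/tliftE/id_D_bilin. Qed.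
Lemma id_D_linear : linear (id_D D).
Proof.
move=> k u v; rewrite /id_D -mpull_linear; congr mpull.
exact/tlift_linear/id_D_bilin.
Qed.

Lemma emb_D_id c u :
  (emb c ⊠ 1 ⊠ 1) * D_id D u = emb (tmap (t2l c) idfun u).
Proof.
apply: (tensor_ext (f := mlmul (emb c ⊠ 1 ⊠ 1) \o linfun_of D_id_linear)
  (g := @emb K _ \o tmap (t2l c) idfun)) => a b.
rewrite -[LHS]/(_ * D_id D _) -[RHS]/(emb (tmap _ _ _)) D_id_tens tmap_tens.
by rewrite mtensM mul1r emb_tens [t2l c a]/= emb_t2.
Qed.

Lemma emb_id_D b u :
  id_D D u * (1 ⊠ 1 ⊠ emb b) = emb (tassoc_inv (tmap idfun (t1l b) u)).
Proof.
apply: (tensor_ext (f := mrmul (1 ⊠ 1 ⊠ emb b) \o linfun_of id_D_linear)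
  (g := @emb K _ \o (@tassoc_inv K A A A \o tmap idfun (t1l b)))) => a c.
rewrite -[LHS]/(id_D D _ * _) -[RHS]/(emb (tassoc_inv (tmap _ _ _))).
rewrite id_D_tens tmap_tens -massoc_tens -mpullM mtensM mulr1 -emb_t1 -emb_tens.
by rewrite mpull_emb.
Qed.

Lemma slice_assoc_inv w w' (u : A ⊗ (A ⊗ A)) :
  slice1 w (slice2 w' (tassoc_inv u)) = slice2 w' (slice1 w u).
Proof.
apply: (ext3r (f := slice1 w \o (slice2 w' \o @tassoc_inv K A A A))
  (g := slice2 w' \o slice1 w)) => [||x y z]; try exact: linearP.
rewrite -[LHS]/(slice1 w (slice2 w' (tassoc_inv _))) -[RHS]/(slice2 w' (slice1 w _)).
have -> : slice1 w (x ⊗ (y ⊗ z)) = w x *: (y ⊗ z) by apply: slice1E.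
rewrite tassoc_invE; have -> : slice2 w' (x ⊗ y ⊗ z) = w' z *: (x ⊗ y).
  exact: slice2E.
by rewrite [slice1 w _]linearZ [slice2 w' _]linearZ /= slice1E slice2E !scalerA mulrC.
Qed.

(** Both sides of coassociativity lie in A ⊗ A ⊗ A: one is [t2] with c fixed, applied to the first
    leg of Δ(a)(1 ⊗ b), the other is [t1] with b fixed, applied to the second leg of (c ⊗ 1)Δ(a).
    Slices of the two outer legs separate such elements. *)
Lemma coassociativeP : coassociative D <->
  forall w c w' b a, slice1 w (t2 (slice2 w' (t1 a b)) c) =
    slice2 w' (t1 (slice1 w (t2 a c)) b).
Proof.
have eqs w c w' b a : slice1 w (slice2 w' (tmap (t2l c) idfun (t1 a b))) =
    slice1 w (t2 (slice2 w' (t1 a b)) c).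
  by rewrite slice2_tmap slice2_idfun.
have eqs' w c w' b a :
    slice1 w (slice2 w' (tassoc_inv (tmap idfun (t1l b) (t2 a c)))) =
    slice2 w' (t1 (slice1 w (t2 a c)) b).
  by rewrite slice_assoc_inv slice1_tmap slice1_idfun.
split=> [co w c w' b a|co a b c u1 u2 u1E u2E].
  rewrite -eqs -eqs'; congr (slice1 w (slice2 w' _)).
  apply: (emb_inj (nondegenerate_tens ndAA ndA)).
  by rewrite -emb_D_id -emb_id_D; apply: (co a).
rewrite emb_D_id emb_id_D -(embI (etrans (emb_t1 a b) (esym u1E))).
rewrite -(embI (etrans (emb_t2 a c) (esym u2E))); congr emb.
apply: slice2_inj => w'; apply: slice1_inj => w.
by rewrite eqs eqs' co.
Qed.

End T12.

(* (1 ⊗ x)Δ(s)(1 ⊗ y) links t3 to t1, so that a linear map which commutes with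
   the slices of t1 commutes with those of t3; similarly for t4 and t2. *)
Lemma coassociative34 (t1 t2 t3 t4 : A -> A -> A ⊗ A) :
  (forall a b, emb (t1 a b) = D a * (1 ⊠ emb b)) ->
  (forall a c, emb (t2 a c) = (emb c ⊠ 1) * D a) ->
  (forall a b, emb (t3 a b) = (1 ⊠ emb b) * D a) ->
  (forall a c, emb (t4 a c) = D a * (emb c ⊠ 1)) ->
  (forall w c w' b a, slice1 w (t2 (slice2 w' (t1 a b)) c) =
    slice2 w' (t1 (slice1 w (t2 a c)) b)) ->
  forall w c w' b a, slice1 w (t4 (slice2 w' (t3 a b)) c) =
    slice2 w' (t3 (slice1 w (t4 a c)) b).
Proof.
move=> E1 E2 E3 E4 co w c w' b a.
have b2 : bilin t2 by apply: (leg1_linear (m := @emb K A)); do 3!right.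
have b3 : bilin t3 by apply: (leg1_linear (m := @emb K A)); right; left.
have e13 s x y : mr (1 ⊠ emb y) (t3 s x) = ml (1 ⊠ emb x) (t1 s y).
  by apply: embI; rewrite emb_ml emb_mr E1 E3 mulrA.
have e24 s x y : ml (emb y ⊠ 1) (t4 s x) = mr (emb x ⊠ 1) (t2 s y).
  by apply: embI; rewrite emb_ml emb_mr E2 E4 mulrA.
have co3 v d s x : slice1 v (t2 (slice2 w' (t3 s x)) d) =
    slice2 w' (t3 (slice1 v (t2 s d)) x).
  pose h : {linear A -> A} := slice1 v \o linfun_of (b2.1 d).
  have h1 y : tmap h idfun (t1 s y) = t1 (h s) y.
    by apply: slice2_inj => u; rewrite slice2_tmap slice2_idfun; apply: co.
  rewrite -[LHS]/(h _) -(slice2_idfun w' (t3 s x)) -(slice2_tmap h idfun).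
  congr (slice2 w' _); apply: (cancel_mr2 ndA) => y; rewrite e13 -h1.
  rewrite -tmap_mr2 -tmap_ml2; congr (tmap h idfun _); exact: e13.
pose g : {linear A -> A} := slice2 w' \o linfun_of (b3.1 b).
have g2 y : tmap idfun g (t2 a y) = t2 (g a) y.
  by apply: slice1_inj => u; rewrite slice1_tmap slice1_idfun; apply: esym (co3 _ _ _ _).
rewrite -[RHS]/(g _) -(slice1_idfun w (t4 a c)) -(slice1_tmap idfun g).
congr (slice1 w _); apply: (cancel_ml1 ndA) => y; rewrite e24 -g2.
by rewrite -tmap_mr1 -tmap_ml1; congr (tmap idfun g _); apply: esym (e24 _ _ _).
Qed.

End Coassociativity.

(** * The axioms on T_1 in multiplier form *)

Section FirstMap.
Variables (K : fieldType) (A : nuAlgType K) (D : A -> multiplier (A ⊗ A)).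
Variables (E : multiplier (A ⊗ A)) (t1 : A -> A -> A ⊗ A).
Variables (B : lmodType K) (iB : B -> multiplier A) (G : A ⊗ A -> A ⊗ A).
Hypothesis ndA : nondegenerate_alg A.
Hypothesis D_linear : linear D.
Hypothesis ED : forall a, E * D a = D a.
Hypothesis emb_t1 : forall a b, emb (t1 a b) = D a * (1 ⊠ emb b).
Hypothesis H : T1_spec D E t1 iB G.

Let embI : injective (@emb K (A ⊗ A)%type) := emb_inj (nondegenerate_tens ndA ndA).
Let t1_bilin : bilin t1.
Proof. by apply: (leg1_linear ndA D_linear (m := @emb K A)); left. Qed.

Lemma T1_bilin : bilin (fun a b => D a * (1 ⊠ emb b)).
Proof.
split=> [b k a a'|a k b b'].
- by rewrite D_linear mulrDl multZl.
- by rewrite emb_linear (mtens_linear2 1) mulrDr multZr.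
Qed.
Lemma T1_tens a b : T1 D (a ⊗ b) = D a * (1 ⊠ emb b).
Proof. exact/tliftE/T1_bilin. Qed.

Lemma T1E x : T1 D x = emb (tlift t1 x).
Proof.
apply: (tensor_ext (f := linfun_of (tlift_linear T1_bilin))
  (g := @emb K _ \o linfun_of (tlift_linear t1_bilin))) => a b.
by rewrite -[LHS]/(T1 D _) -[RHS]/(emb (tlift t1 _)) T1_tens tliftE // emb_t1.
Qed.

Lemma range_T1 : range (T1 D) = range (fun x => emb (ml E x)).
Proof.
apply/seteqP; split=> [_ [x _ <-]|_ [x _ <-]].
- exists (tlift t1 x) => //; rewrite T1E; congr emb.
  apply: (tensor_ext (f := ml E \o linfun_of (tlift_linear t1_bilin))
    (g := linfun_of (tlift_linear t1_bilin))) => a b.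
  rewrite -[LHS]/(ml E (tlift t1 _)) -[RHS]/(tlift t1 _) tliftE //.
  by apply: embI; rewrite emb_ml emb_t1 mulrA ED.
- by have [y yE] := spec_range H x; exists y => //; rewrite T1E yE.
Qed.

Lemma ker_T1 : [set x | T1 D x = 0] = range (fun x => x - G x).
Proof.
rewrite -(spec_ker H); apply/seteqP; split=> x /= x0.
- by apply: embI; rewrite -T1E x0 [RHS]linear0.
- by rewrite T1E x0 linear0.
Qed.

Lemma full1 (V : set A) : is_subspace V ->
  (forall a b, in_tens V setT (D a * (1 ⊠ emb b))) -> V = setT.
Proof.
move=> sV Vt; apply: (spec_full H sV) => a b.
by have [t tV] := Vt a b; rewrite -emb_t1 => /embI ->.
Qed.

Let tswap_bilin a : bilin (fun b c : A => tswap (t1 a c ⊗ b) : (A ⊗ A ⊗ A)%type).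
Proof.
split=> [c k b b'|b k c c']; first by rewrite !linearP.
by rewrite (t1_bilin.2 a) tensDl tensZl linearP.
Qed.

Lemma emb_tswap_t1 a b c :
  emb (tswap (t1 a c ⊗ b)) = D13 D a * (1 ⊠ emb b ⊠ emb c).
Proof.
rewrite -(mswap_tens 1 (emb c) (emb b)) -mpullM mtensM mul1r -emb_t1 -emb_tens.
by rewrite mpull_emb.
Qed.

Lemma T1_spec_is_G1 : is_G1 D E G.
Proof.
split=> [|a b c]; first exact: spec_linear H.
(* Δ_13(a)(1 ⊗ b ⊗ c) is an element of A ⊗ A ⊗ A because Δ(a)(1 ⊗ c) is one of A ⊗ A. *)
exists (tswap (t1 a c ⊗ b)); split; first exact: emb_tswap_t1.
rewrite -[tmap G id]/(tmap G idfun) (spec_D13 H).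
rewrite -massoc_tens -mulrA -mpullM mtensM mul1r -emb_tens -emb_ml.
pose right1 : {linear multiplier (A ⊗ A) -> multiplier (A ⊗ (A ⊗ A))} :=
  linfun_of (@mtens_linear2 K A _ 1).
apply: (tensor_ext (f := @emb K _ \o linfun_of (tlift_linear (tswap_bilin a)))
  (g := mlmul (D13 D a) \o (linfun_of (mpull_linear (assoc_iso A A A)) \o
     (right1 \o @emb K (A ⊗ A)%type)))) => x y.
rewrite -[LHS]/(emb (tlift _ _)) -[RHS]/(_ * mpull _ (1 ⊠ emb _)) tliftE //.
by rewrite emb_tswap_t1 emb_tens massoc_tens.
Qed.

End FirstMap.

(** * The axioms on T_2, read off from (A^op, Δ^cop) *)

Section SecondMap.
Variables (K : fieldType) (A : nuAlgType K) (D : A -> multiplier (A ⊗ A)).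
Variables (E : multiplier (A ⊗ A)) (t2 : A -> A -> A ⊗ A).
Variables (C : lmodType K) (iC : C -> multiplier (nop A)).
Variables (G : (nop A ⊗ nop A)%type -> (nop A ⊗ nop A)%type).
Hypothesis ndA : nondegenerate_alg A.
Hypothesis D_linear : linear D.
Hypothesis DE : forall a, D a * E = D a.
Hypothesis emb_t2 : forall a c, emb (t2 a c) = (emb c ⊠ 1) * D a.
Let t2op (a b : nop A) : (nop A ⊗ nop A)%type := tflip (t2 a b).
Hypothesis H : T1_spec (fun a : nop A => mopc (D a)) (mopc E) t2op iC G.

Let embI : injective (@emb K (A ⊗ A)%type) := emb_inj (nondegenerate_tens ndA ndA).
Let t2_bilin : bilin t2.
Proof. by apply: (leg1_linear ndA D_linear (m := @emb K A)); do 3!right. Qed.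
(* The same maps, with A^op replaced by its underlying vector space A. *)
Let t2f (a b : A) : A ⊗ A := tflip (t2 a b).
Let Gf : A ⊗ A -> A ⊗ A := G.
Let t2f_bilin : bilin t2f.
Proof.
by split=> [b k a a'|a k b b']; rewrite /t2f ?(t2_bilin.1 b) ?(t2_bilin.2 a) linearP.
Qed.
Let Gf_linear : linear Gf := spec_linear H.
Let range_t2f (y : A ⊗ A) : exists y', tlift t2f y' = tflip (mr E (tflip y)).
Proof. exact: (spec_range H y). Qed.
Let ker_t2f : [set y | tlift t2f y = 0] = range (fun y => y - Gf y).
Proof. exact: (spec_ker H). Qed.
Let Gf_D13 (a b c : A) : tmap Gf idfun (tswap (t2f a c ⊗ b)) =
  tlift (fun b' c' : A => tswap (t2f a c' ⊗ b')) (tflip (mr E (tflip (b ⊗ c)))).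
Proof. exact: (spec_D13 H a b c). Qed.

(** The map obtained for (A^op, Δ^cop) has its legs exchanged; the two flips restore them. *)
Definition G2 (x : A ⊗ A) : A ⊗ A := tflip (Gf (tflip x)).

Lemma G2_linear : linear G2.
Proof. by move=> k u v; rewrite /G2 !linearP Gf_linear linearP. Qed.

Lemma T2_bilin : bilin (fun c a => (emb c ⊠ 1) * D a).
Proof.
split=> [a k c c'|c k a a'].
- by rewrite emb_linear (mtens_linear1 1) mulrDl multZl.
- by rewrite D_linear mulrDr multZr.
Qed.
Lemma T2_tens c a : T2 D (c ⊗ a) = (emb c ⊠ 1) * D a.
Proof. exact/tliftE/T2_bilin. Qed.

Lemma T2E x : T2 D x = emb (tflip (tlift t2f (tflip x))).
Proof.
apply: (tensor_ext (f := linfun_of (tlift_linear T2_bilin))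
  (g := @emb K _ \o (@tflip K A A \o (linfun_of (tlift_linear t2f_bilin) \o
    @tflip K A A)))) => c a.
rewrite -[LHS]/(T2 D _) -[RHS]/(emb (tflip (tlift t2f (tflip (c ⊗ a))))).
by rewrite T2_tens tflipE tliftE // /t2f tflipK emb_t2.
Qed.

Lemma range_T2 : range (T2 D) = range (fun x => emb (mr E x)).
Proof.
apply/seteqP; split=> [_ [x _ <-]|_ [x _ <-]].
- exists (tflip (tlift t2f (tflip x))) => //; rewrite emb_mr -T2E.
  apply: (tensor_ext (f := mrmul E \o linfun_of (tlift_linear T2_bilin))
    (g := linfun_of (tlift_linear T2_bilin))) => c a.
  by rewrite -[LHS]/(T2 D _ * E) -[RHS]/(T2 D _) T2_tens -mulrA DE.
- have [y yE] := range_t2f (tflip x); exists (tflip y) => //.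
  by rewrite T2E tflipK yE !tflipK.
Qed.

Lemma ker_T2 : [set x | T2 D x = 0] = range (fun x => x - G2 x).
Proof.
apply/seteqP; split=> [x x0|_ [x _ <-]].
- have : [set y | tlift t2f y = 0] (tflip x).
    apply: (can_inj (@tflipK K A A)); apply: embI; rewrite -T2E.
    by rewrite [LHS]x0 [tflip 0]linear0 [RHS]linear0.
  rewrite ker_t2f => -[y _ yE]; exists (tflip y) => //.
  by rewrite /G2 tflipK -[x in RHS]tflipK -yE linearB.
- have : range (fun y => y - Gf y) (tflip x - Gf (tflip x)) by exists (tflip x).
  rewrite -ker_t2f => /= h.
  rewrite T2E (_ : tflip (x - G2 x) = tflip x - Gf (tflip x)).
    by rewrite h linear0 [LHS]linear0.
  by rewrite linearB /G2 /= tflipK.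
Qed.

Lemma tens_sub_flip (V W : set A) (t : A ⊗ A) :
  tens_sub V W t -> tens_sub W V (tflip t).
Proof.
have [s0 sD] := tens_sub_subspace W V; move: t; apply: lspan_sub.
  by split=> [|k u v]; rewrite /= ?linear0 // linearP; apply: sD.
by move=> _ [v [w [Vv Ww ->]]]; rewrite /= tflipE; apply: tens_sub_tens.
Qed.

Lemma full2 (W : set A) : is_subspace W ->
  (forall a c, in_tens setT W ((emb c ⊠ 1) * D a)) -> W = setT.
Proof.
move=> sW Wt; apply: (spec_full H sW) => a b.
by have [t tV] := Wt a b; rewrite -emb_t2 => /embI tE; apply: tens_sub_flip; rewrite tE.
Qed.

Lemma emb_tswap_t2 a b c :
  emb (tswap (t2 c a ⊗ b)) = (emb a ⊠ emb b ⊠ 1) * D13 D c.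
Proof.
rewrite -(mswap_tens (emb a) 1 (emb b)) -mpullM mtensM mulr1 -emb_t2 -emb_tens.
by rewrite mpull_emb.
Qed.

(** Reversing the three legs turns G ⊗ ι into ι ⊗ G_2 and the elements built from the flip of (a ⊗
    1)Δ(c) into those built from (a ⊗ 1)Δ(c), so this is the mirror image of [spec_D13]. *)
Lemma T1_spec_is_G2 : is_G2 D E G2.
Proof.
split=> [|a b c]; first exact: G2_linear.
exists (tswap (t2 c a ⊗ b)); split; first exact: emb_tswap_t2.
pose Gl : {linear (A ⊗ A)%type -> (A ⊗ A)%type} := linfun_of Gf_linear.
pose G2l : {linear (A ⊗ A)%type -> (A ⊗ A)%type} := linfun_of G2_linear.
have G_rev u : tassoc_inv (tmap id G2 (tassoc (rev3 u))) = rev3 (tmap Gf idfun u).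
  apply: (tensor_ext
    (f := @tassoc_inv K A A A \o (tmap idfun G2l \o (@tassoc K A A A \o @rev3 K A)))
    (g := @rev3 K A \o tmap Gl idfun)) => t z.
  rewrite -[LHS]/(tassoc_inv (tmap _ _ (tassoc (rev3 _)))) -[RHS]/(rev3 (tmap _ _ _)).
  rewrite !rev3E tassoc_invK !tmap_tens rev3E.
  by rewrite -[G2l _]/(tflip (Gf (tflip _))) tflipK.
have rev_tswap (s : A ⊗ A) (y : A) : rev3 (tswap (tflip s ⊗ y)) = tswap (s ⊗ y).
  apply: (tensor_ext (f := @rev3 K A \o (@tswap K A A A \o
      (linfun_of ((tens_bilin (A ⊗ A)%type A).1 y) \o @tflip K A A)))
    (g := @tswap K A A A \o linfun_of ((tens_bilin (A ⊗ A)%type A).1 y))) => u v.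
  rewrite -[LHS]/(rev3 (tswap (tflip _ ⊗ y))) -[RHS]/(tswap (_ ⊗ y)).
  by rewrite tflipE !tswapE rev3E tflipE tassoc_invE.
rewrite -(rev_tswap (t2 c a) b) G_rev Gf_D13 tflipE.
pose left1 : {linear multiplier (A ⊗ A) -> multiplier (A ⊗ A ⊗ A)} :=
  linfun_of (@mtens_linear1 K _ A 1).
have tsw_bilin : bilin (fun b' c' : A => tswap (t2f c c' ⊗ b') : (A ⊗ A ⊗ A)%type).
  split=> [y k x x'|x k y y']; first by rewrite !linearP.
  by rewrite (t2f_bilin.2 c) tensDl tensZl linearP.
have embD y : emb (rev3 (tlift (fun b' c' : A => tswap (t2f c c' ⊗ b')) (tflip y))) =
    (emb y ⊠ 1) * D13 D c.
  apply: (tensor_ext (f := @emb K _ \o (@rev3 K A \o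
      (linfun_of (tlift_linear tsw_bilin) \o @tflip K A A)))
    (g := mrmul (D13 D c) \o (left1 \o @emb K (A ⊗ A)%type))) => u v.
  rewrite -[LHS]/(emb (rev3 (tlift _ (tflip (u ⊗ v))))).
  rewrite -[RHS]/((emb (_ ⊗ _) ⊠ 1) * _) tflipE tliftE // /t2f rev_tswap.
  by rewrite emb_tswap_t2 emb_tens.
rewrite embD emb_mr emb_tens /E12; congr (_ * _).
by rewrite mtensM mulr1.
Qed.

End SecondMap.

(** * Extension of homomorphisms to multiplier algebras *)

Section HomExtension.
Variables (K : fieldType) (X Y : nuAlgType K) (f : X -> multiplier Y).
Variable p : multiplier Y.
Hypothesis ndY : nondegenerate_alg Y.
Hypothesis f_hom : alg_hom f.
Hypothesis pp : p * p = p.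
Hypothesis pf : forall x, p * f x = f x.
Hypothesis fp : forall x, f x * p = f x.
Hypothesis span_l : forall y, lspan [set z | exists x y, z = ml (f x) y] (ml p y).
Hypothesis span_r : forall y, lspan [set z | exists x y, z = mr (f x) y] (mr p y).

Let fl x y : ml p (ml (f x) y) = ml (f x) y.
Proof. by rewrite -[LHS]/(ml (p * f x) y) pf. Qed.
Let lf x y : ml (f x) (ml p y) = ml (f x) y.
Proof. by rewrite -[LHS]/(ml (f x * p) y) fp. Qed.
Let fr x y : mr p (mr (f x) y) = mr (f x) y.
Proof. by rewrite -[LHS]/(mr (f x * p) y) fp. Qed.
Let rf x y : mr (f x) (mr p y) = mr (f x) y.
Proof. by rewrite -[LHS]/(mr (p * f x) y) pf. Qed.
Let lM x x' y : ml (f x) (ml (f x') y) = ml (f (x ** x')) y.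
Proof. by rewrite f_hom.2. Qed.
Let rM x x' y : mr (f x') (mr (f x) y) = mr (f (x ** x')) y.
Proof. by rewrite f_hom.2. Qed.

(** As z = pz, the product yz depends only on yp, which is a combination of elements y'f(x). *)
Lemma hom_ext_uniq_l z z' : ml p z = z -> ml p z' = z' ->
  (forall x, ml (f x) z = ml (f x) z') -> z = z'.
Proof.
move=> pz pz' zz'; apply: (nmull_inj ndY) => y; rewrite -pz -pz' !mlr.
move: (mr p y) (span_r y); apply: lspan_sub => [|_ [x [y' ->]]].
  exact: (@eq_subspace K Y Y (mr (emb z)) (mr (emb z'))).
by rewrite /= -!mlr zz'.
Qed.
Lemma hom_ext_uniq_r z z' : mr p z = z -> mr p z' = z' ->
  (forall x, mr (f x) z = mr (f x) z') -> z = z'.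
Proof.
move=> pz pz' zz'; apply: (nmulr_inj ndY) => y; rewrite -pz -pz' -!mlr.
move: (ml p y) (span_l y); apply: lspan_sub => [|_ [x [y' ->]]].
  exact: (@eq_subspace K Y Y (nmul z) (nmul z')).
by rewrite /= !mlr zz'.
Qed.

(* The image of y under the extension of m is the only z in pY such that
   f(x)z = f(xm)y for all x. *)
Lemma hom_ext_ex_l (m : multiplier X) y :
  exists z, ml p z = z /\ forall x, ml (f x) z = ml (f (mr m x)) y.
Proof.
suff [z [pz zE]] : exists z, ml p z = z /\
    forall x, ml (f x) z = ml (f (mr m x)) (ml p y).
  by exists z; split=> // x; rewrite zE lf.
move: (ml p y) (span_l y); apply: lspan_sub => [|_ [x [y' ->]]].
  split=> [|k u v [z [pz zE]] [z' [pz' z'E]]].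
    by exists 0; split=> [|x]; rewrite ?ml0.
  by exists (k *: z + z'); split=> [|x]; rewrite ml_linear ?pz ?pz' // zE z'E ml_linear.
(* At f(x)y' the solution is f(mx)y', because f(x')f(mx)y' = f((x'm)x)y'. *)
by exists (ml (f (ml m x)) y'); split=> [|x']; rewrite ?fl // !lM mlr.
Qed.
Lemma hom_ext_ex_r (m : multiplier X) y :
  exists z, mr p z = z /\ forall x, mr (f x) z = mr (f (ml m x)) y.
Proof.
suff [z [pz zE]] : exists z, mr p z = z /\
    forall x, mr (f x) z = mr (f (ml m x)) (mr p y).
  by exists z; split=> // x; rewrite zE rf.
move: (mr p y) (span_r y); apply: lspan_sub => [|_ [x [y' ->]]].
  split=> [|k u v [z [pz zE]] [z' [pz' z'E]]].
    by exists 0; split=> [|x]; rewrite ?mr0.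
  by exists (k *: z + z'); split=> [|x]; rewrite mr_linear ?pz ?pz' // zE z'E mr_linear.
by exists (mr (f (mr m x)) y'); split=> [|x']; rewrite ?fr // !rM mlr.
Qed.

Definition hom_ext_l m y : Y := projT1 (cid (hom_ext_ex_l m y)).
Definition hom_ext_r m y : Y := projT1 (cid (hom_ext_ex_r m y)).
Lemma hom_ext_lp m y : ml p (hom_ext_l m y) = hom_ext_l m y.
Proof. by case: (projT2 (cid (hom_ext_ex_l m y))). Qed.
Lemma hom_ext_lE m y x : ml (f x) (hom_ext_l m y) = ml (f (mr m x)) y.
Proof. by case: (projT2 (cid (hom_ext_ex_l m y))). Qed.
Lemma hom_ext_rp m y : mr p (hom_ext_r m y) = hom_ext_r m y.
Proof. by case: (projT2 (cid (hom_ext_ex_r m y))). Qed.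
Lemma hom_ext_rE m y x : mr (f x) (hom_ext_r m y) = mr (f (ml m x)) y.
Proof. by case: (projT2 (cid (hom_ext_ex_r m y))). Qed.

Section Extend.
Variable m : multiplier X.

Lemma hom_ext_l_linear : linear (hom_ext_l m).
Proof.
move=> k y z; apply: hom_ext_uniq_l => [||x]; rewrite ?ml_linear ?hom_ext_lp //.
by rewrite !hom_ext_lE ml_linear.
Qed.
Lemma hom_ext_r_linear : linear (hom_ext_r m).
Proof.
move=> k y z; apply: hom_ext_uniq_r => [||x]; rewrite ?mr_linear ?hom_ext_rp //.
by rewrite !hom_ext_rE mr_linear.
Qed.
Lemma hom_ext_l_mul y z : hom_ext_l m (y ** z) = hom_ext_l m y ** z.
Proof.
apply: hom_ext_uniq_l => [||x]; rewrite ?ml_mul ?hom_ext_lp //.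
by rewrite !hom_ext_lE ml_mul.
Qed.
Lemma hom_ext_r_mul y z : hom_ext_r m (y ** z) = y ** hom_ext_r m z.
Proof.
apply: hom_ext_uniq_r => [||x]; rewrite ?mr_mul ?hom_ext_rp //.
by rewrite !hom_ext_rE mr_mul.
Qed.
Lemma hom_ext_lr y z : y ** hom_ext_l m z = hom_ext_r m y ** z.
Proof.
have -> : hom_ext_r m y = hom_ext_r m (mr p y).
  apply: hom_ext_uniq_r => [||x]; rewrite ?hom_ext_rp //.
  by rewrite !hom_ext_rE rf.
rewrite -hom_ext_lp mlr; move: (mr p y) (span_r y).
apply: lspan_sub => [|_ [x [y' ->]]].
  exact: (@eq_subspace K Y Y (mr (emb (hom_ext_l m z)))
    (mr (emb z) \o linfun_of hom_ext_r_linear)).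
rewrite /= -mlr hom_ext_lE mlr; congr (_ ** _).
apply: hom_ext_uniq_r => [||x']; rewrite ?hom_ext_rp ?fr //.
by rewrite hom_ext_rE !rM mlr.
Qed.

Definition hom_ext : multiplier Y := Multiplier hom_ext_l_linear hom_ext_r_linear
  hom_ext_l_mul hom_ext_r_mul hom_ext_lr.

End Extend.

Lemma hom_extP : hom_extension f p hom_ext.
Proof.
split=> [k m n|m n|x|]; apply: (ml_inj ndY) => y; apply: hom_ext_uniq_l => /=.
- exact: hom_ext_lp.
- by rewrite ml_linear !hom_ext_lp.
- by move=> x; rewrite ml_linear !hom_ext_lE f_hom.1.
- exact: hom_ext_lp.
- exact: hom_ext_lp.
- by move=> x; rewrite !hom_ext_lE.
- exact: hom_ext_lp.
- exact: fl.
- by move=> x'; rewrite hom_ext_lE lM.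
- exact: hom_ext_lp.
- by rewrite -[LHS]/(ml (p * p) y) pp.
- by move=> x; rewrite hom_ext_lE lf.
Qed.

End HomExtension.

(** * From the setting to weak multiplier Hopf algebras *)

Section FromSetting.
Variables (K : fieldType) (A : nuAlgType K) (D : A -> multiplier (A ⊗ A)).
Variables (E : multiplier (A ⊗ A)) (t1 t2 t3 t4 : A -> A -> A ⊗ A).
Variables (B C : lmodType K).
Variables (iB : {linear B -> multiplier A}) (iC : {linear C -> multiplier A}).
Variables (SB : {linear B -> C}) (SC : {linear C -> B}).
Variables (TB : {linear C -> B}) (TC : {linear B -> C}).
Variables (e1 : B -> B ⊗ C) (e3 : C -> B ⊗ C).
Hypothesis S : setting D E t1 t2 t3 t4 iB iC SB SC TB TC e1 e3.

Let ndAA : nondegenerate_alg (A ⊗ A)%type := nondegenerate_tens (ndA S) (ndA S).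

Lemma setting_coproduct : coproduct D.
Proof.
split.
- by split; [exact: D_linear S|exact: D_mul S].
- by move=> x; rewrite (T1E (ndA S) (D_linear S) (emb_t1 S)); eexists.
- by move=> x; rewrite (T2E (ndA S) (D_linear S) (emb_t2 S)); eexists.
- apply/(coassociativeP (ndA S) (D_linear S) (emb_t1 S) (emb_t2 S)).
  exact: coass12 S.
Qed.

(** Since Δ(a)(u ⊗ v) is Δ(a)(1 ⊗ v) times u ⊗ 1, the range of E lies in A^2 ⊗ A. But the left legs
    of E(a ⊗ cb) are βa for the left legs β of E(1 ⊗ c), and these β span B; so A^2 contains BA =
    A. *)
Lemma setting_idempotent :
  (forall y, lspan [set z | exists a x, z = ml (D a) x] (ml E y)) -> idempotent_alg A.
Proof.
move=> spanE; pose V := lspan [set x : A | exists a b, x = a ** b].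
have sV : is_subspace V by apply: lspan_subspace.
have sVA := tens_sub_subspace V (@setT A).
have EV y : tens_sub V setT (ml E y).
  move: (ml E y) (spanE y); apply: lspan_sub => // _ [a [x ->]].
  elim/tensor_ind: x => [|u v x IH]; first by rewrite /= ml0; case: sVA.
  rewrite /= mlD; apply: (subspaceD sVA) => //; rewrite (D_tens S).
  elim/tensor_ind: (t1 a v) => [|x' y' t IHt]; first by rewrite mr0; case: sVA.
  rewrite mrD mul_tens2; apply: (subspaceD sVA) => //.
  by apply: tens_sub_tens => //; apply: lspan_incl; exists x', u.
apply: (subspace_setT sV) => w wV; apply: (lspanT_ind (spanBA S)) => [|_ [x [a ->]]].
  by split=> [|k u v wu wv]; rewrite ?linear0 // linearP /= wu wv mulr0 addr0.
apply: (leg1_e3 S (f := w \o (evl a \o iB))) => c.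
apply: (iC_inj S); rewrite linear0; apply: (ml_inj (ndA S)) => b.
have := slice1_sub wV (EV (a ⊗ ml (iC c) b)).
have -> : ml E (a ⊗ ml (iC c) b) = tmap (evl a \o iB) (evl b \o iC) (e3 c).
  by rewrite -ml_thom (thom_e3 S) /= (tmap_tens idfun (ml (iC c))).
by rewrite slice1_tmap.
Qed.

(** For u = a ⊗ cb and E(1 ⊗ c) a sum of β ⊗ γ, the right-hand side is the sum of Δ(βa) ⊗ γb, that
    is, of (1 ⊗ β ⊗ γ)(Δ(a) ⊗ b). This is the formula for (Δ ⊗ ι)E tested against (Δ ⊗ ι)(u). *)
Lemma E23_D_id : (forall a x, D (ml (iB x) a) = (1 ⊠ iB x) * D a) ->
  forall u, E23 E * D_id D u = D_id D (ml E u).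
Proof.
move=> DB.
pose Dil : {linear (A ⊗ A)%type -> multiplier (A ⊗ A ⊗ A)} :=
  linfun_of (D_id_linear (D_linear S)).
have DiE a b : Dil (a ⊗ b) = D a ⊠ emb b by apply: (D_id_tens (D_linear S)).
apply: (tensor_ext (f := mlmul (E23 E) \o Dil) (g := Dil \o ml E)) => a b.
rewrite -[LHS]/(E23 E * Dil _) -[RHS]/(Dil (ml E _)).
move: b; apply: (lspanT_ind (spanCA S)) => [|_ [c [b ->]]].
  exact: (@eq_subspace K A _ (mlmul (E23 E) \o (Dil \o tens a))
    (Dil \o (ml E \o tens a))).
have -> : ml E (a ⊗ ml (iC c) b) = tmap (evl a \o iB) (evl b \o iC) (e3 c).
  by rewrite -ml_thom (thom_e3 S) /= (tmap_tens idfun (ml (iC c))).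
rewrite DiE emb_ml -[D a]mul1r -mtensM mulrA -mtens11 -massoc_tens -mpullM mtensM.
rewrite mulr1 -(thom_e3 S).
pose right1 : {linear multiplier (A ⊗ A) -> multiplier (A ⊗ (A ⊗ A))} :=
  linfun_of (@mtens_linear2 K A _ 1).
apply: (tensor_ext (f := mrmul (D a ⊠ emb b) \o (linfun_of (mpull_linear (assoc_iso A A A)) \o
   (right1 \o thom iB iC))) (g := Dil \o tmap (evl a \o iB) (evl b \o iC))) => x y.
rewrite -[LHS]/(mpull _ (1 ⊠ thom _ _ _) * _) -[RHS]/(Dil (tmap _ _ _)).
by rewrite thomE massoc_tens tmap_tens DiE mtensM /= /evl DB emb_ml.
Qed.

Section WithIntegrals.
Variables (L1 L2 : set {scalar A}).
Hypothesis L1_faithful : right_faithful L1.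
Hypothesis L2_faithful : left_faithful L2.
Hypothesis L1_formula : forall psi, L1 psi -> right_formula t1 t3 iB SC e1 e3 psi.
Hypothesis L2_formula : forall phi, L2 phi -> left_formula t2 t4 iC SB e1 e3 phi.

(** On A^op left and right faithfulness are interchanged, and so are the two kinds of invariance
    formulas; hence [L1] and [L2] change places. *)
Lemma opcop_T1_spec : exists G, T1_spec (fun a : nop A => mopc (D a)) (mopc E)
  (fun a b : nop A => tflip (t2 a b) : (nop A ⊗ nop A)%type) (@mop K A \o iC) G.
Proof.
have f1 phi : L2 phi -> right_formula (fun a b : nop A => tflip (t2 a b) : (nop A ⊗ nop A)%type)
    (fun a b : nop A => tflip (t4 a b) : (nop A ⊗ nop A)%type) (@mop K A \o iC) SB
    (fun c => tensor_swap _ _ (e3 c)) (fun b => tensor_swap _ _ (e1 b)) phi.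
  by move=> /L2_formula; apply: right_formula_opcop.
have f2 psi : L1 psi -> left_formula (fun a b : nop A => tflip (t1 a b) : (nop A ⊗ nop A)%type)
    (fun a b : nop A => tflip (t3 a b) : (nop A ⊗ nop A)%type) (@mop K A \o iB) SC
    (fun c => tensor_swap _ _ (e3 c)) (fun b => tensor_swap _ _ (e1 b)) psi.
  by move=> /L1_formula; apply: left_formula_opcop.
eexists; exact: (setting_T1_spec (setting_opcop S)
  (L2_faithful : @right_faithful K (nop A) L2) (L1_faithful : @left_faithful K (nop A) L1) f1 f2).
Qed.

(** This is Δ(ab) = Δ(a)(1 ⊗ b), b in B, read in (A^op, Δ^cop), where C takes the place of B. *)
Lemma D_mulC a x : D (ml (iC x) a) = (iC x ⊠ 1) * D a.
Proof.
have [G HG] := opcop_T1_spec; have := spec_mulB HG a x.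
rewrite -[RHS]/(mopc (D a) * (1 ⊠ mop (iC x))) -mop1 -mopc_tens -mopcM => h.
exact: mopc_inj h.
Qed.

Lemma setting_weak : E * E = E -> idempotent_alg A -> coproduct_of_idempotent D E ->
  weak_multiplier_hopf D.
Proof.
move=> EE idA DE'; have [G2 HG2] := opcop_T1_spec.
have HG1 := setting_T1_spec S L1_faithful L2_faithful L1_formula L2_formula.
split=> //; first exact: ndA S.
- exact: setting_coproduct.
- split=> [V|W]; first exact: (full1 (ndA S) (emb_t1 S) HG1).
  exact: (full2 (ndA S) (emb_t2 S) HG2).
exists E; split=> //.
- split.
    exact: (range_T1 (ndA S) (D_linear S) (ED S) (emb_t1 S) HG1).
  exact: (range_T2 (ndA S) (D_linear S) (DE S) (emb_t2 S) HG2).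
- eexists; last exact: (ker_T1 (ndA S) (D_linear S) (emb_t1 S) HG1).
  exact: (T1_spec_is_G1 (ndA S) (D_linear S) (emb_t1 S) HG1).
- eexists; last exact: (ker_T2 (ndA S) (D_linear S) (emb_t2 S) HG2).
  exact: (T1_spec_is_G2 (ndA S) (D_linear S) (emb_t2 S) HG2).
Qed.

End WithIntegrals.
End FromSetting.

Lemma in_alg_choice (K : fieldType) (A : nuAlgType K)
  (f : A -> A -> multiplier (A ⊗ A)) : bilin f ->
  regular_map (tlift f) -> exists t, forall a b, emb (t a b) = f a b.
Proof.
move=> bf reg; have [t tE] := choice (fun p : A * A => reg (p.1 ⊗ p.2)).
by exists (fun a b => t (a, b)) => a b; rewrite -(tE (a, b)) tliftE.
Qed.

(** * The extension of Δ ⊗ ι and its value at E *)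

Section Extension.
Variables (K : fieldType) (A : nuAlgType K) (D : A -> multiplier (A ⊗ A)).
Variable E : multiplier (A ⊗ A).
Hypothesis ndA : nondegenerate_alg A.
Hypothesis idA : idempotent_alg A.
Hypothesis D_hom : alg_hom D.
Hypothesis EE : E * E = E.
Hypothesis ED : forall a, E * D a = D a.
Hypothesis DE : forall a, D a * E = D a.
Hypothesis span_l : forall y, lspan [set z | exists a x, z = ml (D a) x] (ml E y).
Hypothesis span_r : forall y, lspan [set z | exists a x, z = mr (D a) x] (mr E y).

Let ndAAA : nondegenerate_alg (A ⊗ A ⊗ A)%type :=
  nondegenerate_tens (nondegenerate_tens ndA ndA) ndA.
Let Dil : {linear (A ⊗ A)%type -> multiplier (A ⊗ A ⊗ A)} :=
  linfun_of (D_id_linear D_hom.1).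
Let DilE a b : Dil (a ⊗ b) = D a ⊠ emb b. Proof. exact: (D_id_tens D_hom.1). Qed.

Lemma D_id_hom : alg_hom (D_id D).
Proof.
split=> [|x y]; first exact: (D_id_linear D_hom.1).
apply: (tensor_ext (f := Dil \o nmul x) (g := mlmul (D_id D x) \o Dil)) => a b.
apply: (tensor_ext (f := Dil \o mr (emb (a ⊗ b))) (g := mrmul (Dil (a ⊗ b)) \o Dil)).
move=> a' b'; rewrite -[LHS]/(Dil (_ ** _)) -[RHS]/(Dil _ * Dil _) tens_mul !DilE.
by rewrite D_hom.2 embM mtensM.
Qed.

Lemma E12_D_id x : E12 E * D_id D x = D_id D x.
Proof.
apply: (tensor_ext (f := mlmul (E12 E) \o Dil) (g := Dil)) => a b.
by rewrite -[LHS]/(E12 E * Dil _) DilE mtensM mul1r ED.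
Qed.
Lemma D_id_E12 x : D_id D x * E12 E = D_id D x.
Proof.
apply: (tensor_ext (f := mrmul (E12 E) \o Dil) (g := Dil)) => a b.
by rewrite -[LHS]/(Dil _ * E12 E) DilE mtensM mulr1 DE.
Qed.

(** The second leg has to be a product, one factor for each argument of (Δ ⊗ ι)(a ⊗ z)(u ⊗ z'); this
    is where A^2 = A enters. *)
Lemma D_id_span_l y : lspan [set z | exists x y, z = ml (D_id D x) y] (ml (E12 E) y).
Proof.
have sS := lspan_subspace [set z | exists x y, z = ml (D_id D x) y].
elim/tensor_ind: y => [|t z y IH]; first by rewrite ml0; case: sS.
rewrite mlD; apply: (subspaceD sS) => //; rewrite mul_tens1 /=.
move: z; apply: (lspanT_ind idA) => [|_ [z [z' ->]]].
  by split=> [|k u v Su Sv]; [rewrite linear0; case: sS | rewrite linearP; apply: sS.2].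
move: (ml E t) (span_l t); apply: lspan_sub => [|_ [a [u ->]]].
  split=> [|k v v' Sv Sv']; first by rewrite /= tens0l; case: sS.
  by rewrite /= tensDl tensZl; apply: sS.2.
apply: lspan_incl; exists (a ⊗ z), (u ⊗ z').
by rewrite -[D_id D _]/(Dil _) DilE mul_tens1.
Qed.
Lemma D_id_span_r y : lspan [set z | exists x y, z = mr (D_id D x) y] (mr (E12 E) y).
Proof.
have sS := lspan_subspace [set z | exists x y, z = mr (D_id D x) y].
elim/tensor_ind: y => [|t z y IH]; first by rewrite mr0; case: sS.
rewrite mrD; apply: (subspaceD sS) => //; rewrite mul_tens2 /=.
move: z; apply: (lspanT_ind idA) => [|_ [z [z' ->]]].
  by split=> [|k u v Su Sv]; [rewrite linear0; case: sS | rewrite linearP; apply: sS.2].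
move: (mr E t) (span_r t); apply: lspan_sub => [|_ [a [u ->]]].
  split=> [|k v v' Sv Sv']; first by rewrite /= tens0l; case: sS.
  by rewrite /= tensDl tensZl; apply: sS.2.
apply: lspan_incl; exists (a ⊗ z'), (u ⊗ z).
by rewrite -[D_id D _]/(Dil _) DilE mul_tens2.
Qed.

(** The image of E and (E ⊗ 1)(1 ⊗ E) both absorb E ⊗ 1 on the right, the latter by commutation. It
    remains to compare them on the elements (Δ ⊗ ι)(x)z that span the range of E ⊗ 1, where both act
    by x ↦ Ex. *)
Lemma coproduct_of_idempotentP : E12 E * E23 E = E23 E * E12 E ->
  (forall u, E23 E * D_id D u = D_id D (ml E u)) -> coproduct_of_idempotent D E.
Proof.
move=> comm E23D; split=> //.
have pp : E12 E * E12 E = E12 E by rewrite mtensM EE mulr1.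
have [F ext] : exists F, hom_extension (D_id D) (E12 E) F.
  eexists; exact: (hom_extP ndAAA D_id_hom pp E12_D_id D_id_E12 D_id_span_l D_id_span_r).
exists F; split=> //; case: ext => _ FM Femb F1.
apply: (ml_inj ndAAA) => y.
have -> : F E = F E * E12 E by rewrite -F1 -FM mulr1.
have -> : E12 E * E23 E = E12 E * E23 E * E12 E.
  by rewrite comm -mulrA pp.
rewrite -[LHS]/(ml (F E) (ml (E12 E) y)) -[RHS]/(ml (E12 E * E23 E) (ml (E12 E) y)).
move: (ml (E12 E) y) (D_id_span_l y); apply: lspan_sub => [|_ [x [z ->]]].
  exact: (@eq_subspace K _ _ (ml (F E)) (ml (E12 E * E23 E))).
rewrite -[LHS]/(ml (F E * D_id D x) z) -[RHS]/(ml (E12 E * E23 E * D_id D x) z).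
by rewrite -mulrA E23D E12_D_id -Femb -FM -emb_ml Femb.
Qed.

End Extension.

(** * The setting and the invariance formulas from the hypotheses *)

Section Hypotheses.
Variables (K : fieldType) (A : nuAlgType K) (D : A -> multiplier (A ⊗ A)).
Hypotheses (hA : nondegenerate_alg A) (hD : regular_coproduct D).
Variable E : multiplier (A ⊗ A).
Hypothesis hE : E * E = E.
Hypothesis hEl : lspan [set y | exists a x, y = ml (D a) x] = range (ml E).
Hypothesis hEr : lspan [set y | exists a x, y = mr (D a) x] = range (mr E).
Hypothesis hDE : coproduct_of_idempotent D E.

Lemma range_lspan_l : forall y, lspan [set z | exists a x, z = ml (D a) x] (ml E y).
Proof. by move=> y; rewrite hEl; exists y. Qed.
Lemma range_lspan_r : forall y, lspan [set z | exists a x, z = mr (D a) x] (mr E y).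
Proof. by move=> y; rewrite hEr; exists y. Qed.

Let ndAA : nondegenerate_alg (A ⊗ A)%type := nondegenerate_tens hA hA.

(** Δ(a)x lies in the range of E, on which E acts as the identity because E^2 = E. *)
Lemma idempotent_mul_D a : E * D a = D a.
Proof.
apply: (ml_inj ndAA) => x.
have : range (ml E) (ml (D a) x) by rewrite -hEl; apply: lspan_incl; exists a, x.
by case=> y _ yE; rewrite /= -yE -[LHS]/(ml (E * E) y) hE.
Qed.
Lemma D_mul_idempotent a : D a * E = D a.
Proof.
apply: (mr_inj ndAA) => x.
have : range (mr E) (mr (D a) x) by rewrite -hEr; apply: lspan_incl; exists a, x.
by case=> y _ yE; rewrite /= -yE -[LHS]/(mr (E * E) y) hE.
Qed.

Variables (B C : nuAlgType K) (iB : B -> multiplier A) (iC : C -> multiplier A).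
Hypotheses (hB : sits_nondegenerately iB) (hC : sits_nondegenerately iC).
Variable EBC : multiplier (B ⊗ C).
Variable F : multiplier (B ⊗ C) -> multiplier (A ⊗ A).
Hypothesis hF : hom_extension (tens_hom iB iC) 1 F.
Hypothesis FE : F EBC = E.
Variables (SB : anti_iso B C) (SC : anti_iso C B).
Hypothesis hsep : regular_separability_idempotent EBC SB SC.

Let ndB : nondegenerate_alg B := sits_nondegenerate hA hB.
Let ndC : nondegenerate_alg C := sits_nondegenerate hA hC.

Let thF x : thom (incl hB) (incl hC) x = F (emb x).
Proof. by rewrite (ext_emb hB hC hF). Qed.
Let FM m n : F (m * n) = F m * F n.
Proof. exact: extM hF _ _. Qed.

Lemma exists_setting : exists t1 t2 t3 t4, setting D E t1 t2 t3 t4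
  (incl hB) (incl hC) (anti_lin SB) (anti_lin SC) (anti_inv_lin SB) (anti_inv_lin SC)
  (sep1 hsep) (sep3 hsep).
Proof.
case: hD => -[[D_lin D_mul] r1 r2 co] r3 r4.
have [t1 t1E] := in_alg_choice (T1_bilin D_lin) r1.
have [t2 t2E] := in_alg_choice (T2_bilin D_lin) r2.
have [|t3 t3E] := in_alg_choice _ r3.
  split=> [b k a a'|a k b b'].
  - by rewrite D_lin mulrDr multZr.
  - by rewrite emb_linear (mtens_linear2 1) mulrDl multZl.
have [|t4 t4E] := in_alg_choice _ r4.
  split=> [a k c c'|c k a a'].
  - by rewrite emb_linear (mtens_linear1 1) mulrDr multZr.
  - by rewrite D_lin mulrDl multZl.
have co12 := (coassociativeP hA D_lin t1E (fun a c => t2E c a)).1 co.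
have mBC x : mulBC (incl hB) (anti_lin SC) x = incl hB (prodB SC x).
  apply: (tensor_ext (f := mulBC (incl hB) (anti_lin SC))
    (g := incl hB \o prodB SC)) => b c.
  rewrite mulBCE -[RHS]/(incl hB (prodB SC _)) prodBE !inclE.
  by case: (hB) => -[_ ->].
have mCB x : mulCB (incl hC) (anti_lin SB) x = incl hC (prodC SB x).
  apply: (tensor_ext (f := mulCB (incl hC) (anti_lin SB))
    (g := incl hC \o prodC SB)) => b c.
  rewrite mulCBE -[RHS]/(incl hC (prodC SB _)) prodCE !inclE.
  by case: (hC) => -[_ ->].
have [lB lC] : (forall b, incl hB b ⊠ 1 = F (emb b ⊠ 1)) /\
    (forall c, 1 ⊠ incl hC c = F (1 ⊠ emb c)).
  by split=> b; rewrite ?(ext_left hA hB hC hF) ?(ext_right hA hB hC hF) inclE.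
have injB : injective (incl hB) by rewrite inclE; case: (hB).
have injC : injective (incl hC) by rewrite inclE; case: (hC).
(* T_2 and T_4 take their arguments in the order c ⊗ a, whereas the setting puts the argument of Δ
   first. *)
exists t1, (fun a c => t2 c a), t3, (fun a c => t4 c a); split=> //.
- exact: idempotent_mul_D.
- exact: D_mul_idempotent.
- exact: (coassociative34 hA D_lin t1E (fun a c => t2E c a) t3E (fun a c => t4E c a) co12).
- by rewrite inclE; case: (hB).
- by rewrite inclE; case: (hB).
- by rewrite inclE; case: (hC).
- by rewrite inclE; case: (hC).
- exact: anti_toK.
- exact: anti_invK.
- exact: anti_toK.
- exact: anti_invK.
- by move=> b; rewrite lB lC -FE -!FM (sep_SB hsep).
- by move=> c; rewrite lB lC -FE -!FM (sep_SC hsep).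
- by move=> b; rewrite thF emb_sep1 FM FE -lB.
- by move=> b; rewrite (tau_sep1 ndB ndC) thF emb_sep2 FM FE -lB.
- by move=> c; rewrite thF emb_sep3 FM FE -lC.
- by move=> c; rewrite (tau_sep3 ndB ndC) thF emb_sep4 FM FE -lC.
- by move=> b; rewrite mBC (prodB_sep1 ndB ndC).
- by move=> c; rewrite mCB (prodC_sep3 ndB ndC).
- move=> f f0.
  exact: (@sep_leg1 _ _ _ _ _ _ ndB ndC hsep f (or_intror (fun c => f0 (SC c)))).
- by move=> f f0; exact: (@sep_leg1 _ _ _ _ _ _ ndB ndC hsep f (or_introl f0)).
- by move=> f f0; exact: (@sep_leg2 _ _ _ _ _ _ ndB ndC hsep f (or_introl f0)).
- move=> f f0.
  exact: (@sep_leg2 _ _ _ _ _ _ ndB ndC hsep f (or_intror (fun b => f0 (SB b)))).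
Qed.

Notation iBl := (incl hB).
Notation iCl := (incl hC).
Notation SBl := (anti_lin SB).
Notation SCl := (anti_lin SC).
Notation TBl := (anti_inv_lin SB).
Notation TCl := (anti_inv_lin SC).

Section Push.
Variables (X Y : nuAlgType K) (iX : X -> multiplier A) (iY : Y -> multiplier A).
Hypotheses (hX : sits_nondegenerately iX) (hY : sits_nondegenerately iY).
Variables (m0 : multiplier (X ⊗ Y)) (m : multiplier (A ⊗ A)).
Hypothesis hm : extends_to (tens_hom iX iY) 1 m0 m.

(** The extension to M(A ⊗ A) is multiplicative and known on each leg, so a product that falls into
    X ⊗ Y can be computed there and carried over. *)
Lemma push_l1 x t : (emb x ⊠ 1) * m0 = emb t ->
  (incl hX x ⊠ 1) * m = thom (incl hX) (incl hY) t.
Proof.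
case: hm => H [hH <-] m0t; rewrite inclE -(ext_left hA hX hY hH) -(extM hH) m0t.
exact: (ext_emb hX hY hH).
Qed.
Lemma push_r1 x t : m0 * (emb x ⊠ 1) = emb t ->
  m * (incl hX x ⊠ 1) = thom (incl hX) (incl hY) t.
Proof.
case: hm => H [hH <-] m0t; rewrite inclE -(ext_left hA hX hY hH) -(extM hH) m0t.
exact: (ext_emb hX hY hH).
Qed.
Lemma push_l2 x t : (1 ⊠ emb x) * m0 = emb t ->
  (1 ⊠ incl hY x) * m = thom (incl hX) (incl hY) t.
Proof.
case: hm => H [hH <-] m0t; rewrite inclE -(ext_right hA hX hY hH) -(extM hH) m0t.
exact: (ext_emb hX hY hH).
Qed.
Lemma push_r2 x t : m0 * (1 ⊠ emb x) = emb t ->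
  m * (1 ⊠ incl hY x) = thom (incl hX) (incl hY) t.
Proof.
case: hm => H [hH <-] m0t; rewrite inclE -(ext_right hA hX hY hH) -(extM hH) m0t.
exact: (ext_emb hX hY hH).
Qed.

End Push.

Lemma F1_is_F1 F1 m : is_id_anti EBC SC F1 -> extends_to (tens_hom iB iB) 1 F1 m ->
  is_F1 iBl SCl (sep1 hsep) (sep3 hsep) m.
Proof.
move=> hF1 hm; split=> x.
- by apply: (push_l1 hB hB hm); apply: (id_anti1 ndB ndC ndB hF1); apply: emb_sep1.
- rewrite -[x](anti_invK SC); apply: (push_r2 hB hB hm).
  by apply: (id_anti4 ndB ndC ndB hF1); apply: emb_sep4.
- by apply: (push_l2 hB hB hm); apply: (id_anti3 ndB ndC ndB hF1); apply: emb_sep3.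
Qed.

Lemma F2_is_F2 F2 m : is_anti_id EBC SB F2 -> extends_to (tens_hom iC iC) 1 F2 m ->
  is_F2 iCl SBl (sep1 hsep) (sep3 hsep) m.
Proof.
move=> hF2 hm; split=> x.
- by apply: (push_r2 hC hC hm); apply: (anti_id3 ndB ndC ndC hF2); apply: emb_sep3.
- rewrite -[x](anti_invK SB); apply: (push_l1 hC hC hm).
  by apply: (anti_id2 ndB ndC ndC hF2); apply: emb_sep2.
- by apply: (push_r1 hC hC hm); apply: (anti_id1 ndB ndC ndC hF2); apply: emb_sep1.
Qed.

Notation e1' := (fun c => swap_anti SBl SCl (sep3 hsep c)).
Notation e3' := (fun b => swap_anti SBl SCl (sep1 hsep b)).

(** For Δ^cop the idempotent is ζE and S_C^{-1} replaces S_C, so the role of F_1 falls to (ι ⊗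
    S_C^{-1})ζE = ζF_4. *)
Lemma F4_is_F1 F4 m : is_anti_id EBC (anti_inv SC) F4 ->
  extends_to (tens_hom iC iC) 1 F4 m -> is_F1 iCl TCl e1' e3' (mcop m).
Proof.
rewrite -[anti_inv SC]/(anti_to (anti_iso_inv SC)) => hF4 hm.
have swapE x : thom iCl iCl (tmap idfun TCl (tensor_swap _ _ x)) =
    mcop (thom iCl iCl (tmap (anti_lin (anti_iso_inv SC)) idfun x)).
  by rewrite -tensor_swap_tmap thom_cop.
split=> x.
- rewrite /swap_anti (tau_sep3 ndB ndC) swapE -mcop_tens -mcopM; congr mcop.
  by apply: (push_l2 hC hC hm); apply: (anti_id4 ndB ndC ndC hF4); apply: emb_sep4.
- rewrite /swap_anti (tau_sep3 ndB ndC) swapE -mcop_tens -mcopM; congr mcop.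
  rewrite -{1}[x](anti_toK SC); apply: (push_r1 hC hC hm).
  by apply: (anti_id1 ndB ndC ndC hF4); apply: emb_sep1.
- rewrite /swap_anti (tau_sep1 ndB ndC) swapE -mcop_tens -mcopM; congr mcop.
  by apply: (push_l1 hC hC hm); apply: (anti_id2 ndB ndC ndC hF4); apply: emb_sep2.
Qed.

(** Here S_B^{-1} replaces S_B, and (S_B^{-1} ⊗ ι)ζE = ζF_3. *)
Lemma F3_is_F2 F3 m : is_id_anti EBC (anti_inv SB) F3 ->
  extends_to (tens_hom iB iB) 1 F3 m -> is_F2 iBl TBl e1' e3' (mcop m).
Proof.
rewrite -[anti_inv SB]/(anti_to (anti_iso_inv SB)) => hF3 hm.
have swapE x : thom iBl iBl (tmap TBl idfun (tensor_swap _ _ x)) =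
    mcop (thom iBl iBl (tmap idfun (anti_lin (anti_iso_inv SB)) x)).
  by rewrite -tensor_swap_tmap thom_cop.
split=> x.
- rewrite /swap_anti (tau_sep1 ndB ndC) swapE -mcop_tens -mcopM; congr mcop.
  by apply: (push_r1 hB hB hm); apply: (id_anti2 ndB ndC ndB hF3); apply: emb_sep2.
- rewrite /swap_anti (tau_sep1 ndB ndC) swapE -mcop_tens -mcopM; congr mcop.
  rewrite -{1}[x](anti_toK SB); apply: (push_l2 hB hB hm).
  by apply: (id_anti3 ndB ndC ndB hF3); apply: emb_sep3.
- rewrite /swap_anti (tau_sep3 ndB ndC) swapE -mcop_tens -mcopM; congr mcop.
  by apply: (push_r2 hB hB hm); apply: (id_anti4 ndB ndC ndB hF3); apply: emb_sep4.
Qed.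

Lemma cop_range_l y :
  lspan [set z | exists a x, z = ml (cop D a) x] (ml (mcop E) y).
Proof.
have sS := lspan_subspace [set z | exists a x, z = ml (cop D a) x].
rewrite -[ml (mcop E) y]/(tflip (ml E (tflip y))).
move: (ml E _) (range_lspan_l (tflip y)); apply: lspan_sub => [|_ [a [x ->]]].
  by split=> [|k u v Su Sv]; rewrite /= ?linear0 ?linearP; [case: sS|apply: sS.2].
by apply: lspan_incl; exists a, (tflip x); rewrite /= tflipK.
Qed.
Lemma cop_range_r y :
  lspan [set z | exists a x, z = mr (cop D a) x] (mr (mcop E) y).
Proof.
have sS := lspan_subspace [set z | exists a x, z = mr (cop D a) x].
rewrite -[mr (mcop E) y]/(tflip (mr E (tflip y))).
move: (mr E _) (range_lspan_r (tflip y)); apply: lspan_sub => [|_ [a [x ->]]].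
  by split=> [|k u v Su Sv]; rewrite /= ?linear0 ?linearP; [case: sS|apply: sS.2].
by apply: lspan_incl; exists a, (tflip x); rewrite /= tflipK.
Qed.

Variables (F1 F3 : multiplier (B ⊗ B)) (F2 F4 : multiplier (C ⊗ C)).
Hypotheses (hF1 : is_id_anti EBC SC F1) (hF2 : is_anti_id EBC SB F2).
Hypotheses (hF3 : is_id_anti EBC (anti_inv SB) F3).
Hypotheses (hF4 : is_anti_id EBC (anti_inv SC) F4).

Section Integrals.
Variables t1 t2 t3 t4 : A -> A -> A ⊗ A.
Hypothesis S : setting D E t1 t2 t3 t4 iBl iCl SBl SCl TBl TCl (sep1 hsep) (sep3 hsep).
Let S' := setting_cop S.

Lemma right_integral_formula psi : right_integral D iB F1 F3 psi ->
  right_formula t1 t3 iBl SCl (sep1 hsep) (sep3 hsep) psi.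
Proof.
case=> _ h; apply: (right_formula_of S) => a; have [n [Dn _ [m mF1 mn] _]] := h a.
by exists n, m; split=> //; apply: F1_is_F1 hF1 mF1.
Qed.
Lemma left_integral_formula phi : left_integral D iC F2 F4 phi ->
  left_formula t2 t4 iCl SBl (sep1 hsep) (sep3 hsep) phi.
Proof.
case=> _ h; apply: (left_formula_of S) => a; have [n [Dn _ _ [m mF2 mn]]] := h a.
by exists n, m; split=> //; apply: F2_is_F2 hF2 mF2.
Qed.
(** The flip turns (ι ⊗ φ)((1 ⊗ a)F_4) into (φ ⊗ ι)((a ⊗ 1)ζF_4), the form of invariance of a right
    integral for Δ^cop. *)
Lemma left_integral_cop phi : left_integral D iC F2 F4 phi ->
  right_formula (flip2 t4) (flip2 t2) iCl TCl e1' e3' phi.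
Proof.
case=> _ h; apply: (right_formula_of S') => a; have [n [Dn _ [m mF4 mn] _]] := h a.
exists n, (mcop m); split; first exact: is_fun_id_cop Dn.
  exact: F4_is_F1 hF4 mF4.
by rewrite -mcop_tens -mcopM; apply: is_fun_id_cop.
Qed.
Lemma right_integral_cop psi : right_integral D iB F1 F3 psi ->
  left_formula (flip2 t3) (flip2 t1) iBl TBl e1' e3' psi.
Proof.
case=> _ h; apply: (left_formula_of S') => a; have [n [Dn _ _ [m mF3 mn]]] := h a.
exists n, (mcop m); split; first exact: is_id_fun_cop Dn.
  exact: F3_is_F2 hF3 mF3.
by rewrite -mcop_tens -mcopM; apply: is_id_fun_cop.
Qed.

End Integrals.

Lemma weak_multiplier_hopf_of_integrals (L L' : set {scalar A}) :
  left_faithful L -> (forall phi, L phi -> left_integral D iC F2 F4 phi) ->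
  right_faithful L' -> (forall psi, L' psi -> right_integral D iB F1 F3 psi) ->
  weak_multiplier_hopf D.
Proof.
move=> fL iL fL' iL'; have [t1 [t2 [t3 [t4 S]]]] := exists_setting.
apply: (setting_weak S fL' fL) => //.
- by move=> psi /iL'; apply: right_integral_formula S _.
- by move=> phi /iL; apply: left_integral_formula S _.
- exact: setting_idempotent S range_lspan_l.
Qed.

(** For Δ^cop the left integrals act as right integrals, so they have to be right faithful, and the
    right integrals left faithful. The other two faithfulness conditions serve as well: the formula
    for (Δ^cop ⊗ ι)ζE rests on Δ(ca) = (c ⊗ 1)Δ(a), which [D_mulC] provides for Δ itself. *)
Lemma weak_multiplier_hopf_cop (L L' : set {scalar A}) :
  faithful L -> (forall phi, L phi -> left_integral D iC F2 F4 phi) ->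
  faithful L' -> (forall psi, L' psi -> right_integral D iB F1 F3 psi) ->
  weak_multiplier_hopf (cop D).
Proof.
move=> [fLl fLr] iL [fLl' fLr'] iL'; have [t1 [t2 [t3 [t4 S]]]] := exists_setting.
have S' := setting_cop S; have idA := setting_idempotent S range_lspan_l.
have EE : mcop E * mcop E = mcop E by rewrite -mcopM hE.
apply: (setting_weak S' fLr fLl') => //.
- by move=> phi /iL; apply: left_integral_cop S _.
- by move=> psi /iL'; apply: right_integral_cop S _.
apply: (coproduct_of_idempotentP hA idA _ EE (ED S') (DE S') cop_range_l cop_range_r).
- by split; [exact: D_linear S'|exact: D_mul S'].
- by apply: E12_E23_cop => //; case: hDE.
apply: (E23_D_id S') => a x; rewrite -mcop_tens -mcopM; congr mcop.
apply: (D_mulC S fLr' fLl).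
- by move=> psi /iL'; apply: right_integral_formula S _.
- by move=> phi /iL; apply: left_integral_formula S _.
Qed.

End Hypotheses.

Theorem theorem3p18 (R : realType) (A : nuAlgType R[i])
  (D : A -> multiplier (A ⊗ A))
  (hA : nondegenerate_alg A) (hD : regular_coproduct D)
  (E : multiplier (A ⊗ A)) (hE : E * E = E)
  (hEl : lspan [set y | exists a x, y = ml (D a) x] = range (ml E))
  (hEr : lspan [set y | exists a x, y = mr (D a) x] = range (mr E))
  (hDE : coproduct_of_idempotent D E)
  (B C : nuAlgType R[i]) (iB : B -> multiplier A) (iC : C -> multiplier A)
  (hB : sits_nondegenerately iB) (hC : sits_nondegenerately iC)
  (EBC : multiplier (B ⊗ C)) (hEBC : extends_to (tens_hom iB iC) 1 EBC E)
  (SB : anti_iso B C) (SC : anti_iso C B)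
  (hsep : regular_separability_idempotent EBC SB SC)
  (F1 F3 : multiplier (B ⊗ B)) (F2 F4 : multiplier (C ⊗ C))
  (hF1 : is_id_anti EBC SC F1) (hF2 : is_anti_id EBC SB F2)
  (hF3 : is_id_anti EBC (anti_inv SB) F3)
  (hF4 : is_anti_id EBC (anti_inv SC) F4) :
  ((exists2 L : set {scalar A}, left_faithful L &
      forall phi, L phi -> left_integral D iC F2 F4 phi) ->
   (exists2 L : set {scalar A}, right_faithful L &
      forall psi, L psi -> right_integral D iB F1 F3 psi) ->
   weak_multiplier_hopf D) /\
  ((exists2 L : set {scalar A}, faithful L &
      forall phi, L phi -> left_integral D iC F2 F4 phi) ->
   (exists2 L : set {scalar A}, faithful L &
      forall psi, L psi -> right_integral D iB F1 F3 psi) ->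
   regular_weak_multiplier_hopf D).
Proof.
have [F [hF FE]] := hEBC.
have weak := @weak_multiplier_hopf_of_integrals _ A D hA hD E hE hEl hEr hDE B C iB iC
  hB hC EBC F hF FE SB SC hsep F1 F3 F2 F4 hF1 hF2.
split=> [[L fL iL] [L' fL' iL']|[L fL iL] [L' fL' iL']].
  exact: weak fL iL fL' iL'.
split=> //; first exact: weak fL.1 iL fL'.2 iL'.
exact: (@weak_multiplier_hopf_cop _ A D hA hD E hE hEl hEr hDE B C iB iC
  hB hC EBC F hF FE SB SC hsep F1 F3 F2 F4 hF1 hF2 hF3 hF4 L L' fL iL fL' iL').
Qed.
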